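(* Let $\alpha=[a_0;a_1, \dots, a_{k_0}, \overline{a_{k_0+1}, \dots, a_{k_0+p}}]$ be a quadratic irrational (eventually periodic with period $p$), and assume that $\max_{1 \le r \le p} (\log a_{k_0+r})/a_{k_0+r+1} \le T$ with some constant $T \ge 1$. For $1\le r\le p$ let $G_{\alpha,r}(x)=\lim P_{q_k}(\alpha,(-1)^k x/q_k)$, the pointwise limit as $k\to\infty$ along $k\in p\mathbb{N}+k_0+r$. Then for any $1\le r \le p$ and any real $x$ with $|x| \le \max \{ 1, 2-2/a_{k_0+r+1} \}$, \[ \begin{split} G_{\alpha, r}(x) = &|2 \sin (\pi x)| \cdot \left| 1+\frac{C_r-D_r}{x+1} \right| \cdot \left| 1+\frac{C_r}{x} \right| \cdot \left| 1+\frac{D_r}{x-1} \right| \\ & \times \exp \Bigg( C_r \left( \log \frac{a_{k_0+r}}{2 \pi} - \frac{\Gamma' (2+x)}{\Gamma (2+x)} \right) + O \left( \frac{T+\log (a_{k_0+r-1}a_{k_0+r})}{(2-|x|)a_{k_0+r} a_{k_0+r+1}} + \frac{T}{(2-|x|)^2 a_{k_0+r+1}^2} \right) \Bigg) , \end{split} \] where $\Gamma$ is the Gamma function, $C_r=\lim_{m \to \infty} q_{k_0+r+mp} \| q_{k_0+r+mp} \alpha \|$ and $D_r=\lim_{m \to \infty} q_{k_0+r-1+mp} \| q_{k_0+r+mp} \alpha \|$, and the implied constant in $O$ is universal.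
   Context: For real $\alpha,x$ and integer $N\ge0$, the shifted Sudler product is $P_N(\alpha,x)=\prod_{n=1}^N|2\sin(\pi(n\alpha+x))|$. $q_k$ are the denominators of the convergents $p_k/q_k=[a_0;a_1,\dots,a_k]$; $\|y\|$ is the distance from $y$ to the nearest integer. The overline denotes the period of the continued fraction. For quadratic irrationals the limits $G_{\alpha,r}$ are known to exist pointwise on $\mathbb{R}$.
   Formalization: In the error term, a_{k_0+r-1} is read periodically as a_{k_0+r-1+p}; this matters only for r=1, where the literal a_{k_0} makes the bound false or undefined. At x=-1,0,1 the product before exp is taken by continuity. *)

(* Defs.v *)
From Stdlib Require Import Reals Lra Lia ZArith.
From Coquelicot Require Import Coquelicot.
Open Scope R_scope.

Definition floorR (y : R) : Z := Int_part y.

Definition dist_int (y : R) : R :=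
  Rmin (y - IZR (floorR y)) (IZR (floorR y) + 1 - y).

Definition irrational (a : R) : Prop :=
  ~ (exists (m n : Z), n <> 0%Z /\ a = IZR m / IZR n).

Fixpoint cf_state (alpha : R) (n : nat) : R :=
  match n with
  | O => alpha
  | S m => let y := cf_state alpha m in / (y - IZR (floorR y))
  end.

Definition cf_digit (alpha : R) (n : nat) : Z := floorR (cf_state alpha n).

Definition aR (alpha : R) (n : nat) : R := IZR (cf_digit alpha n).

(* (q_{k-1}, q_k) with q_{-1} = 0, q_0 = 1, q_{k+1} = a_{k+1} q_k + q_{k-1} *)
Fixpoint q_pair (alpha : R) (k : nat) : nat * nat :=
  match k with
  | O => (0%nat, 1%nat)
  | S j => let (qm, qj) := q_pair alpha j in
           (qj, (Z.to_nat (cf_digit alpha (S j)) * qj + qm)%nat)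
  end.

Definition qden (alpha : R) (k : nat) : nat := snd (q_pair alpha k).

Fixpoint sudler (alpha x : R) (N : nat) : R :=
  match N with
  | O => 1
  | S n => sudler alpha x n * Rabs (2 * sin (PI * (INR (S n) * alpha + x)))
  end.

Definition Gamma (z : R) : R :=
  RInt_gen (fun t => Rpower t (z - 1) * exp (- t)) (at_right 0) (Rbar_locally p_infty).

Definition digamma (z : R) : R := Derive Gamma z / Gamma z.

Definition prefactor_raw (C D x : R) : R :=
  Rabs (2 * sin (PI * x)) * Rabs (1 + (C - D) / (x + 1)) * Rabs (1 + C / x)
  * Rabs (1 + D / (x - 1)).

(* Its value, extended by continuity at the removable singularities x = -1, 0, 1 *)
Definition prefactor (C D x : R) : R :=
  if Req_EM_T x 0 then real (Lim (prefactor_raw C D) x)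
  else if Req_EM_T x 1 then real (Lim (prefactor_raw C D) x)
  else if Req_EM_T x (-1) then real (Lim (prefactor_raw C D) x)
  else prefactor_raw C D x.

(* Main.v *)
Require Import Defs.
From Stdlib Require Import Reals Lra Lia ZArith List Permutation.
From Coquelicot Require Import Coquelicot.
Open Scope R_scope.

(** For |x| < 2 only the factors j = 0, 1, -1 can vanish at C_k = 0, so exactly these three are kept
    exact: every other j + x stays at distance at least 2 - |x| from the zeros 0 and q of the sine,
    and its logarithm can be linearized. The perturbation C_k (1 - {j beta}) is nonnegative, so it
    can only push an argument towards the zero at q; the condition |x| <= max (1, 2 - 2/a) keeps it
    within two thirds of the available distance. Pairing j with q - j turns the weights 1 - {j beta}
    into 1 - 2 {j beta}. The digamma part also yields - gamma, which cancels the + gamma of the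
    sawtooth part, and - ln beta becomes ln a up to 1/a. The scaled cotangent is close to 1/j only
    for small j, so the sawtooth sum is reached by summation by parts against a decreasing weight. A
    single beta_k may be close to 1, so the recursion contracts only over two steps. For r = 1 the
    digit preceding a_(k0+r) along the limit is the last one of the period, hence it is read at
    index k0 + r - 1 + p. *)

(* Put q = q_k, q' = q_(k-1), beta = q'/q and C_k = q ||q alpha||. The substitution
   n = q - (j q' mod q) turns P_q(alpha, (-1)^k x / q) into the product over j mod q of
   |2 sin (pi (j + x + C_k (1 - {j beta})) / q)|. The factors j = 0, 1, -1, together with the
   product of the others at C_k = 0, converge to the prefactor. The logarithm of the remaining
   ratio is C_k times a cotangent sum, up to O(C_k^2 / (2 - |x|)^2). Splitting off the
   x-dependence of that sum, which produces - digamma (2 + x), leaves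
   sum_j (1 - 2 {j beta}) / j.
   Truncated at N, the latter equals - ln beta + gamma - ln (2 pi) minus beta times the same sum
   for {1 / beta} truncated at floor (N beta), up to O(beta + 1 / floor (N beta)). Iterating this
   reciprocity law along beta_k = q_(k-1) / q_k, for which {1 / beta_k} = beta_(k-1), bounds the
   total deviation by (T + ln a_(k-1)) / a_k, since beta_k beta_(k-1) <= 1/2 and
   ln a_(k-1) <= T a_k. The constants are uniform in k, so k may tend to infinity. *)

(** * Finite sums, products and elementary trigonometry *)

Fixpoint psum (f : nat -> R) (n : nat) : R :=
  match n with O => 0 | S k => psum f k + f k end.

Fixpoint pprod (f : nat -> R) (n : nat) : R :=
  match n with O => 1 | S k => pprod f k * f k end.

Lemma psum_S f n : psum f (S n) = psum f n + f n.
Proof. reflexivity. Qed.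

Lemma psum_ext f g n : (forall i, (i < n)%nat -> f i = g i) -> psum f n = psum g n.
Proof.
  induction n as [|n IH]; simpl; intros Hfg; [easy|].
  rewrite IH, Hfg; auto with arith.
Qed.

Lemma psum_plus f g n : psum (fun i => f i + g i) n = psum f n + psum g n.
Proof. induction n as [|n IH]; simpl; [|rewrite IH]; ring. Qed.

Lemma psum_minus f g n : psum (fun i => f i - g i) n = psum f n - psum g n.
Proof. induction n as [|n IH]; simpl; [|rewrite IH]; ring. Qed.

Lemma psum_scal c f n : psum (fun i => c * f i) n = c * psum f n.
Proof. induction n as [|n IH]; simpl; [|rewrite IH]; ring. Qed.

Lemma psum_const c n : psum (fun _ => c) n = INR n * c.
Proof. induction n as [|n IH]; [simpl; ring|]. rewrite S_INR; simpl psum; rewrite IH; ring. Qed.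

Lemma psum_le f g n : (forall i, (i < n)%nat -> f i <= g i) -> psum f n <= psum g n.
Proof.
  induction n as [|n IH]; simpl; intros Hfg; [lra|].
  apply Rplus_le_compat; auto with arith.
Qed.

Lemma psum_nonneg f n : (forall i, (i < n)%nat -> 0 <= f i) -> 0 <= psum f n.
Proof.
  intros Hf. replace 0 with (psum (fun _ => 0) n) by (rewrite psum_const; ring).
  now apply psum_le.
Qed.

Lemma psum_abs_le f g n :
  (forall i, (i < n)%nat -> Rabs (f i) <= g i) -> Rabs (psum f n) <= psum g n.
Proof.
  induction n as [|n IH]; simpl; intros Hfg; [rewrite Rabs_R0; lra|].
  eapply Rle_trans; [apply Rabs_triang|].
  apply Rplus_le_compat; auto with arith.
Qed.

Lemma psum_app f n m : psum f (n + m) = psum f n + psum (fun i => f (n + i)%nat) m.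
Proof.
  induction m as [|m IH]; simpl.
  - rewrite Nat.add_0_r; ring.
  - rewrite Nat.add_succ_r; simpl; rewrite IH; ring.
Qed.

Lemma psum_S_l f n : psum f (S n) = f O + psum (fun i => f (S i)) n.
Proof. change (S n) with (1 + n)%nat; rewrite psum_app; simpl; ring. Qed.

Lemma psum_rev f n : psum (fun i => f (n - 1 - i)%nat) n = psum f n.
Proof.
  induction n as [|n IH]; [easy|].
  rewrite psum_S_l. simpl psum at 2. rewrite Rplus_comm. f_equal.
  - rewrite <- IH. apply psum_ext. intros i Hi. f_equal. lia.
  - f_equal. lia.
Qed.

Lemma psum_telescope f n : psum (fun i => f (S i) - f i) n = f n - f O.
Proof. induction n as [|n IH]; simpl; [|rewrite IH]; ring. Qed.

Lemma psum_abel (u w : nat -> R) n :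
  psum (fun i => u i * w i) n
  = psum (fun i => psum u (S i) * (w i - w (S i))) n + psum u n * w n.
Proof. induction n as [|n IH]; simpl; [|rewrite IH; simpl]; ring. Qed.

Lemma pprod_ext f g n : (forall i, (i < n)%nat -> f i = g i) -> pprod f n = pprod g n.
Proof.
  induction n as [|n IH]; simpl; intros Hfg; [easy|].
  rewrite IH, Hfg; auto with arith.
Qed.

Lemma pprod_mult f g n : pprod (fun i => f i * g i) n = pprod f n * pprod g n.
Proof. induction n as [|n IH]; simpl; [|rewrite IH]; ring. Qed.

Lemma pprod_app f n m : pprod f (n + m) = pprod f n * pprod (fun i => f (n + i)%nat) m.
Proof.
  induction m as [|m IH]; simpl.
  - rewrite Nat.add_0_r; ring.
  - rewrite Nat.add_succ_r; simpl; rewrite IH; ring.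
Qed.

Lemma pprod_S_l f n : pprod f (S n) = f O * pprod (fun i => f (S i)) n.
Proof. change (S n) with (1 + n)%nat; rewrite pprod_app; simpl; ring. Qed.

Lemma pprod_1 f : pprod f 1 = f O.
Proof. simpl; ring. Qed.

Lemma pprod_2 f : pprod f 2 = f O * f 1%nat.
Proof. simpl; ring. Qed.

Lemma pprod_exp f n : pprod (fun i => exp (f i)) n = exp (psum f n).
Proof. induction n as [|n IH]; simpl; [now rewrite exp_0|rewrite IH, exp_plus; ring]. Qed.

Lemma Rabs_between x : - Rabs x <= x <= Rabs x.
Proof. apply Rabs_le_between, Rle_refl. Qed.

Lemma Rinv_unit a : 1 <= a -> 0 < / a <= 1.
Proof.
  intros Ha. split; [apply Rinv_0_lt_compat; lra|].
  rewrite <- Rinv_1. apply Rinv_le_contravar; lra.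
Qed.

(** Otherwise 8/5 would lie in [0, PI/2], where the cosine is nonnegative; but its Taylor upper
    bound of degree 4 is negative at 8/5. *)
Lemma PI_lt_16_5 : PI < 16 / 5.
Proof.
  destruct (Rlt_dec PI (16 / 5)) as [H|H]; [easy|exfalso].
  pose proof (cos_ge_0 (8 / 5) ltac:(lra) ltac:(lra)).
  pose proof (pre_cos_bound (8 / 5) 0 ltac:(lra) ltac:(lra)) as [_ Hc].
  unfold cos_approx, cos_term in Hc; simpl in Hc. lra.
Qed.

Lemma PI_gt_3 : 3 < PI.
Proof. pose proof PI2_3_2. lra. Qed.

(** Follows from sin t >= t - t^3 / 6, because t^2 <= 3 on this interval. *)
Lemma sin_ge_half t : 0 <= t <= PI / 2 -> t / 2 <= sin t.
Proof.
  intros [Ht0 Ht1]. pose proof PI_lt_16_5.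
  assert (Ht : t <= 8 / 5) by lra.
  assert (Ht2 : t * t <= 8 / 5 * (8 / 5)) by (apply Rmult_le_compat; lra).
  pose proof (pre_sin_bound t 0 Ht0 ltac:(lra)) as [Hs _].
  unfold sin_approx, sin_term in Hs; simpl in Hs.
  assert (Ht3 : t * (t * t) <= t * 3) by (apply Rmult_le_compat_l; lra).
  lra.
Qed.

Lemma sin_ge_min t : 0 <= t <= PI -> Rmin t (PI - t) / 2 <= sin t.
Proof.
  intros Ht. destruct (Rle_dec t (PI / 2)) as [H|H].
  - rewrite Rmin_left by lra. apply sin_ge_half; lra.
  - rewrite Rmin_right by lra. rewrite <- sin_PI_x. apply sin_ge_half; lra.
Qed.

Lemma sin_le_self t : 0 <= t -> sin t <= t.
Proof.
  intros Ht. destruct (Req_dec t 0) as [->|H]; [rewrite sin_0; lra|].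
  apply Rlt_le, sin_lt_x; lra.
Qed.

(* [ctn q] is the logarithmic derivative of [y |-> sin (PI * y / q)]. *)
Definition ctn (q y : R) : R := PI / q * (cos (PI * y / q) / sin (PI * y / q)).

Lemma sin_arg_pos q y : 0 < y < q -> 0 < sin (PI * y / q).
Proof.
  intros [H0 H1]. pose proof PI_RGT_0.
  apply sin_gt_0.
  - apply Rdiv_lt_0_compat; nra.
  - apply Rmult_lt_reg_r with q; [lra|]. field_simplify; nra.
Qed.

(** The factor 1/2 lost in [sin_ge_min] is compensated by PI >= 2, which leaves the constant 1. *)
Lemma sin_arg_ge q y d : 0 < q -> 0 <= d -> d <= y <= q - d -> d / q <= sin (PI * y / q).
Proof.
  intros Hq Hd Hy. pose proof PI_RGT_0. pose proof PI_gt_3.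
  assert (Hy0 : 0 <= PI * y / q) by (apply Rdiv_le_0_compat; nra).
  assert (Hy1 : PI * y / q <= PI).
  { apply Rmult_le_reg_r with q; [lra|]. field_simplify; nra. }
  eapply Rle_trans; [|apply sin_ge_min; lra].
  assert (He : PI - PI * y / q = PI * (q - y) / q) by (field; lra).
  rewrite He.
  assert (Hd3 : 2 * (d / q) <= PI * d / q).
  { apply Rmult_le_reg_r with q; [lra|]. field_simplify; nra. }
  assert (PI * d / q <= PI * y / q /\ PI * d / q <= PI * (q - y) / q) as [Ha Hb].
  { split; apply Rmult_le_compat_r; try (left; apply Rinv_0_lt_compat; lra); nra. }
  unfold Rmin; destruct Rle_dec; lra.
Qed.

Lemma ctn_sub q y z : 0 < y < q -> 0 < z < q ->
  ctn q y - ctn q z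
  = PI / q * (sin (PI * (z - y) / q) / (sin (PI * y / q) * sin (PI * z / q))).
Proof.
  intros Hy Hz. pose proof (sin_arg_pos q y Hy). pose proof (sin_arg_pos q z Hz).
  replace (PI * (z - y) / q) with (PI * z / q - PI * y / q) by (field; lra).
  rewrite sin_minus. unfold ctn. field. lra.
Qed.

(** The constant 16 bounds PI^2. Separate distances [d] and [e] to the zeros are kept because later
    sums need the product of two different ones. *)
Lemma ctn_lipschitz q y z d e : 0 < d -> 0 < e -> d <= y <= q - d -> e <= z <= q - e ->
  Rabs (ctn q y - ctn q z) <= 16 * Rabs (z - y) / (d * e).
Proof.
  intros Hd He Hy Hz. pose proof PI_RGT_0 as Hpi. pose proof PI_4 as Hpi4.
  assert (Hq : 0 < q) by lra.
  rewrite ctn_sub by lra.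
  pose proof (sin_arg_ge q y d Hq ltac:(lra) Hy) as Hsy.
  pose proof (sin_arg_ge q z e Hq ltac:(lra) Hz) as Hsz.
  assert (Hdq : 0 < d / q) by (now apply Rdiv_lt_0_compat).
  assert (Heq : 0 < e / q) by (now apply Rdiv_lt_0_compat).
  assert (Hs : Rabs (sin (PI * (z - y) / q)) <= PI * Rabs (z - y) / q).
  { assert (Hw : forall t, Rabs (sin t) <= Rabs t).
    { assert (Hp : forall t, 0 <= t -> Rabs (sin t) <= t).
      { intros t Ht. destruct (Rle_dec t 1).
        - rewrite Rabs_pos_eq; [now apply sin_le_self|].
          apply sin_ge_0; [easy|]. pose proof PI_gt_3; lra.
        - pose proof (SIN_bound t). apply Rabs_le; lra. }
      intros t. destruct (Rle_dec 0 t).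
      - rewrite (Rabs_pos_eq t) by easy. auto.
      - rewrite <- (Rabs_Ropp t), <- (Rabs_Ropp (sin t)), <- sin_neg.
        rewrite (Rabs_pos_eq (- t)) by lra. apply Hp; lra. }
    eapply Rle_trans; [apply Hw|].
    unfold Rdiv. rewrite !Rabs_mult, (Rabs_pos_eq PI), (Rabs_pos_eq (/ q)); try lra.
    left; now apply Rinv_0_lt_compat. }
  unfold Rdiv at 1 2. rewrite !Rabs_mult, (Rabs_pos_eq PI), (Rabs_pos_eq (/ q));
    [|left; now apply Rinv_0_lt_compat|lra].
  rewrite (Rabs_pos_eq (/ _)).
  2:{ left; apply Rinv_0_lt_compat. apply Rmult_lt_0_compat; lra. }
  assert (Hi : / (sin (PI * y / q) * sin (PI * z / q)) <= / ((d / q) * (e / q))).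
  { apply Rinv_le_contravar; [now apply Rmult_lt_0_compat|].
    apply Rmult_le_compat; lra. }
  assert (Hi0 : 0 < / (sin (PI * y / q) * sin (PI * z / q))).
  { apply Rinv_0_lt_compat. apply Rmult_lt_0_compat; lra. }
  apply Rle_trans with (PI * / q * (PI * Rabs (z - y) / q * / ((d / q) * (e / q)))).
  - apply Rmult_le_compat_l.
    + apply Rmult_le_pos; [lra|]. left; now apply Rinv_0_lt_compat.
    + apply Rmult_le_compat; try lra. apply Rabs_pos.
  - replace (PI * / q * (PI * Rabs (z - y) / q * / (d / q * (e / q))))
      with ((PI * PI) * (Rabs (z - y) / (d * e))) by (field; lra).
    replace (16 * Rabs (z - y) / (d * e)) with (16 * (Rabs (z - y) / (d * e))) by (field; lra).
    apply Rmult_le_compat_r; [|nra].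
    apply Rdiv_le_0_compat; [apply Rabs_pos|nra].
Qed.

Lemma exp_le_compat x y : x <= y -> exp x <= exp y.
Proof.
  intros [H| ->]; [left; now apply exp_increasing|lra].
Qed.

(** * The product formula for the sine *)

(* Coefficients are listed from the constant term upwards; the leading 1 is implicit. *)
Fixpoint monic_eval (l : list C) (z : C) : C :=
  match l with
  | nil => RtoC 1
  | cons c l' => Cplus c (Cmult z (monic_eval l' z))
  end.

(** Synthetic division by z - r: the quotient collects the intermediate Horner values at r. *)
Lemma monic_eval_factor (l : list C) (c r : C) :
  exists l', length l' = length l /\
    forall z, Cminus (monic_eval (c :: l) z) (monic_eval (c :: l) r)
              = Cmult (Cminus z r) (monic_eval l' z).
Proof.
  revert c. induction l as [|d l IH]; intros c.
  - exists nil. split; [easy|]. intros z. simpl. ring.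
  - destruct (IH d) as [l' [Hlen Hl']].
    exists (monic_eval (d :: l) r :: l'). split; [simpl; congruence|].
    intros z. specialize (Hl' z).
    change (monic_eval (c :: d :: l) z) with (Cplus c (Cmult z (monic_eval (d :: l) z))).
    change (monic_eval (c :: d :: l) r) with (Cplus c (Cmult r (monic_eval (d :: l) r))).
    change (monic_eval (monic_eval (d :: l) r :: l') z)
      with (Cplus (monic_eval (d :: l) r) (Cmult z (monic_eval l' z))).
    replace (monic_eval (d :: l) z)
      with (Cplus (monic_eval (d :: l) r) (Cmult (Cminus z r) (monic_eval l' z)))
      by (rewrite <- Hl'; ring).
    ring.
Qed.

(** A root is divided out at each step; distinctness keeps the remaining ones roots of the quotient.
    Moduli suffice, since all factors of the Sudler product are absolute values. *)
Lemma monic_eval_roots (n : nat) (rt : nat -> C) (l : list C) (z : C) :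
  length l = n ->
  (forall i j, (i < n)%nat -> (j < n)%nat -> rt i = rt j -> i = j) ->
  (forall i, (i < n)%nat -> monic_eval l (rt i) = RtoC 0) ->
  Cmod (monic_eval l z) = pprod (fun i => Cmod (Cminus z (rt i))) n.
Proof.
  revert l. induction n as [|n IH]; intros l Hlen Hinj Hrt.
  - destruct l; [|discriminate]. simpl. now rewrite Cmod_1.
  - destruct l as [|c l]; [discriminate|].
    destruct (monic_eval_factor l c (rt n)) as [l' [Hlen' Hl']].
    assert (Hf : forall y, monic_eval (c :: l) y = Cmult (Cminus y (rt n)) (monic_eval l' y)).
    { intros y. rewrite <- Hl', (Hrt n) by lia. ring. }
    rewrite Hf, Cmod_mult. simpl pprod. rewrite Rmult_comm. f_equal.
    apply IH.
    + simpl in Hlen. congruence.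
    + intros i j Hi Hj. apply Hinj; lia.
    + intros i Hi. pose proof (Hrt i ltac:(lia)) as H0. rewrite Hf in H0.
      destruct (Ceq_dec (monic_eval l' (rt i)) (RtoC 0)) as [He|Hne]; [easy|].
      exfalso. apply (Cmult_neq_0 (Cminus (rt i) (rt n)) _) in Hne; [easy|].
      intros Hd. assert (i = n); [|lia].
      apply Hinj; try lia.
      replace (rt i) with (Cplus (Cminus (rt i) (rt n)) (rt n)) by ring.
      rewrite Hd. ring.
Qed.

Definition cis (t : R) : C := (cos t, sin t).

Lemma cis_pow t n : Cpow (cis t) n = cis (INR n * t).
Proof.
  induction n as [|n IH].
  - simpl. unfold cis. now rewrite Rmult_0_l, cos_0, sin_0.
  - rewrite S_INR. simpl Cpow. rewrite IH. unfold cis, Cmult; simpl.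
    replace ((INR n + 1) * t) with (t + INR n * t) by ring.
    rewrite cos_plus, sin_plus. f_equal; ring.
Qed.

Lemma Cmod_cis_minus a b : Cmod (Cminus (cis a) (cis b)) = Rabs (2 * sin ((a - b) / 2)).
Proof.
  rewrite <- sqrt_Rsqr_abs. unfold Cmod. f_equal.
  unfold Cminus, Cplus, Copp, cis, Rsqr; simpl.
  pose proof (cos_minus a b) as Hc.
  replace (a - b) with (2 * ((a - b) / 2)) in Hc by field.
  rewrite cos_2a_sin in Hc.
  pose proof (sin2_cos2 a) as Ha. pose proof (sin2_cos2 b) as Hb. unfold Rsqr in *. lra.
Qed.

Lemma monic_eval_zeros n z : monic_eval (repeat (RtoC 0) n) z = Cpow z n.
Proof.
  induction n as [|n IH]; [easy|]. simpl. rewrite IH. ring.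
Qed.

Definition unity_root (q i : nat) : C := cis (2 * PI * INR i / INR q).

Lemma unity_root_pow q i : (1 <= q)%nat -> Cpow (unity_root q i) q = RtoC 1.
Proof.
  intros Hq. assert (HqR : 0 < INR q) by (apply lt_0_INR; lia).
  unfold unity_root. rewrite cis_pow.
  replace (INR q * (2 * PI * INR i / INR q)) with (0 + 2 * INR i * PI) by (field; lra).
  unfold cis. now rewrite cos_period, sin_period, cos_0, sin_0.
Qed.

Lemma unity_root_inj q i j : (i < q)%nat -> (j < q)%nat ->
  unity_root q i = unity_root q j -> i = j.
Proof.
  assert (Hlt : forall i j, (i < j)%nat -> (j < q)%nat -> unity_root q i <> unity_root q j).
  { clear i j. intros i j Hij Hj He. apply lt_INR in Hij, Hj. pose proof (pos_INR i).
    assert (Hz : Cmod (Cminus (unity_root q j) (unity_root q i)) = 0).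
    { rewrite He. replace (Cminus _ _) with (RtoC 0) by ring. apply Cmod_0. }
    unfold unity_root in Hz. rewrite Cmod_cis_minus in Hz.
    replace ((2 * PI * INR j / INR q - 2 * PI * INR i / INR q) / 2)
      with (PI * (INR j - INR i) / INR q) in Hz by (field; lra).
    apply Rabs_eq_0 in Hz.
    pose proof (sin_arg_pos (INR q) (INR j - INR i) ltac:(lra)). lra. }
  intros Hi Hj He. destruct (Nat.lt_trichotomy i j) as [H|[H|H]]; [|easy|];
    exfalso; eapply Hlt; eauto.
Qed.

(** z^q - 1 is evaluated at z = exp (-2 pi i x / q): its modulus is the right side, and the
    distances of z from the q-th roots of unity are the factors. *)
Lemma sin_prod_shift (q : nat) (x : R) : (1 <= q)%nat ->
  pprod (fun j => Rabs (2 * sin (PI * (INR j + x) / INR q))) q = Rabs (2 * sin (PI * x)).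
Proof.
  intros Hq. assert (HqR : 0 < INR q) by (apply lt_0_INR; lia).
  pose (l := Copp (RtoC 1) :: repeat (RtoC 0) (q - 1)).
  assert (Hl : forall z, monic_eval l z = Cminus (Cpow z q) (RtoC 1)).
  { intros z. unfold l. simpl. rewrite monic_eval_zeros.
    replace q with (S (q - 1)) at 2 by lia. simpl. ring. }
  assert (H1 : RtoC 1 = cis 0) by (unfold cis; now rewrite cos_0, sin_0).
  pose proof (monic_eval_roots q (unity_root q) l (cis (- 2 * PI * x / INR q))) as Hm.
  rewrite Hl, cis_pow, H1, Cmod_cis_minus in Hm.
  replace ((INR q * (-2 * PI * x / INR q) - 0) / 2) with (- (PI * x)) in Hm by (field; lra).
  rewrite sin_neg, Ropp_mult_distr_r_reverse, Rabs_Ropp in Hm. rewrite Hm.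
  - apply pprod_ext. intros i _. unfold unity_root. rewrite Cmod_cis_minus.
    replace ((-2 * PI * x / INR q - 2 * PI * INR i / INR q) / 2)
      with (- (PI * (INR i + x) / INR q)) by (field; lra).
    now rewrite sin_neg, Ropp_mult_distr_r_reverse, Rabs_Ropp.
  - unfold l. simpl. rewrite repeat_length. lia.
  - intros i j. apply unity_root_inj.
  - intros i Hi. rewrite Hl, unity_root_pow by easy. ring.
Qed.

Lemma monic_eval_ones n z :
  Cmult (Cminus z (RtoC 1)) (monic_eval (repeat (RtoC 1) n) z) = Cminus (Cpow z (S n)) (RtoC 1).
Proof.
  induction n as [|n IH]; [simpl; ring|].
  transitivity (Cplus (Cminus z (RtoC 1))
    (Cmult z (Cmult (Cminus z (RtoC 1)) (monic_eval (repeat (RtoC 1) n) z)))); [simpl; ring|].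
  rewrite IH. simpl. ring.
Qed.

Lemma monic_eval_ones_1 n : monic_eval (repeat (RtoC 1) n) (RtoC 1) = RtoC (INR (S n)).
Proof.
  induction n as [|n IH]; [easy|].
  rewrite S_INR, RtoC_plus, <- IH. simpl. ring.
Qed.

(** Here 1 + z + ... + z^(q-1) is evaluated at z = 1. This version, without the factor j = 0, serves
    the removable singularities of the prefactor. *)
Lemma sin_prod (q : nat) : (1 <= q)%nat ->
  pprod (fun j => Rabs (2 * sin (PI * INR (S j) / INR q))) (q - 1) = INR q.
Proof.
  intros Hq. assert (HqR : 0 < INR q) by (apply lt_0_INR; lia).
  assert (H1 : RtoC 1 = unity_root q 0).
  { unfold unity_root, cis. simpl INR. replace (2 * PI * 0 / INR q) with 0 by (field; lra).
    now rewrite cos_0, sin_0. }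
  pose proof (monic_eval_roots (q - 1) (fun i => unity_root q (S i))
    (repeat (RtoC 1) (q - 1)) (RtoC 1)) as Hm.
  rewrite monic_eval_ones_1, Cmod_R in Hm.
  replace (S (q - 1)) with q in Hm by lia. rewrite Rabs_pos_eq in Hm by lra.
  etransitivity; [|symmetry; apply Hm].
  - apply pprod_ext. intros i _. rewrite H1. unfold unity_root. rewrite Cmod_cis_minus.
    replace ((2 * PI * INR 0 / INR q - 2 * PI * INR (S i) / INR q) / 2)
      with (- (PI * INR (S i) / INR q)) by (simpl (INR 0); field; lra).
    now rewrite sin_neg, Ropp_mult_distr_r_reverse, Rabs_Ropp.
  - apply repeat_length.
  - intros i j Hi Hj He. apply unity_root_inj in He; lia.
  - intros i Hi. pose proof (monic_eval_ones (q - 1) (unity_root q (S i))) as H.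
    replace (S (q - 1)) with q in H by lia. rewrite unity_root_pow in H by easy.
    destruct (Ceq_dec (monic_eval (repeat (RtoC 1) (q - 1)) (unity_root q (S i))) (RtoC 0))
      as [He|Hne]; [easy|exfalso].
    apply (Cmult_neq_0 (Cminus (unity_root q (S i)) (RtoC 1))) in Hne.
    + apply Hne. rewrite H. ring.
    + intros Hd. assert (He : unity_root q (S i) = unity_root q 0).
      { rewrite <- H1.
        replace (unity_root q (S i)) with (Cplus (Cminus (unity_root q (S i)) (RtoC 1)) (RtoC 1)) by ring.
        rewrite Hd. ring. }
      apply unity_root_inj in He; lia.
Qed.

(** * The Gamma and digamma functions *)

Lemma ln_le_sub_1 x : 0 < x -> ln x <= x - 1.
Proof.
  intros Hx. pose proof (exp_ineq1_le (ln x)) as H. rewrite exp_ln in H by easy. lra.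
Qed.

(** For a nonnegative integrand the improper integral is the supremum of the proper ones. The second
    conclusion gives positivity of Gamma. *)
Lemma is_RInt_gen_nonneg (f : R -> R) (B : R) :
  (forall t, 0 < t -> 0 <= f t) ->
  (forall t, 0 < t -> continuous f t) ->
  (forall a b, 0 < a -> a <= b -> RInt f a b <= B) ->
  exists l, is_RInt_gen f (at_right 0) (Rbar_locally p_infty) l /\
    forall a b, 0 < a -> a <= b -> RInt f a b <= l.
Proof.
  intros Hf0 Hfc HB.
  assert (Hex : forall a b, 0 < a -> a <= b -> ex_RInt f a b).
  { intros a b Ha Hab. apply (@ex_RInt_continuous R_CompleteNormedModule).
    intros z Hz. apply Hfc. rewrite Rmin_left in Hz by lra. lra. }
  destruct (completeness (fun y => exists a b, 0 < a /\ a <= b /\ y = RInt f a b)) as [l [Hub Hlub]].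
  - exists B. intros y (a & b & Ha & Hab & ->). auto.
  - exists (RInt f 1 1), 1, 1. lra.
  - exists l. split.
    2:{ intros a b Ha Hab. apply Hub. now exists a, b. }
    intros P [eps HP].
    assert (Hnear : exists a b, 0 < a /\ a <= b /\ l - eps < RInt f a b).
    { apply Classical_Prop.NNPP. intros Hn.
      assert (l <= l - eps); [|destruct eps; simpl in *; lra].
      apply Hlub. intros y (a & b & Ha & Hab & ->).
      apply Rnot_lt_le. intros Hlt. apply Hn. now exists a, b. }
    destruct Hnear as (a & b & Ha & Hab & Hl).
    apply (Filter_prod _ _ _ (fun x => 0 < x < a) (fun y => b < y)).
    + exists (mkposreal a Ha). intros y Hy Hy0.
      apply (Rabs_def2 (_ - _)) in Hy. simpl in Hy. lra.
    + exists b. auto.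
    + intros x y Hx Hy. exists (RInt f x y). split.
      * apply (@RInt_correct R_CompleteNormedModule). apply Hex; lra.
      * apply HP. unfold ball; simpl; unfold AbsRing_ball, abs, minus, plus, opp; simpl.
        assert (Hle : RInt f x y <= l) by (apply Hub; exists x, y; lra).
        assert (Hge : RInt f a b <= RInt f x y).
        { rewrite <- (RInt_Chasles f x a y) by (apply Hex; lra).
          rewrite <- (RInt_Chasles f a b y) by (apply Hex; lra).
          unfold plus; simpl.
          assert (0 <= RInt f x a) by (apply RInt_ge_0; [lra|apply Hex; lra|intros; apply Hf0; lra]).
          assert (0 <= RInt f b y) by (apply RInt_ge_0; [lra|apply Hex; lra|intros; apply Hf0; lra]).
          lra. }
        apply Rabs_def1; destruct eps; simpl in *; lra.
Qed.

Lemma is_derive_Rpower_pos z t : 0 < t ->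
  is_derive (fun s => Rpower s z) t (z * Rpower t (z - 1)).
Proof.
  intros Ht. unfold Rpower. auto_derive; [easy|].
  replace ((z - 1) * ln t) with (z * ln t - ln t) by ring.
  unfold Rminus. rewrite exp_plus, exp_Ropp, exp_ln by easy. field. lra.
Qed.

Lemma continuous_Rpower_pos z t : 0 < t -> continuous (fun s => Rpower s z) t.
Proof.
  intros Ht. apply (ex_derive_continuous (fun s => Rpower s z)).
  eexists. now apply is_derive_Rpower_pos.
Qed.

Definition gamma_fun (z t : R) : R := Rpower t (z - 1) * exp (- t).

Lemma gamma_fun_pos z t : 0 < gamma_fun z t.
Proof. apply Rmult_lt_0_compat; apply exp_pos. Qed.

Lemma gamma_fun_continuous z t : 0 < t -> continuous (gamma_fun z) t.
Proof.
  intros Ht. apply (continuous_mult (fun s => Rpower s (z - 1)) (fun s => exp (- s))).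
  - now apply continuous_Rpower_pos.
  - apply (ex_derive_continuous (fun s => exp (- s))). auto_derive. easy.
Qed.

(** t^s exp (-t) is maximal at t = s. *)
Lemma Rpower_exp_bound s t : 0 < s -> 0 < t -> Rpower t s * exp (- t) <= exp (s * ln s - s).
Proof.
  intros Hs Ht. unfold Rpower. rewrite <- exp_plus.
  assert (H : ln (t / s) <= t / s - 1) by (apply ln_le_sub_1, Rdiv_lt_0_compat; lra).
  rewrite ln_div in H by easy.
  assert (s * (ln t - ln s) <= s * (t / s - 1)) by (apply Rmult_le_compat_l; lra).
  replace (s * (t / s - 1)) with (t - s) in H0 by (field; lra).
  apply exp_le_compat. lra.
Qed.

(* The integrand is dominated by a multiple of the derivative of the bounded
   function [- / (1 + t ^ z)]. *)
Lemma gamma_fun_bound z : 0 < z ->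
  exists B, forall a b, 0 < a -> a <= b -> RInt (gamma_fun z) a b <= B.
Proof.
  intros Hz.
  (* The domination needs exp (-t) (1 + u)^2 <= M z with u = t^z. Since (1 + u)^2 <= 2 + 2 u^2, it
     follows from exp (-t) <= 1 and the bound of t^(2z) exp (-t) by its maximum at t = 2z. *)
  pose (M := (2 + 2 * exp (2 * z * ln (2 * z) - 2 * z)) / z).
  assert (HM : 0 < M).
  { apply Rdiv_lt_0_compat; [|easy]. pose proof (exp_pos (2 * z * ln (2 * z) - 2 * z)). lra. }
  pose (H := fun t => - M / (1 + Rpower t z)).
  pose (dH := fun t => M * (z * Rpower t (z - 1)) / (1 + Rpower t z) ^ 2).
  assert (Hp : forall t, 0 < Rpower t z) by (intros; apply exp_pos).
  assert (HdH : forall t, 0 < t -> is_derive H t (dH t)).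
  { intros t Ht. unfold H, dH. pose proof (Hp t).
    evar_last.
    - apply (is_derive_div (fun _ => - M) (fun s => 1 + Rpower s z)).
      + apply (is_derive_const (- M)).
      + apply (is_derive_plus (fun _ => 1) (fun s => Rpower s z)).
        * apply (is_derive_const 1).
        * now apply is_derive_Rpower_pos.
      + lra.
    - unfold plus, zero; simpl. field. lra. }
  assert (HcdH : forall t, 0 < t -> continuous dH t).
  { intros t Ht. unfold dH, Rdiv.
    apply (continuous_mult (fun t => M * (z * Rpower t (z - 1))) (fun t => / (1 + Rpower t z) ^ 2)).
    - apply (continuous_mult (fun _ => M)); [apply continuous_const|].
      apply (continuous_mult (fun _ => z)); [apply continuous_const|].
      now apply continuous_Rpower_pos.
    - apply continuous_Rinv_comp; [|pose proof (Hp t); nra].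
      apply (continuous_comp (fun t => 1 + Rpower t z) (fun y => y ^ 2)).
      + apply (continuous_plus (fun _ => 1)); [apply continuous_const|].
        now apply continuous_Rpower_pos.
      + apply (ex_derive_continuous (fun y => y ^ 2)). auto_derive. easy. }
  exists M. intros a b Ha Hab.
  assert (HI : is_RInt dH a b (minus (H b) (H a))).
  { apply (is_RInt_derive H dH); intros x Hx; rewrite Rmin_left in Hx by lra;
      [apply HdH|apply HcdH]; lra. }
  apply Rle_trans with (RInt dH a b).
  - apply RInt_le; [easy| | |].
    + apply (@ex_RInt_continuous R_CompleteNormedModule). intros x Hx.
      rewrite Rmin_left in Hx by lra. apply gamma_fun_continuous; lra.
    + eexists; exact HI.
    + intros t [Ht _]. unfold gamma_fun, dH.
      assert (Ht0 : 0 < t) by lra. pose proof (Hp t) as Hpt.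
      set (u := Rpower t z) in *.
      pose proof (exp_pos (- t)) as He.
      assert (He1 : exp (- t) <= 1) by (rewrite <- exp_0; apply exp_le_compat; lra).
      pose proof (Rpower_exp_bound (2 * z) t ltac:(lra) Ht0) as Hb.
      replace (Rpower t (2 * z)) with (u * u) in Hb
        by (unfold u; rewrite <- Rpower_plus; f_equal; ring).
      assert (HMz : exp (- t) * (1 + u) ^ 2 <= M * z).
      { unfold M. replace (_ / z * z) with (2 + 2 * exp (2 * z * ln (2 * z) - 2 * z)) by (field; lra).
        assert ((1 + u) ^ 2 <= 2 + 2 * (u * u)) by (pose proof (pow2_ge_0 (1 - u)); lra).
        apply Rle_trans with (exp (- t) * (2 + 2 * (u * u))).
        - apply Rmult_le_compat_l; lra.
        - lra. }
      assert (Hpos : 0 < Rpower t (z - 1)) by apply exp_pos.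
      apply Rmult_le_reg_r with ((1 + u) ^ 2); [nra|].
      replace (M * (z * Rpower t (z - 1)) / (1 + u) ^ 2 * (1 + u) ^ 2)
        with (Rpower t (z - 1) * (M * z)) by (field; nra).
      rewrite Rmult_assoc. apply Rmult_le_compat_l; lra.
  - rewrite (is_RInt_unique _ _ _ _ HI). unfold minus, plus, opp, H; simpl.
    pose proof (Hp a). pose proof (Hp b).
    assert (0 < M / (1 + Rpower b z)) by (apply Rdiv_lt_0_compat; lra).
    assert (M / (1 + Rpower a z) <= M).
    { apply Rmult_le_reg_r with (1 + Rpower a z); [lra|].
      replace (M / (1 + Rpower a z) * (1 + Rpower a z)) with M by (field; lra). nra. }
    replace (- M / (1 + Rpower b z)) with (- (M / (1 + Rpower b z))) by (field; lra).
    replace (- M / (1 + Rpower a z)) with (- (M / (1 + Rpower a z))) by (field; lra).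
    lra.
Qed.

Lemma Gamma_correct z : 0 < z ->
  is_RInt_gen (gamma_fun z) (at_right 0) (Rbar_locally p_infty) (Gamma z) /\ 0 < Gamma z.
Proof.
  intros Hz. destruct (gamma_fun_bound z Hz) as [B HB].
  destruct (is_RInt_gen_nonneg (gamma_fun z) B) as [l [Hl Hle]].
  - intros t _. left. apply gamma_fun_pos.
  - intros t. apply gamma_fun_continuous.
  - exact HB.
  - assert (Hg : Gamma z = l).
    { unfold Gamma. apply is_RInt_gen_unique; try exact Hl; typeclasses eauto. }
    rewrite Hg. split; [easy|].
    apply Rlt_le_trans with (RInt (gamma_fun z) 1 2); [|apply Hle; lra].
    apply RInt_gt_0; [lra|intros; apply gamma_fun_pos|].
    intros x Hx. apply gamma_fun_continuous. lra.
Qed.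

Lemma Gamma_pos z : 0 < z -> 0 < Gamma z.
Proof. apply Gamma_correct. Qed.

Lemma near_0_infty_ordered (P : R -> Prop) : (forall t, 0 < t -> P t) ->
  filter_prod (at_right 0) (Rbar_locally p_infty)
    (fun ab => fst ab <= snd ab /\ forall t, Rmin (fst ab) (snd ab) <= t -> P t).
Proof.
  intros HP.
  apply (Filter_prod _ _ _ (fun x => 0 < x < 1) (fun y => 1 < y)).
  - exists (mkposreal 1 Rlt_0_1). intros y Hy Hy0.
    apply (Rabs_def2 (_ - _)) in Hy. simpl in Hy. lra.
  - exists 1. auto.
  - intros x y Hx Hy. simpl. split; [lra|]. intros t Ht. rewrite Rmin_left in Ht by lra.
    apply HP. lra.
Qed.

Lemma Rpower_exp_lim_0 z : 0 < z ->
  filterlim (fun t => Rpower t z * exp (- t)) (at_right 0) (locally 0).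
Proof.
  intros Hz P [eps HP].
  assert (Hd : 0 < Rpower eps (/ z)) by apply exp_pos.
  exists (mkposreal _ Hd). intros t Ht Ht0. apply HP.
  unfold ball in *; simpl in *; unfold AbsRing_ball, abs, minus, plus, opp in *; simpl in *.
  apply Rabs_def2 in Ht. pose proof (cond_pos eps) as He.
  assert (Hlt : Rpower t z < eps).
  { replace (pos eps) with (Rpower (Rpower eps (/ z)) z).
    - apply Rlt_Rpower_l; lra.
    - rewrite Rpower_mult, Rinv_l, Rpower_1; lra. }
  assert (H1 : 0 < exp (- t) <= 1).
  { split; [apply exp_pos|]. rewrite <- exp_0. apply exp_le_compat. lra. }
  assert (0 < Rpower t z) by apply exp_pos.
  apply Rabs_def1; nra.
Qed.

Lemma Rpower_exp_lim_infty z : 0 < z ->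
  filterlim (fun t => Rpower t z * exp (- t)) (Rbar_locally p_infty) (locally 0).
Proof.
  intros Hz P [eps HP]. pose proof (cond_pos eps) as He.
  set (c := exp ((z + 1) * ln (z + 1) - (z + 1))).
  exists (Rmax 1 (c / eps)). intros t Ht. apply HP.
  pose proof (Rmax_l 1 (c / eps)). pose proof (Rmax_r 1 (c / eps)).
  unfold ball in *; simpl in *; unfold AbsRing_ball, abs, minus, plus, opp in *; simpl in *.
  pose proof (Rpower_exp_bound (z + 1) t ltac:(lra) ltac:(lra)) as Hb. fold c in Hb.
  rewrite Rpower_plus, Rpower_1 in Hb by lra.
  assert (Hc : c < t * eps).
  { apply Rmult_lt_reg_r with (/ eps); [now apply Rinv_0_lt_compat|].
    replace (t * eps * / eps) with t by (field; lra). unfold Rdiv in *. lra. }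
  assert (0 < Rpower t z * exp (- t)) by (apply Rmult_lt_0_compat; apply exp_pos).
  apply Rabs_def1; [|lra].
  rewrite Ropp_0, Rplus_0_r. nra.
Qed.

Lemma Gamma_succ z : 0 < z -> Gamma (z + 1) = z * Gamma z.
Proof.
  intros Hz.
  destruct (Gamma_correct z Hz) as [H1 _].
  destruct (Gamma_correct (z + 1) ltac:(lra)) as [H2 _].
  (* Integration by parts: [F] is the boundary term and vanishes at both ends. *)
  pose (F := fun t => Rpower t z * exp (- t)).
  pose (dF := fun t => z * gamma_fun z t - gamma_fun (z + 1) t).
  assert (HdF : forall t, 0 < t -> is_derive F t (dF t)).
  { intros t Ht. unfold F, dF, gamma_fun. replace (z + 1 - 1) with z by ring.
    evar_last.
    - apply (is_derive_mult (fun s => Rpower s z) (fun s => exp (- s))).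
      + now apply is_derive_Rpower_pos.
      + auto_derive; [easy|reflexivity].
      + intros; apply Rmult_comm.
    - unfold plus, mult; simpl. ring. }
  assert (HI : is_RInt_gen (Derive F) (at_right 0) (Rbar_locally p_infty) (0 - 0)).
  { apply is_RInt_gen_Derive.
    - eapply filter_imp; [|apply (near_0_infty_ordered (fun t => ex_derive F t))].
      + intros [a b] [_ H] x Hx. apply H. simpl in *; lra.
      + intros t Ht. eexists. now apply HdF.
    - eapply filter_imp; [|apply (near_0_infty_ordered (fun t => continuous (Derive F) t))].
      + intros [a b] [_ H] x Hx. apply H. simpl in *; lra.
      + intros t Ht. apply (continuous_ext_loc _ dF).
        * exists (mkposreal t Ht). intros s Hs. symmetry. apply is_derive_unique, HdF.
          apply (Rabs_def2 (_ - _)) in Hs. simpl in Hs. lra.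
        * apply (continuous_minus (fun t => z * gamma_fun z t) (gamma_fun (z + 1)));
            [|now apply gamma_fun_continuous].
          apply (continuous_scal_r z (gamma_fun z)). now apply gamma_fun_continuous.
    - now apply Rpower_exp_lim_0.
    - now apply Rpower_exp_lim_infty. }
  assert (HI2 : is_RInt_gen (Derive F) (at_right 0) (Rbar_locally p_infty)
                  (minus (scal z (Gamma z)) (Gamma (z + 1)))).
  { eapply is_RInt_gen_ext;
      [|apply (is_RInt_gen_minus _ _ _ _ (is_RInt_gen_scal _ z _ H1) H2)].
    eapply filter_imp; [|apply (near_0_infty_ordered (fun t => dF t = Derive F t))].
    - intros [a b] [_ H] x Hx. apply H. simpl in *; lra.
    - intros t Ht. symmetry. now apply is_derive_unique, HdF. }
  apply (@is_RInt_gen_unique R_CompleteNormedModule) in HI; try typeclasses eauto.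
  apply (@is_RInt_gen_unique R_CompleteNormedModule) in HI2; try typeclasses eauto.
  rewrite HI in HI2. unfold minus, plus, opp, scal in HI2; simpl in HI2.
  unfold mult in HI2; simpl in HI2. lra.
Qed.

(* Bernoulli's inequality [(t/w)^h <= 1 - h + h t/w], integrated against the Gamma density. *)
Lemma Gamma_wendel w h : 0 < w -> 0 <= h <= 1 -> Gamma (w + h) <= Rpower w h * Gamma w.
Proof.
  intros Hw Hh.
  destruct (Gamma_correct w Hw) as [H1 _].
  destruct (Gamma_correct (w + 1) ltac:(lra)) as [H2 _].
  destruct (Gamma_correct (w + h) ltac:(lra)) as [H3 _].
  pose proof (is_RInt_gen_plus _ _ _ _ (is_RInt_gen_scal _ (Rpower w h * (1 - h)) _ H1)
     (is_RInt_gen_scal _ (Rpower w h * h / w) _ H2)) as Hg.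
  assert (Hb : forall t, 0 < t -> norm (gamma_fun (w + h) t)
     <= plus (scal (Rpower w h * (1 - h)) (gamma_fun w t))
             (scal (Rpower w h * h / w) (gamma_fun (w + 1) t))).
  { intros t Ht. unfold norm, plus, scal; simpl. unfold abs, mult; simpl.
    rewrite Rabs_pos_eq by (left; apply gamma_fun_pos).
    unfold gamma_fun.
    replace (w + h - 1) with (w - 1 + h) by ring.
    replace (w + 1 - 1) with (w - 1 + 1) by ring.
    rewrite !Rpower_plus, Rpower_1 by easy.
    assert (Hp : 0 < Rpower t (w - 1) * exp (- t)) by (apply Rmult_lt_0_compat; apply exp_pos).
    assert (Hy : Rpower t h <= Rpower w h * (1 - h) + Rpower w h * h / w * t).
    { assert (He : Rpower t h = Rpower w h * Rpower (t / w) h).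
      { rewrite Rpower_mult_distr; [|easy|now apply Rdiv_lt_0_compat].
        f_equal. field. lra. }
      rewrite He.
      replace (Rpower w h * (1 - h) + Rpower w h * h / w * t)
        with (Rpower w h * (1 - h + h * (t / w))) by (field; lra).
      apply Rmult_le_compat_l; [left; apply exp_pos|].
      set (v := t / w). assert (Hv : 0 < v) by (now apply Rdiv_lt_0_compat).
      assert (Hm : 0 < 1 - h + h * v) by (destruct (Req_dec h 0); nra).
      apply Rnot_lt_le. intros Hlt.
      (* concavity of ln at the mean m = 1 - h + h v *)
      set (m := 1 - h + h * v) in *.
      pose proof (ln_le_sub_1 (v / m) ltac:(now apply Rdiv_lt_0_compat)) as L1.
      pose proof (ln_le_sub_1 (1 / m) ltac:(apply Rdiv_lt_0_compat; lra)) as L2.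
      rewrite ln_div in L1, L2 by lra. rewrite ln_1 in L2.
      assert (L3 : ln m < h * ln v).
      { apply ln_increasing in Hlt; [|easy]. unfold Rpower in Hlt. now rewrite ln_exp in Hlt. }
      assert (L4 : h * (v / m - 1) + (1 - h) * (1 / m - 1) = 0) by (unfold m; field; fold m; lra).
      nra. }
    nra. }
  assert (Hn : norm (Gamma (w + h)) <= plus (scal (Rpower w h * (1 - h)) (Gamma w))
             (scal (Rpower w h * h / w) (Gamma (w + 1)))).
  { refine (@RInt_gen_norm R_CompleteNormedModule _ _ _ _ _ _ _ _ _ _ H3 Hg).
    - eapply filter_imp; [|apply (near_0_infty_ordered (fun _ => True)); easy].
      now intros [a b] [H _].
    - eapply filter_imp; [|apply (near_0_infty_ordered _ Hb)].
      intros [a b] [H0 H] t Ht. apply H. simpl in *. rewrite Rmin_left by easy. lra. }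
  revert Hn. unfold norm, plus, scal; simpl. unfold abs, mult; simpl.
  rewrite Gamma_succ by easy. rewrite Rabs_pos_eq by (left; apply Gamma_pos; lra).
  intros Hn. eapply Rle_trans; [exact Hn|]. right. field. lra.
Qed.

(** The hypothesis makes e + v decreasing and e - v increasing, so both squeeze one limit, which
    yields its existence and the rate together. *)
Lemma telescoping_limit (e v : nat -> R) :
  (forall n, Rabs (e (S n) - e n) <= v n - v (S n)) -> is_lim_seq v 0 ->
  exists L : R, is_lim_seq e L /\ forall n, Rabs (e n - L) <= v n.
Proof.
  intros He Hv.
  assert (Hd : forall n, e (S n) + v (S n) <= e n + v n).
  { intros n. specialize (He n). apply Rabs_le_between in He. lra. }
  assert (Hi : forall n, e n - v n <= e (S n) - v (S n)).
  { intros n. specialize (He n). apply Rabs_le_between in He. lra. }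
  assert (Hv0 : forall n, 0 <= v n).
  { apply (is_lim_seq_decr_compare v 0 Hv). intros n. specialize (He n).
    pose proof (Rabs_pos (e (S n) - e n)). lra. }
  assert (Hm : forall n, e O - v O <= e n - v n).
  { induction n as [|n IH]; [lra|]. specialize (Hi n). lra. }
  destruct (ex_finite_lim_seq_decr (fun n => e n + v n) (e O - v O)) as [L HL].
  - exact Hd.
  - intros n. specialize (Hm n). specialize (Hv0 n). lra.
  - assert (HeL : is_lim_seq e L).
    { apply (is_lim_seq_ext (fun n => (e n + v n) - v n)); [intros; ring|].
      replace (Finite L) with (Finite (L - 0)) by (f_equal; ring).
      now apply is_lim_seq_minus'. }
    assert (HL2 : is_lim_seq (fun n => e n - v n) L).
    { replace (Finite L) with (Finite (L - 0)) by (f_equal; ring).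
      now apply is_lim_seq_minus'. }
    exists L. split; [easy|]. intros n.
    pose proof (is_lim_seq_decr_compare _ _ HL Hd n) as H1.
    pose proof (is_lim_seq_incr_compare _ _ HL2 Hi n) as H2. simpl in *.
    apply Rabs_le_between. lra.
Qed.

Lemma is_lim_seq_inv_INR_S (K : R) : is_lim_seq (fun n => K / INR (S n)) 0.
Proof.
  replace (Finite 0) with (Rbar_mult K 0) by (simpl; f_equal; ring).
  apply is_lim_seq_scal_l. apply (is_lim_seq_inv _ p_infty); [|easy].
  apply (is_lim_seq_incr_1 INR), is_lim_seq_INR.
Qed.

Lemma inv_sq_telescope n : / INR (S n) ^ 2 <= 2 / INR (S n) - 2 / INR (S (S n)).
Proof.
  assert (H : 1 <= INR (S n)) by (apply (le_INR 1); lia).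
  rewrite (S_INR (S n)). set (y := INR (S n)) in *.
  replace (2 / y - 2 / (y + 1)) with (2 / (y * (y + 1))) by (field; lra).
  apply Rmult_le_reg_r with (y ^ 2 * (y + 1)); [nra|].
  replace (/ y ^ 2 * (y ^ 2 * (y + 1))) with (y + 1) by (field; lra).
  replace (2 / (y * (y + 1)) * (y ^ 2 * (y + 1))) with (2 * y) by (field; lra). lra.
Qed.

Lemma psum_inv_sq_le n : psum (fun j => / INR (S j) ^ 2) n <= 2.
Proof.
  eapply Rle_trans; [apply psum_le; intros; apply inv_sq_telescope|].
  pose proof (psum_telescope (fun k => - (2 / INR (S k))) n) as Ht. cbv beta in Ht.
  erewrite psum_ext; [rewrite Ht|intros; cbv beta; ring].
  assert (0 < 2 / INR (S n)).
  { apply Rdiv_lt_0_compat; [lra|apply lt_0_INR; lia]. }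
  simpl (INR 1). lra.
Qed.

Lemma ln_add_bounds y h : 0 < y -> 0 < y + h -> h / (y + h) <= ln (y + h) - ln y <= h / y.
Proof.
  intros Hy Hh. split.
  - pose proof (ln_le_sub_1 (y / (y + h)) ltac:(now apply Rdiv_lt_0_compat)) as H.
    rewrite ln_div in H by easy.
    replace (y / (y + h) - 1) with (- (h / (y + h))) in H by (field; lra). lra.
  - pose proof (ln_le_sub_1 ((y + h) / y) ltac:(now apply Rdiv_lt_0_compat)) as H.
    rewrite ln_div in H by easy.
    replace ((y + h) / y - 1) with (h / y) in H by (field; lra). lra.
Qed.

Lemma ln_add_quadratic y h : 0 < y -> - (y / 2) <= h ->
  Rabs (ln (y + h) - ln y - h / y) <= 2 * h ^ 2 / y ^ 2.
Proof.
  intros Hy Hh. pose proof (ln_add_bounds y h Hy ltac:(lra)) as Hb.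
  assert (He : h / y - h / (y + h) <= 2 * h ^ 2 / y ^ 2).
  { replace (h / y - h / (y + h)) with (h ^ 2 * / (y * (y + h))) by (field; lra).
    replace (2 * h ^ 2 / y ^ 2) with (h ^ 2 * / (y * (y / 2))) by (field; lra).
    apply Rmult_le_compat_l; [apply pow2_ge_0|].
    apply Rinv_le_contravar; [nra|]. apply Rmult_le_compat_l; lra. }
  apply Rabs_le_between. lra.
Qed.

(** [Gamma_wendel] at (w, h) is the upper bound; at (w + h, 1 - h), combined with Gamma (w + 1) = w
    Gamma w, it is the lower one. *)
Lemma ln_Gamma_succ_sub w h : 0 < w -> 0 <= h <= 1 ->
  Rabs (ln (Gamma (w + h)) - ln (Gamma w) - h * ln w) <= h / w.
Proof.
  intros Hw Hh. pose proof (Gamma_pos w Hw) as Gw. pose proof (Gamma_pos (w + h) ltac:(lra)) as Gh.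
  assert (Hup : forall w h, 0 < w -> 0 <= h <= 1 ->
     ln (Gamma (w + h)) <= ln (Gamma w) + h * ln w).
  { clear. intros w h Hw Hh. pose proof (Gamma_wendel w h Hw Hh) as H.
    pose proof (Gamma_pos w Hw). apply ln_le in H; [|apply Gamma_pos; lra].
    rewrite ln_mult in H by (try easy; apply exp_pos).
    unfold Rpower in H. rewrite ln_exp in H. lra. }
  pose proof (Hup w h Hw Hh) as H1.
  pose proof (Hup (w + h) (1 - h) ltac:(lra) ltac:(lra)) as H2.
  replace (w + h + (1 - h)) with (w + 1) in H2 by ring.
  rewrite Gamma_succ, ln_mult in H2 by easy.
  pose proof (ln_add_bounds w h Hw ltac:(lra)) as Hb.
  assert (Hq : 0 <= h / w) by (apply Rdiv_le_0_compat; lra).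
  apply Rabs_le_between. nra.
Qed.

Lemma ln_Gamma_sub w h : 0 < w -> Rabs h <= 1 -> Rabs h < w ->
  Rabs (ln (Gamma (w + h)) - ln (Gamma w) - h * ln w) <= 2 * Rabs h / (w - Rabs h).
Proof.
  intros Hw Hh Hhw. destruct (Rle_dec 0 h) as [H0|H0].
  - rewrite (Rabs_pos_eq h) in * by easy.
    eapply Rle_trans; [apply ln_Gamma_succ_sub; lra|].
    unfold Rdiv. apply Rmult_le_compat; try lra.
    + left; now apply Rinv_0_lt_compat.
    + apply Rinv_le_contravar; lra.
  - rewrite (Rabs_left h) in * by lra.
    pose proof (ln_Gamma_succ_sub (w + h) (- h) ltac:(lra) ltac:(lra)) as H1.
    replace (w + h + - h) with w in H1 by ring.
    pose proof (ln_add_bounds w h Hw ltac:(lra)) as Hb.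
    replace (w - - h) with (w + h) by ring.
    replace (2 * - h / (w + h)) with (- h / (w + h) + - h / (w + h)) by (field; lra).
    assert (Hd : 0 <= ln w - ln (w + h) <= - h / (w + h)).
    { split.
      - assert (h / w <= 0); [|lra]. unfold Rdiv.
        assert (0 < / w) by now apply Rinv_0_lt_compat. nra.
      - replace (- h / (w + h)) with (- (h / (w + h))) by (field; lra). lra. }
    apply Rabs_le_between in H1. apply Rabs_le_between. nra.
Qed.

Lemma ln_Gamma_shift z n : 0 < z ->
  ln (Gamma (z + INR n)) = ln (Gamma z) + psum (fun j => ln (z + INR j)) n.
Proof.
  intros Hz. induction n as [|n IH].
  - simpl. rewrite !Rplus_0_r. easy.
  - rewrite S_INR. simpl psum. replace (z + (INR n + 1)) with (z + INR n + 1) by ring.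
    pose proof (pos_INR n). rewrite Gamma_succ, ln_mult, IH by (try apply Gamma_pos; lra). ring.
Qed.

(** Gauss's formula, proved together with the differentiability of Gamma. The functional equation
    moves ln Gamma (z + h) - ln Gamma z to the argument z + n, where the increment is h ln (z + n)
    up to O(1 / n). Letting n tend to infinity for fixed h leaves an error O(h^2), hence a
    derivative. *)
Lemma digamma_lim z : 0 < z ->
  is_lim_seq (fun n => ln (z + INR n) - psum (fun j => / (z + INR j)) n) (digamma z).
Proof.
  intros Hz. pose (e := fun n => ln (z + INR n) - psum (fun j => / (z + INR j)) n).
  assert (Hstep : forall n, Rabs (e (S (S n)) - e (S n)) <= 4 / INR (S n) - 4 / INR (S (S n))).
  { intros n. unfold e. pose proof (pos_INR n).
    change (psum (fun j : nat => / (z + INR j)) (S (S n)))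
      with (psum (fun j : nat => / (z + INR j)) (S n) + / (z + INR (S n))).
    rewrite (S_INR (S n)). pose proof (lt_0_INR (S n) ltac:(lia)).
    pose proof (ln_add_quadratic (z + INR (S n)) 1 ltac:(lra) ltac:(lra)) as Hq.
    eapply Rle_trans; [|eapply Rle_trans; [exact (Hq)|]].
    - right. f_equal. unfold Rdiv. rewrite Rplus_assoc. ring.
    - pose proof (inv_sq_telescope n) as Ht. rewrite (S_INR (S n)) in Ht.
      assert (/ (z + INR (S n)) ^ 2 <= / INR (S n) ^ 2).
      { apply Rinv_le_contravar; [nra|]. apply pow_incr. lra. }
      unfold Rdiv in *. lra. }
  destruct (telescoping_limit (fun n => e (S n)) (fun n => 4 / INR (S n))) as [L [HL _]].
  { exact Hstep. }
  { apply is_lim_seq_inv_INR_S. }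
  apply is_lim_seq_incr_1 in HL.
  (* Bounds the sum of 2 / (z + j)^2: the term j = 0 is 2 / z^2, the others are at most 2 times the
     2 of [psum_inv_sq_le]. *)
  pose (Kz := 2 / z ^ 2 + 4).
  assert (HK : 0 < Kz).
  { unfold Kz. assert (0 < 2 / z ^ 2) by (apply Rdiv_lt_0_compat; nra). lra. }
  assert (Hmain : forall h, Rabs h <= Rmin 1 (z / 2) ->
     Rabs (ln (Gamma (z + h)) - ln (Gamma z) - h * L) <= Kz * h ^ 2).
  { intros h Hh. pose proof (Rmin_l 1 (z / 2)). pose proof (Rmin_r 1 (z / 2)).
    assert (Hh2 : - (z / 2) <= h <= z / 2) by (apply Rabs_le_between; lra).
    assert (Hn : forall n, Rabs (ln (Gamma (z + h)) - ln (Gamma z) - h * e n)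
       <= 2 * Rabs h / (z + INR n - Rabs h) + Kz * h ^ 2).
    { intros n. pose proof (pos_INR n).
      pose proof (ln_Gamma_sub (z + INR n) h ltac:(lra) ltac:(lra) ltac:(lra)) as HA.
      pose proof (ln_Gamma_shift z n Hz) as G1.
      pose proof (ln_Gamma_shift (z + h) n ltac:(lra)) as G2.
      replace (z + h + INR n) with (z + INR n + h) in G2 by ring.
      rewrite G1, G2 in HA.
      assert (HB : Rabs (psum (fun j => ln (z + h + INR j) - ln (z + INR j) - h * / (z + INR j)) n)
         <= Kz * h ^ 2).
      { apply Rle_trans with (psum (fun j => 2 * h ^ 2 * / (z + INR j) ^ 2) n).
        - apply psum_abs_le. intros j _. pose proof (pos_INR j).
          pose proof (ln_add_quadratic (z + INR j) h ltac:(lra) ltac:(lra)) as Hq.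
          replace (z + h + INR j) with (z + INR j + h) by ring. exact Hq.
        - rewrite psum_scal.
          assert (Hs : psum (fun j => / (z + INR j) ^ 2) n <= / z ^ 2 + 2).
          { destruct n as [|n]; [simpl; assert (0 < / (z * (z * 1))) by (apply Rinv_0_lt_compat; nra); lra|].
            rewrite psum_S_l. apply Rplus_le_compat; [simpl INR; rewrite Rplus_0_r; lra|].
            eapply Rle_trans; [|apply (psum_inv_sq_le n)]. apply psum_le. intros j _.
            pose proof (lt_0_INR (S j) ltac:(lia)).
            apply Rinv_le_contravar; [nra|]. apply pow_incr. lra. }
          pose proof (pow2_ge_0 h).
          apply Rle_trans with (2 * h ^ 2 * (/ z ^ 2 + 2)); [apply Rmult_le_compat_l; lra|].
          unfold Kz. right. field. lra. }
      rewrite !psum_minus, psum_scal in HB.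
      unfold e. apply Rabs_le_between in HA. apply Rabs_le_between in HB.
      apply Rabs_le_between. lra. }
    assert (HR : is_lim_seq (fun n => 2 * Rabs h / (z + INR n - Rabs h) + Kz * h ^ 2) (Kz * h ^ 2)).
    { replace (Kz * h ^ 2) with (0 + Kz * h ^ 2) at 1 by ring.
      apply is_lim_seq_plus'; [|apply is_lim_seq_const].
      replace (Finite 0) with (Rbar_mult (2 * Rabs h) 0) by (simpl; f_equal; ring).
      apply is_lim_seq_scal_l. apply (is_lim_seq_inv _ p_infty); [|easy].
      apply (is_lim_seq_ext (fun n => INR n + (z - Rabs h))); [intros; ring|].
      eapply is_lim_seq_plus; [apply is_lim_seq_INR|apply is_lim_seq_const|easy]. }
    assert (HLn : is_lim_seq (fun n => Rabs (ln (Gamma (z + h)) - ln (Gamma z) - h * e n))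
       (Rabs (ln (Gamma (z + h)) - ln (Gamma z) - h * L))).
    { apply (is_lim_seq_abs _ (Finite _)). apply is_lim_seq_minus'; [apply is_lim_seq_const|].
      apply (is_lim_seq_scal_l _ h (Finite L)). exact HL. }
    exact (is_lim_seq_le _ _ _ _ Hn HLn HR). }
  assert (Hder : is_derive (fun y => ln (Gamma y)) z L).
  { apply is_derive_Reals. intros eps Heps.
    assert (Hd : 0 < Rmin (Rmin 1 (z / 2)) (eps / Kz)).
    { repeat apply Rmin_pos; try lra. now apply Rdiv_lt_0_compat. }
    exists (mkposreal _ Hd). intros h Hh0 Hh. simpl in Hh.
    pose proof (Rmin_l (Rmin 1 (z / 2)) (eps / Kz)). pose proof (Rmin_r (Rmin 1 (z / 2)) (eps / Kz)).
    specialize (Hmain h ltac:(lra)).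
    replace ((ln (Gamma (z + h)) - ln (Gamma z)) / h - L)
      with ((ln (Gamma (z + h)) - ln (Gamma z) - h * L) / h) by (field; easy).
    pose proof (Rabs_pos_lt h Hh0) as Ha.
    unfold Rdiv at 1. rewrite Rabs_mult, Rabs_inv.
    apply Rmult_lt_reg_r with (Rabs h); [easy|].
    rewrite Rmult_assoc, Rinv_l, Rmult_1_r by lra.
    eapply Rle_lt_trans; [exact Hmain|].
    replace (h ^ 2) with (Rabs h * Rabs h) by (rewrite <- Rabs_mult, Rabs_pos_eq; nra).
    rewrite <- Rmult_assoc. apply Rmult_lt_compat_r; [easy|].
    apply Rmult_lt_reg_r with (/ Kz); [now apply Rinv_0_lt_compat|].
    replace (Kz * Rabs h * / Kz) with (Rabs h) by (field; lra). unfold Rdiv in *. lra. }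
  assert (HG : is_derive Gamma z (L * Gamma z)).
  { pose proof (Gamma_pos z Hz) as Hp.
    apply (is_derive_ext_loc (fun y => exp (ln (Gamma y)))).
    - exists (mkposreal z Hz). intros y Hy.
      apply (Rabs_def2 (_ - _)) in Hy. simpl in Hy. apply exp_ln, Gamma_pos. lra.
    - evar_last.
      + apply (is_derive_comp exp (fun y => ln (Gamma y)) z); [apply is_derive_exp|exact Hder].
      + unfold scal; simpl. unfold mult; simpl. now rewrite exp_ln. }
  assert (HdL : digamma z = L).
  { unfold digamma. rewrite (is_derive_unique _ _ _ HG). field.
    pose proof (Gamma_pos z Hz). lra. }
  rewrite HdL. exact HL.
Qed.

(** * Harmonic numbers and Stirling's formula *)

Lemma nonneg_of_derive (f df : R -> R) (u : R) :
  0 <= u -> 0 <= f 0 ->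
  (forall x, 0 <= x <= u -> is_derive f x (df x)) ->
  (forall x, 0 <= x <= u -> 0 <= df x) -> 0 <= f u.
Proof.
  intros Hu H0 Hd Hp.
  destruct (MVT_gen f 0 u df) as (c & Hc & He).
  - intros x Hx. rewrite Rmin_left, Rmax_right in Hx by easy. apply Hd. lra.
  - intros x Hx. rewrite Rmin_left, Rmax_right in Hx by easy.
    apply continuity_pt_filterlim, (ex_derive_continuous f).
    eexists. apply Hd. lra.
  - rewrite Rmin_left, Rmax_right in Hc by easy. specialize (Hp c Hc). nra.
Qed.

(* Error of the trapezoidal rule for [1 / (1 + t)] on [0, u]. *)
Lemma trapezoid_ln u : 0 <= u -> 0 <= (u + u / (1 + u)) / 2 - ln (1 + u) <= u ^ 3 / 6.
Proof.
  intros Hu. split.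
  - apply (nonneg_of_derive (fun u => (u + u / (1 + u)) / 2 - ln (1 + u))
             (fun u => (u / (1 + u)) ^ 2 / 2)); [easy| | |].
    + rewrite Rplus_0_r, ln_1. lra.
    + intros x Hx. auto_derive; [repeat split; lra|]. field. lra.
    + intros x Hx. pose proof (pow2_ge_0 (x / (1 + x))). lra.
  - cut (0 <= u ^ 3 / 6 - ((u + u / (1 + u)) / 2 - ln (1 + u))); [lra|].
    apply (nonneg_of_derive (fun u => u ^ 3 / 6 - ((u + u / (1 + u)) / 2 - ln (1 + u)))
             (fun u => (u ^ 2 - (u / (1 + u)) ^ 2) / 2)); [easy| | |].
    + rewrite Rplus_0_r, ln_1. lra.
    + intros x Hx. auto_derive; [repeat split; lra|]. field. lra.
    + intros x Hx. assert (x / (1 + x) <= x).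
      { apply Rmult_le_reg_r with (1 + x); [lra|]. field_simplify; nra. }
      assert (0 <= x / (1 + x)) by (apply Rdiv_le_0_compat; lra). nra.
Qed.

Lemma ln_succ_trapezoid y : 0 < y ->
  0 <= (/ y + / (y + 1)) / 2 - (ln (y + 1) - ln y) <= / (6 * y ^ 3).
Proof.
  intros Hy. pose proof (trapezoid_ln (/ y) ltac:(left; now apply Rinv_0_lt_compat)) as H.
  replace (1 + / y) with ((y + 1) / y) in H by (field; lra).
  rewrite ln_div in H by lra.
  replace (/ y / ((y + 1) / y)) with (/ (y + 1)) in H by (field; lra).
  replace ((/ y) ^ 3 / 6) with (/ (6 * y ^ 3)) in H by (field; lra).
  exact H.
Qed.

Definition harm (n : nat) : R := psum (fun j => / INR (S j)) n.
Definition lnfact (n : nat) : R := psum (fun j => ln (INR (S j))) n.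

Lemma harm_S n : harm (S n) = harm n + / INR (S n).
Proof. reflexivity. Qed.

Lemma lnfact_S n : lnfact (S n) = lnfact n + ln (INR (S n)).
Proof. reflexivity. Qed.

(** The usual Euler constant. Subtracting 1 / (2n) turns the increments into trapezoidal errors of
    order n^(-3), whence the rate 1 / n^2 in [harm_asymp]. *)
Definition euler_gamma : R :=
  real (Lim_seq (fun n => harm (S n) - ln (INR (S n)) - / (2 * INR (S n)))).

Lemma harm_asymp n : (1 <= n)%nat ->
  Rabs (harm n - ln (INR n) - euler_gamma - / (2 * INR n)) <= / INR n ^ 2.
Proof.
  intros Hn. pose (e := fun n => harm (S n) - ln (INR (S n)) - / (2 * INR (S n))).
  destruct (telescoping_limit e (fun n => / INR (S n) ^ 2)) as [L [HL Hb]].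
  - intros m. unfold e. rewrite (harm_S (S m)). rewrite (S_INR (S m)).
    assert (Hy : 1 <= INR (S m)) by (apply (le_INR 1); lia).
    set (y := INR (S m)) in *.
    pose proof (ln_succ_trapezoid y ltac:(lra)) as Ht.
    replace (harm (S m) + / (y + 1) - ln (y + 1) - / (2 * (y + 1)) - (harm (S m) - ln y - / (2 * y)))
      with ((/ y + / (y + 1)) / 2 - (ln (y + 1) - ln y)) by (field; lra).
    rewrite Rabs_pos_eq by lra. eapply Rle_trans; [apply Ht|].
    apply Rmult_le_reg_r with (6 * y ^ 3 * (y + 1) ^ 2).
    { apply Rmult_lt_0_compat; [|nra]. assert (0 < y ^ 3) by (apply pow_lt; lra). lra. }
    replace (/ (6 * y ^ 3) * (6 * y ^ 3 * (y + 1) ^ 2)) with ((y + 1) ^ 2) by (field; lra).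
    replace ((/ y ^ 2 - / (y + 1) ^ 2) * (6 * y ^ 3 * (y + 1) ^ 2))
      with (6 * y * (2 * y + 1)) by (field; lra). nra.
  - replace 0 with (0 * 0) by ring.
    apply (is_lim_seq_ext (fun n => 1 / INR (S n) * (1 / INR (S n)))).
    { intros m. pose proof (lt_0_INR (S m) ltac:(lia)). field. lra. }
    apply is_lim_seq_mult'; apply is_lim_seq_inv_INR_S.
  - assert (Hg : euler_gamma = L).
    { unfold euler_gamma. apply is_lim_seq_unique in HL. unfold e in HL. now rewrite HL. }
    rewrite Hg. destruct n as [|n]; [lia|]. specialize (Hb n). unfold e in Hb.
    replace (harm (S n) - ln (INR (S n)) - L - / (2 * INR (S n)))
      with (harm (S n) - ln (INR (S n)) - / (2 * INR (S n)) - L) by ring. exact Hb.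
Qed.

(** The fractional part of y enters at order 1 / y. At y = m / beta this term produces the sawtooth
    of 1 / beta in the reciprocity law. *)
Lemma harm_floor_asymp n y : (1 <= n)%nat -> INR n <= y < INR n + 1 ->
  Rabs (harm n - ln y - euler_gamma - (1 / 2 - (y - INR n)) / y) <= 16 / y ^ 2.
Proof.
  intros Hn Hy. pose proof (harm_asymp n Hn) as H1.
  assert (Hn1 : 1 <= INR n) by (apply (le_INR 1); lia).
  set (N := INR n) in *. set (t := y - N).
  pose proof (ln_add_quadratic N t ltac:(lra) ltac:(unfold t; lra)) as H2.
  replace (N + t) with y in H2 by (unfold t; ring).
  assert (Ht : 0 <= t < 1) by (unfold t; lra).
  assert (H3 : Rabs ((1 / 2 - t) / N - (1 / 2 - t) / y) <= / N ^ 2).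
  { replace ((1 / 2 - t) / N - (1 / 2 - t) / y) with ((1 / 2 - t) * t / (N * y))
      by (unfold t; field; lra).
    unfold Rdiv. rewrite Rabs_mult, (Rabs_pos_eq (/ _)).
    2:{ left. apply Rinv_0_lt_compat. nra. }
    apply Rle_trans with (1 * / (N * y)).
    - apply Rmult_le_compat_r; [left; apply Rinv_0_lt_compat; nra|].
      assert (0 <= t * t <= t) by (split; [apply Rle_0_sqr|rewrite <- (Rmult_1_r t) at 3; apply Rmult_le_compat_l; lra]).
      apply Rabs_le_between. lra.
    - rewrite Rmult_1_l. apply Rinv_le_contravar; nra. }
  assert (H4 : 2 * t ^ 2 / N ^ 2 <= 2 * / N ^ 2).
  { unfold Rdiv. apply Rmult_le_compat_r; [left; apply Rinv_0_lt_compat; nra|].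
    assert (t * t <= 1 * 1) by (apply Rmult_le_compat; lra). lra. }
  assert (H5 : / N ^ 2 <= 4 / y ^ 2).
  { apply Rmult_le_reg_r with (N ^ 2 * y ^ 2); [apply Rmult_lt_0_compat; nra|].
    replace (/ N ^ 2 * (N ^ 2 * y ^ 2)) with (y ^ 2) by (field; lra).
    replace (4 / y ^ 2 * (N ^ 2 * y ^ 2)) with ((2 * N) ^ 2) by (field; lra).
    apply pow_incr. lra. }
  assert (H6 : / (2 * N) = 1 / 2 / N) by (field; lra). rewrite H6 in H1.
  apply Rabs_le_between in H1, H2, H3.
  assert (H7 : (1 / 2 - t) / N = 1 / 2 / N - t / N) by (field; lra). rewrite H7 in H3.
  apply Rabs_le_between. lra.
Qed.

(** * Wallis integrals and the constant in Stirling's formula *)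

Definition wallis (n : nat) : R := RInt (fun t => sin t ^ n) 0 (PI / 2).

Lemma sin_pow_ex_RInt n a b : ex_RInt (fun t => sin t ^ n) a b.
Proof.
  apply (@ex_RInt_continuous R_CompleteNormedModule). intros z _.
  apply (ex_derive_continuous (fun t => sin t ^ n)). auto_derive. easy.
Qed.

(** The integrated derivative of - cos t sin^(n+1) t, which vanishes at both ends. *)
Lemma wallis_rec n : (INR n + 2) * wallis (S (S n)) = (INR n + 1) * wallis n.
Proof.
  pose (F := fun t => - (cos t * sin t ^ S n)).
  assert (HI : is_RInt (fun t => minus (scal (INR n + 2) (sin t ^ S (S n))) (scal (INR n + 1) (sin t ^ n)))
     0 (PI / 2) (minus (F (PI / 2)) (F 0))).
  { apply (is_RInt_derive F).
    - intros x _. unfold F. auto_derive; [easy|].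
      unfold minus, plus, opp, scal; simpl. unfold mult; simpl.
      pose proof (sin2_cos2 x) as Hsc. unfold Rsqr in Hsc.
      assert (Hc : cos x * cos x = 1 - sin x * sin x) by lra.
      replace (match n with 0%nat => 1 | S _ => INR n + 1 end) with (INR n + 1)
        by (destruct n; simpl; ring).
      transitivity (sin x ^ n * (sin x * sin x) - (INR n + 1) * sin x ^ n * (cos x * cos x));
        [|rewrite Hc]; ring.
    - intros x _. apply (ex_derive_continuous (fun t => minus (scal (INR n + 2) (sin t ^ S (S n))) (scal (INR n + 1) (sin t ^ n)))).
      unfold minus, plus, opp, scal; simpl. unfold mult; simpl. auto_derive. easy. }
  pose proof (is_RInt_minus _ _ _ _ _ _
     (is_RInt_scal _ _ _ (INR n + 2) _
        (@RInt_correct R_CompleteNormedModule _ _ _ (sin_pow_ex_RInt (S (S n)) 0 (PI / 2))))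
     (is_RInt_scal _ _ _ (INR n + 1) _
        (@RInt_correct R_CompleteNormedModule _ _ _ (sin_pow_ex_RInt n 0 (PI / 2))))) as HJ.
  apply (@is_RInt_unique R_CompleteNormedModule) in HI.
  apply (@is_RInt_unique R_CompleteNormedModule) in HJ. pose proof (eq_trans (eq_sym HI) HJ) as HE. clear HI HJ. rename HE into HJ.
  unfold F in HJ. rewrite cos_PI2, sin_0 in HJ.
  unfold minus, plus, opp, scal in HJ; simpl in HJ. unfold mult in HJ; simpl in HJ.
  unfold wallis. simpl. lra.
Qed.

Lemma wallis_decr n : wallis (S n) <= wallis n.
Proof.
  apply RInt_le; [pose proof PI_RGT_0; lra| | |]; try apply sin_pow_ex_RInt.
  intros x Hx. assert (0 <= sin x) by (apply sin_ge_0; lra).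
  pose proof (SIN_bound x). simpl. pose proof (pow_le (sin x) n H).
  rewrite <- (Rmult_1_l (sin x ^ n)) at 2. apply Rmult_le_compat_r; lra.
Qed.

Lemma wallis_0 : wallis 0 = PI / 2.
Proof.
  unfold wallis. simpl. rewrite RInt_const. change (@eq R ((PI / 2 - 0) * 1) (PI / 2)). ring.
Qed.

Lemma wallis_1 : wallis 1 = 1.
Proof.
  unfold wallis. apply is_RInt_unique.
  apply (is_RInt_ext sin); [intros x _; symmetry; apply pow_1|].
  replace 1 with (minus (- cos (PI / 2)) (- cos 0)).
  - apply (is_RInt_derive (fun t => - cos t)).
    + intros x _. auto_derive; [easy|ring].
    + intros x _. apply (ex_derive_continuous sin). auto_derive. easy.
  - rewrite cos_PI2, cos_0. unfold minus, plus, opp; simpl.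
    change (@eq R (- 0 + - - (1)) 1). ring.
Qed.

(** By [wallis_rec] the left side does not depend on n. *)
Lemma wallis_prod n : (INR n + 1) * (wallis n * wallis (S n)) = PI / 2.
Proof.
  induction n as [|n IH].
  - rewrite wallis_0, wallis_1. simpl. ring.
  - rewrite S_INR. rewrite <- IH. pose proof (wallis_rec n) as H.
    replace ((INR n + 1 + 1) * (wallis (S n) * wallis (S (S n))))
      with (wallis (S n) * ((INR n + 2) * wallis (S (S n)))) by ring.
    rewrite H. ring.
Qed.

Lemma ln_wallis_even n :
  wallis (2 * n) > 0 /\
  ln (wallis (2 * n)) = ln (PI / 2) + lnfact (2 * n) - 2 * INR n * ln 2 - 2 * lnfact n.
Proof.
  induction n as [|n [IHp IH]].
  - simpl. rewrite wallis_0. unfold lnfact; simpl. pose proof PI_RGT_0. split; [lra|ring].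
  - replace (2 * S n)%nat with (S (S (2 * n))) by lia.
    pose proof (wallis_rec (2 * n)) as H.
    pose proof (pos_INR (2 * n)) as Hp.
    assert (Hw : wallis (S (S (2 * n))) = (INR (2 * n) + 1) / (INR (2 * n) + 2) * wallis (2 * n)).
    { apply Rmult_eq_reg_l with (INR (2 * n) + 2); [|lra]. rewrite H. field. lra. }
    assert (Hpos : 0 < (INR (2 * n) + 1) / (INR (2 * n) + 2)) by (apply Rdiv_lt_0_compat; lra).
    rewrite Hw. split; [apply Rmult_lt_0_compat; easy|].
    rewrite ln_mult, ln_div, IH by lra.
    rewrite !lnfact_S, !S_INR, mult_INR. simpl (INR 2).
    pose proof (pos_INR n).
    replace ((1 + 1) * INR n + 1 + 1) with (2 * (INR n + 1)) by ring.
    replace ((1 + 1) * INR n + 2) with (2 * (INR n + 1)) by ring.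
    rewrite ln_mult by lra. ring.
Qed.

Definition stirling_err (n : nat) : R :=
  lnfact (S n) - (INR (S n) + 1 / 2) * ln (INR (S n)) + INR (S n).

(** With y = n + 1 the increment is y + 1/2 times the trapezoidal error [g] of the logarithm, minus
    1 / (4 y (y + 1)); both parts are of order 1 / y^2. *)
Lemma stirling_err_step n :
  Rabs (stirling_err (S n) - stirling_err n) <= 1 / INR (S n) - 1 / INR (S (S n)).
Proof.
  unfold stirling_err. rewrite (lnfact_S (S n)), (S_INR (S n)).
  assert (Hy : 1 <= INR (S n)) by (apply (le_INR 1); lia).
  set (y := INR (S n)) in *.
  pose proof (ln_succ_trapezoid y ltac:(lra)) as Ht.
  set (g := (/ y + / (y + 1)) / 2 - (ln (y + 1) - ln y)) in *.
  assert (Hl : ln (y + 1) = ln y + (/ y + / (y + 1)) / 2 - g) by (unfold g; ring).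
  replace (lnfact (S n) + ln (y + 1) - (y + 1 + 1 / 2) * ln (y + 1) + (y + 1)
             - (lnfact (S n) - (y + 1 / 2) * ln y + y))
    with (1 - (y + 1 / 2) * (ln (y + 1) - ln y)) by ring.
  rewrite Hl.
  replace (1 - (y + 1 / 2) * (ln y + (/ y + / (y + 1)) / 2 - g - ln y))
    with ((y + 1 / 2) * g - / (4 * (y * (y + 1)))) by (field; lra).
  assert (Hg : (y + 1 / 2) * g <= / (2 * (y * (y + 1)))).
  { apply Rle_trans with ((y + 1 / 2) * / (6 * y ^ 3)); [apply Rmult_le_compat_l; lra|].
    apply Rmult_le_reg_r with (6 * y ^ 3 * (y + 1)).
    { apply Rmult_lt_0_compat; [|lra]. assert (0 < y ^ 3) by (apply pow_lt; lra). lra. }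
    replace ((y + 1 / 2) * / (6 * y ^ 3) * (6 * y ^ 3 * (y + 1)))
      with ((y + 1 / 2) * (y + 1)) by (field; lra).
    replace (/ (2 * (y * (y + 1))) * (6 * y ^ 3 * (y + 1))) with (3 * y ^ 2) by (field; lra).
    nra. }
  assert (Hg0 : 0 <= (y + 1 / 2) * g) by (apply Rmult_le_pos; lra).
  replace (1 / y - 1 / (y + 1)) with (/ (y * (y + 1))) by (field; lra).
  assert (Hr : 0 < / (y * (y + 1))) by (apply Rinv_0_lt_compat; nra).
  replace (/ (2 * (y * (y + 1)))) with (/ 2 * / (y * (y + 1))) in Hg by (field; lra).
  replace (/ (4 * (y * (y + 1)))) with (/ 4 * / (y * (y + 1))) by (field; lra).
  apply Rabs_le_between. lra.
Qed.

Lemma stirling n : (1 <= n)%nat ->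
  Rabs (lnfact n - (INR n + 1 / 2) * ln (INR n) + INR n - ln (2 * PI) / 2) <= / INR n.
Proof.
  intros Hn.
  destruct (telescoping_limit stirling_err (fun n => 1 / INR (S n))) as [L [HL Hb]].
  { exact stirling_err_step. }
  { apply is_lim_seq_inv_INR_S. }
  assert (HL2 : L = ln (2 * PI) / 2).
  { pose proof PI_RGT_0 as Hpi.
    (* The limit of this combination is 2 L, and Wallis evaluates it as ln (2 PI). The index 2n + 1
       stands for 2 (n + 1), since [stirling_err i] belongs to i + 1. *)
    pose (d := fun n => 2 * (2 * stirling_err n - stirling_err (2 * n + 1))).
    assert (Hd1 : is_lim_seq d (2 * (2 * L - L))).
    { apply (is_lim_seq_scal_l _ 2 (Finite _)). apply is_lim_seq_minus'.
      - apply (is_lim_seq_scal_l _ 2 (Finite _)). exact HL.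
      - apply (is_lim_seq_subseq stirling_err L (fun n => (2 * n + 1)%nat)); [|exact HL].
        apply eventually_subseq. intros; lia. }
    assert (Hd2 : is_lim_seq d (ln (2 * PI))).
    { apply is_lim_seq_le_le with (fun n => ln (2 * PI) - 2 / INR (S n))
        (fun n => ln (2 * PI) + 2 / INR (S n)).
      2:{ replace (Finite (ln (2 * PI))) with (Finite (ln (2 * PI) - 0)) by (f_equal; ring).
          apply is_lim_seq_minus'; [apply is_lim_seq_const|apply is_lim_seq_inv_INR_S]. }
      2:{ replace (Finite (ln (2 * PI))) with (Finite (ln (2 * PI) + 0)) by (f_equal; ring).
          apply is_lim_seq_plus'; [apply is_lim_seq_const|apply is_lim_seq_inv_INR_S]. }
      intros m. unfold d, stirling_err.
      replace (S (2 * m + 1)) with (2 * S m)%nat by lia.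
      destruct (ln_wallis_even (S m)) as [Hwp Hw].
      assert (HM : 1 <= INR (S m)) by (apply (le_INR 1); lia).
      rewrite (mult_INR 2 (S m)). simpl (INR 2).
      set (M := INR (S m)) in *. set (k := (2 * S m)%nat) in *.
      assert (Hk : INR k = 2 * M) by (unfold k; rewrite mult_INR; easy).
      pose proof (wallis_prod k) as P1. pose proof (wallis_decr k) as P2.
      pose proof (wallis_decr (S k)) as P3. pose proof (wallis_rec k) as P4.
      rewrite Hk in *. set (W := wallis k) in *. set (W1 := wallis (S k)) in *.
      set (W2 := wallis (S (S k))) in *.
      assert (HW2 : W2 = (2 * M + 1) / (2 * M + 2) * W).
      { apply Rmult_eq_reg_l with (2 * M + 2); [|lra]. rewrite P4. field. lra. }
      (* Monotonicity of the Wallis integrals squeezes (2M + 1) W^2 between PI / 2 and PI / 2 (1 + 1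
         / (2M + 1)). *)
      assert (U1 : PI / 2 <= (2 * M + 1) * (W * W)).
      { rewrite <- P1. apply Rmult_le_compat_l; [lra|]. apply Rmult_le_compat_l; lra. }
      assert (U2 : (2 * M + 1) * (W * W) <= PI / 2 * ((2 * M + 2) / (2 * M + 1))).
      { rewrite <- P1. apply Rle_trans with ((2 * M + 1) * (W * W2) * ((2 * M + 2) / (2 * M + 1))).
        - right. rewrite HW2. field. lra.
        - apply Rmult_le_compat_r; [left; apply Rdiv_lt_0_compat; lra|].
          apply Rmult_le_compat_l; [lra|]. apply Rmult_le_compat_l; lra. }
      assert (HWW : 0 < W * W) by (apply Rmult_lt_0_compat; lra).
      apply ln_le in U1; [|lra]. apply ln_le in U2; [|apply Rmult_lt_0_compat; lra].
      rewrite (ln_mult (PI / 2)) in U2 by (try lra; apply Rdiv_lt_0_compat; lra).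
      rewrite ln_mult, ln_mult in U1, U2 by lra.
      rewrite ln_div in U2 by lra. rewrite Hw in U1, U2.
      assert (V1 : ln (2 * M + 2) - ln (2 * M + 1) <= / M).
      { pose proof (ln_add_bounds (2 * M + 1) 1 ltac:(lra) ltac:(lra)) as [_ Hv].
        replace (2 * M + 1 + 1) with (2 * M + 2) in Hv by ring.
        eapply Rle_trans; [exact Hv|]. unfold Rdiv. rewrite Rmult_1_l.
        apply Rinv_le_contravar; lra. }
      pose proof (ln_add_bounds (2 * M) 1 ltac:(lra) ltac:(lra)) as [V2 V3].
      assert (V4 : 0 <= 1 / (2 * M + 1)) by (apply Rdiv_le_0_compat; lra).
      assert (V5 : 1 / (2 * M) <= / M).
      { unfold Rdiv. rewrite Rmult_1_l. apply Rinv_le_contravar; lra. }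
      rewrite (ln_mult 2 M) in V2, V3 by lra.
      replace ((1 + 1) * M) with (2 * M) by ring. rewrite (ln_mult 2 M) by lra.
      rewrite (ln_mult 2 PI) by lra.
      rewrite ln_div in U1, U2 by lra.
      rewrite (ln_div (2 * M + 2)) in U2 by lra. lra. }
    apply is_lim_seq_unique in Hd1. apply is_lim_seq_unique in Hd2.
    rewrite Hd1 in Hd2. injection Hd2. intros; lra. }
  destruct n as [|n]; [lia|]. specialize (Hb n). unfold stirling_err in Hb.
  rewrite HL2 in Hb. unfold Rdiv at 3 in Hb. rewrite Rmult_1_l in Hb. exact Hb.
Qed.

(** * Reciprocity for sawtooth sums *)

(** The fractional part {j q' / q}, written with a remainder so that coprimality arguments stay in
    the natural numbers. *)
Definition frac_mul (q' q j : nat) : R := INR ((j * q') mod q) / INR q.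
Definition saw (q' q j : nat) : R := (1 - 2 * frac_mul q' q j) / INR j.
Definition sawsum (q' q N : nat) : R := psum (fun i => saw q' q (S i)) N.

Lemma frac_mul_floor q' q j : (0 < q)%nat ->
  frac_mul q' q j = INR j * (INR q' / INR q) - INR (j * q' / q).
Proof.
  intros Hq. unfold frac_mul. pose proof (lt_0_INR q Hq).
  pose proof (Nat.div_mod (j * q') q ltac:(lia)) as Hd.
  assert (HR : INR j * INR q' = INR q * INR (j * q' / q) + INR ((j * q') mod q)).
  { rewrite <- !mult_INR, <- plus_INR. now f_equal. }
  replace (INR j * (INR q' / INR q)) with (INR j * INR q' / INR q) by (field; lra).
  rewrite HR. field. lra.
Qed.

Lemma frac_mul_bounds q' q j : (0 < q)%nat -> 0 <= frac_mul q' q j < 1.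
Proof.
  intros Hq. unfold frac_mul. pose proof (lt_0_INR q Hq).
  pose proof (pos_INR ((j * q') mod q)).
  pose proof (lt_INR _ _ (Nat.mod_upper_bound (j * q') q ltac:(lia))).
  split; [now apply Rdiv_le_0_compat|].
  apply Rmult_lt_reg_r with (INR q); [easy|]. field_simplify; lra.
Qed.

(** As beta = q' / q <= 1, the floor of N beta grows by at most one. When it jumps, coprimality and
    N + 1 < q exclude that (N + 1) beta is an integer, so the jump to m happens exactly after N =
    floor (m / beta). *)
Lemma floor_mul_succ q' q N : (0 < q' <= q)%nat -> Nat.gcd q' q = 1%nat -> (S N < q)%nat ->
  (S N * q' / q = N * q' / q)%nat \/
  (S N * q' / q = S (N * q' / q) /\ S (N * q' / q) * q / q' = N)%nat.
Proof.
  intros Hq Hg HN.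
  pose proof (Nat.div_mod (N * q') q ltac:(lia)) as D1.
  pose proof (Nat.mod_upper_bound (N * q') q ltac:(lia)) as B1.
  set (M := (N * q' / q)%nat) in *. set (r := ((N * q') mod q)%nat) in *.
  destruct (Nat.lt_ge_cases (r + q') q) as [Hlt|Hge].
  - left. symmetry. apply Nat.div_unique with (r + q')%nat; nia.
  - right. split.
    + symmetry. apply Nat.div_unique with (r + q' - q)%nat; nia.
    + assert (Hne : (S M * q <> S N * q')%nat).
      { intros He. assert (Hd : Nat.divide q (S N)).
        { apply Nat.gauss with q'; [|now rewrite Nat.gcd_comm].
          exists (S M). lia. }
        apply Nat.divide_pos_le in Hd; lia. }
      symmetry. apply Nat.div_unique with (S M * q - N * q')%nat; nia.
Qed.

(* Summation by parts over the integers m < N beta: floor (j beta) counts the m with m / beta <= j. *)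
Lemma sawsum_floor q' q N : (0 < q' <= q)%nat -> Nat.gcd q' q = 1%nat -> (N < q)%nat ->
  sawsum q' q N
  = (2 * INR (N * q' / q) + 1) * harm N - 2 * (INR q' / INR q) * INR N
    - 2 * psum (fun m => harm (S m * q / q')) (N * q' / q).
Proof.
  intros Hq Hg. induction N as [|N IH]; intros HN.
  - rewrite Nat.mul_0_l, Nat.Div0.div_0_l. simpl. unfold sawsum, harm. simpl. ring.
  - change (sawsum q' q (S N)) with (sawsum q' q N + saw q' q (S N)).
    rewrite IH by lia. unfold saw. rewrite frac_mul_floor by lia.
    rewrite harm_S.
    pose proof (lt_0_INR (S N) ltac:(lia)). pose proof (lt_0_INR q ltac:(lia)).
    destruct (floor_mul_succ q' q N Hq Hg HN) as [He|[He He2]]; rewrite He.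
    + rewrite S_INR in *. field. lra.
    + rewrite psum_S, He2. rewrite !S_INR in *. field. lra.
Qed.

Definition saw_main (b : R) : R := - ln b + euler_gamma - ln (2 * PI).

(** In [sawsum_floor] the harmonic numbers are replaced by their asymptotics; the main logarithms
    sum to ln M!, which Stirling evaluates, and the terms of order 1 / y form the sawtooth sum one
    level below. The errors are 64 beta + 5 beta, and 7 / M plus twice the 1 / M of Stirling. *)
Lemma sawsum_reciprocity q' q a q'' N :
  (0 < q' <= q)%nat -> Nat.gcd q' q = 1%nat -> (q = a * q' + q'')%nat -> (N < q)%nat ->
  (1 <= N * q' / q)%nat ->
  Rabs (sawsum q' q N - saw_main (INR q' / INR q)
        + INR q' / INR q * sawsum q'' q' (N * q' / q))
  <= 70 * (INR q' / INR q) + 10 / INR (N * q' / q).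
Proof.
  intros Hq Hg Ha HN HM.
  rewrite sawsum_floor by easy.
  assert (Hq0 : 0 < INR q) by (apply lt_0_INR; lia).
  assert (Hq'0 : 0 < INR q') by (apply lt_0_INR; lia).
  assert (HMN : INR N * (INR q' / INR q) - INR (N * q' / q) = frac_mul q' q N)
    by (symmetry; apply frac_mul_floor; lia).
  pose proof (frac_mul_bounds q' q N ltac:(lia)) as Hth.
  assert (HN1 : (1 <= N)%nat) by (destruct N; [rewrite Nat.mul_0_l, Nat.Div0.div_0_l in HM|]; lia).
  set (M := (N * q' / q)%nat) in *. set (t := frac_mul q' q N) in *.
  set (b := INR q' / INR q) in *.
  assert (Hb0 : 0 < b) by (now apply Rdiv_lt_0_compat).
  assert (Hb1 : b <= 1) by (apply -> Rdiv_le_1; [apply le_INR; lia|easy]).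
  assert (HMR : 1 <= INR M) by (apply (le_INR 1); lia).
  assert (HNR : 1 <= INR N) by (apply (le_INR 1); lia).
  assert (Hsum : Rabs (2 * psum (fun m => harm (S m * q / q')) M
     - (2 * lnfact M - 2 * INR M * ln b + 2 * INR M * euler_gamma) - b * sawsum q'' q' M)
     <= 64 * b).
  { assert (He : 2 * psum (fun m => harm (S m * q / q')) M
     - (2 * lnfact M - 2 * INR M * ln b + 2 * INR M * euler_gamma) - b * sawsum q'' q' M
     = psum (fun m => 2 * harm (S m * q / q') - 2 * ln (INR (S m)) - (2 * euler_gamma - 2 * ln b)
               - b * saw q'' q' (S m)) M).
    { rewrite !psum_minus, !psum_scal, !psum_const. unfold sawsum, lnfact. ring. }
    rewrite He.
    apply Rle_trans with (psum (fun m => 32 * b * / INR (S m) ^ 2) M).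
    2:{ rewrite psum_scal. pose proof (psum_inv_sq_le M). nra. }
    apply psum_abs_le. intros m Hm.
    assert (Hm1 : 1 <= INR (S m)) by (apply (le_INR 1); lia).
    set (n := (S m * q / q')%nat).
    assert (Hn : (1 <= n)%nat) by (apply Nat.div_le_lower_bound; nia).
    pose proof (frac_mul_floor q q' (S m) ltac:(lia)) as Hf. fold n in Hf.
    (* As q = a q' + q'', multiples of q / q' and of q'' / q' have equal fractional parts: this is
       the Gauss map. *)
    assert (Hfr : frac_mul q q' (S m) = frac_mul q'' q' (S m)).
    { unfold frac_mul. f_equal. f_equal. rewrite Ha.
      replace (S m * (a * q' + q''))%nat with (S m * q'' + (S m * a) * q')%nat by ring.
      now rewrite Nat.Div0.mod_add. }
    assert (Hy : INR (S m) * (INR q / INR q') = INR (S m) / b) by (unfold b; field; lra).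
    rewrite Hy in Hf.
    pose proof (frac_mul_bounds q q' (S m) ltac:(lia)) as Hfb.
    pose proof (harm_floor_asymp n (INR (S m) / b) Hn ltac:(lra)) as Hh.
    rewrite ln_div in Hh by lra.
    replace (INR (S m) / b - INR n) with (frac_mul q'' q' (S m)) in Hh by lra.
    replace (16 / (INR (S m) / b) ^ 2) with (16 * b * b * / INR (S m) ^ 2) in Hh by (field; lra).
    unfold saw.
    replace (b * ((1 - 2 * frac_mul q'' q' (S m)) / INR (S m)))
      with (2 * ((1 / 2 - frac_mul q'' q' (S m)) / (INR (S m) / b))) by (field; lra).
    assert (Hi : 0 < / INR (S m) ^ 2) by (apply Rinv_0_lt_compat; nra).
    assert (Hbb : 16 * b * b * / INR (S m) ^ 2 <= 16 * b * / INR (S m) ^ 2).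
    { apply Rmult_le_compat_r; [lra|]. nra. }
    apply Rabs_le_between in Hh. apply Rabs_le_between. lra. }
  pose proof (harm_asymp N HN1) as HhN.
  pose proof (stirling M HM) as Hst.
  (* The factor 2M + 1 is at most 3 N beta, which turns the error 1 / N of [harm N] into beta. *)
  assert (HeN : Rabs ((2 * INR M + 1) * (harm N - ln (INR N) - euler_gamma)) <= 5 * b).
  { rewrite Rabs_mult, (Rabs_pos_eq (2 * INR M + 1)) by lra.
    assert (H1 : Rabs (harm N - ln (INR N) - euler_gamma) <= 3 / 2 * / INR N).
    { assert (/ INR N ^ 2 <= / INR N).
      { apply Rinv_le_contravar; nra. }
      replace (/ (2 * INR N)) with (/ 2 * / INR N) in HhN by (field; lra).
      assert (0 < / INR N) by (apply Rinv_0_lt_compat; lra).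
      apply Rabs_le_between in HhN. apply Rabs_le_between. lra. }
    apply Rle_trans with ((3 * (INR N * b)) * (3 / 2 * / INR N)).
    - apply Rmult_le_compat; try lra. apply Rabs_pos.
    - replace (3 * (INR N * b) * (3 / 2 * / INR N)) with (9 / 2 * b) by (field; lra). lra. }
  (* N beta = M + t, so the logarithms leave 2t up to O(1 / M); this cancels against the - 2 N beta
     of [sawsum_floor] and the 2M of Stirling. *)
  assert (Hlog : Rabs ((2 * INR M + 1) * (ln (INR N) + ln b - ln (INR M)) - 2 * t) <= 7 / INR M).
  { rewrite <- ln_mult by lra. replace (INR N * b) with (INR M + t) by lra.
    pose proof (ln_add_quadratic (INR M) t ltac:(lra) ltac:(lra)) as Hl.
    set (d := ln (INR M + t) - ln (INR M) - t / INR M) in *.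
    replace ((2 * INR M + 1) * (ln (INR M + t) - ln (INR M)) - 2 * t)
      with ((2 * INR M + 1) * d + t / INR M) by (unfold d; field; lra).
    assert (Hd : Rabs ((2 * INR M + 1) * d) <= 6 / INR M).
    { rewrite Rabs_mult, (Rabs_pos_eq (2 * INR M + 1)) by lra.
      apply Rle_trans with (3 * INR M * (2 * / INR M ^ 2)).
      - apply Rmult_le_compat; try lra; [apply Rabs_pos|].
        eapply Rle_trans; [exact Hl|]. unfold Rdiv. apply Rmult_le_compat_r.
        + left; apply Rinv_0_lt_compat; nra.
        + assert (t * t <= 1 * 1) by (apply Rmult_le_compat; lra). lra.
      - right. field. lra. }
    assert (Ht : 0 <= t / INR M <= / INR M).
    { assert (0 < / INR M) by (apply Rinv_0_lt_compat; lra). unfold Rdiv. split; nra. }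
    unfold Rdiv in *. apply Rabs_le_between in Hd. apply Rabs_le_between. lra. }
  assert (HiM : 0 < / INR M) by (apply Rinv_0_lt_compat; lra).
  unfold saw_main.
  apply Rabs_le_between in Hsum, Hst, HeN, Hlog.
  unfold Rdiv in *. apply Rabs_le_between.
  replace t with (INR N * b - INR M) in Hlog by lra.
  split; lra.
Qed.

(** Bounds the constant part of [saw_main] plus 80 = 70 + 10, the worst error of
    [sawsum_reciprocity]. *)
Definition saw_const : R := Rabs euler_gamma + Rabs (ln (2 * PI)) + 80.

(** The crude form of reciprocity, valid for every truncation N < q and therefore iterable. It needs
    a bound for all truncations one level below, since floor (N beta) is arbitrary there. *)
Lemma sawsum_bound_step q' q a q'' rho N :
  (0 < q' <= q)%nat -> Nat.gcd q' q = 1%nat -> (q = a * q' + q'')%nat ->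
  (forall M, (M < q')%nat -> Rabs (sawsum q'' q' M) <= rho) ->
  (N < q)%nat ->
  Rabs (sawsum q' q N) <= - ln (INR q' / INR q) + saw_const + INR q' / INR q * rho.
Proof.
  intros Hq Hg Ha Hrho HN.
  assert (Hq0 : 0 < INR q) by (apply lt_0_INR; lia).
  assert (Hq'0 : 0 < INR q') by (apply lt_0_INR; lia).
  assert (Hb0 : 0 < INR q' / INR q) by (now apply Rdiv_lt_0_compat).
  assert (Hb1 : INR q' / INR q <= 1) by (apply -> Rdiv_le_1; [apply le_INR; lia|easy]).
  assert (Hln : 0 <= - ln (INR q' / INR q)).
  { pose proof (ln_le_sub_1 _ Hb0). lra. }
  pose proof (Rabs_pos euler_gamma) as Hg0. pose proof (Rabs_pos (ln (2 * PI))) as Hp0.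
  assert (Hr0 : 0 <= rho).
  { eapply Rle_trans; [apply Rabs_pos|apply (Hrho O); lia]. }
  unfold saw_const.
  destruct (Nat.eq_dec (N * q' / q) 0) as [H0|H0].
  - pose proof (frac_mul_floor q' q N ltac:(lia)) as Hf.
    pose proof (frac_mul_bounds q' q N ltac:(lia)) as Hfb.
    rewrite sawsum_floor by easy. rewrite H0 in *. simpl psum. simpl INR in *.
    assert (Hbr : 0 <= INR q' / INR q * rho) by nra.
    destruct N as [|N].
    + unfold harm. simpl. match goal with |- Rabs ?e <= _ => replace e with 0 by ring end.
      rewrite Rabs_R0. lra.
    + assert (HN1 : 1 <= INR (S N)) by (apply (le_INR 1); lia).
      pose proof (harm_asymp (S N) ltac:(lia)) as Hh.
      set (n := INR (S N)) in *. set (b := INR q' / INR q) in *.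
      assert (Hi : 0 < / n <= 1) by now apply Rinv_unit.
      replace (/ (2 * n)) with (/ 2 * / n) in Hh by (field; lra).
      replace (/ n ^ 2) with (/ n * / n) in Hh by (field; lra).
      assert (Hnn : / n * / n <= 1 * 1) by (apply Rmult_le_compat; lra).
      assert (Hl : ln n <= - ln b).
      { pose proof (ln_le_sub_1 (n * b) ltac:(nra)) as Hl. rewrite ln_mult in Hl by lra. lra. }
      assert (Hl0 : 0 <= ln n) by (rewrite <- ln_1; apply ln_le; lra).
      apply Rabs_le_between in Hh.
      pose proof (Rabs_between euler_gamma). apply Rabs_le_between. lra.
  - pose proof (sawsum_reciprocity q' q a q'' N Hq Hg Ha HN ltac:(lia)) as Hrec.
    assert (HM : (N * q' / q < q')%nat) by (apply Nat.Div0.div_lt_upper_bound; nia).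
    specialize (Hrho _ HM).
    assert (HMR : 1 <= INR (N * q' / q)) by (apply (le_INR 1); lia).
    assert (HiM : 10 / INR (N * q' / q) <= 10).
    { apply Rmult_le_reg_r with (INR (N * q' / q)); [lra|]. field_simplify; lra. }
    set (s := sawsum q'' q' (N * q' / q)) in *. set (b := INR q' / INR q) in *.
    assert (Hbs : Rabs (b * s) <= b * rho).
    { rewrite Rabs_mult, Rabs_pos_eq by lra. apply Rmult_le_compat_l; lra. }
    unfold saw_main in Hrec.
    pose proof (Rabs_between euler_gamma).
    pose proof (Rabs_between (ln (2 * PI))).
    apply Rabs_le_between in Hbs. apply Rabs_le_between in Hrec.
    apply Rabs_le_between. lra.
Qed.

(** * Continued fractions *)

Lemma floorR_bounds y : IZR (floorR y) <= y < IZR (floorR y) + 1.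
Proof. unfold floorR. pose proof (base_Int_part y). lra. Qed.

Lemma floorR_unique y z : IZR z <= y < IZR z + 1 -> floorR y = z.
Proof.
  intros H. pose proof (floorR_bounds y) as Hf.
  assert (H1 : IZR (floorR y) < IZR (z + 1)) by (rewrite plus_IZR; lra).
  assert (H2 : IZR z < IZR (floorR y + 1)) by (rewrite plus_IZR; lra).
  apply lt_IZR in H1. apply lt_IZR in H2. lia.
Qed.

Lemma irrational_not_floor y : irrational y -> IZR (floorR y) < y.
Proof.
  intros Hy. destruct (floorR_bounds y) as [[H|H] _]; [easy|exfalso].
  apply Hy. exists (floorR y), 1%Z. split; [lia|]. rewrite <- H at 1. field.
Qed.

Lemma cf_state_irrational alpha n : irrational alpha -> irrational (cf_state alpha n).
Proof.
  intros Ha. induction n as [|n IH]; [exact Ha|].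
  intros (m & d & Hd & He). simpl in He.
  pose proof (irrational_not_floor _ IH) as Hf.
  set (y := cf_state alpha n) in *. set (a := floorR y) in *.
  assert (HdR : IZR d <> 0) by (now apply not_0_IZR).
  assert (Hm : m <> 0%Z).
  { intros ->. assert (H : (y - IZR a) * / (y - IZR a) = 1) by (field; lra).
    rewrite He in H. unfold Rdiv in H. lra. }
  assert (HmR : IZR m <> 0) by (now apply not_0_IZR).
  apply IH. exists (a * m + d)%Z, m. split; [easy|].
  rewrite plus_IZR, mult_IZR. apply (Rplus_eq_reg_r (- IZR a)).
  transitivity (/ / (y - IZR a)); [rewrite Rinv_inv; ring|]. rewrite He. field. lra.
Qed.

Lemma cf_state_gt_1 alpha n : irrational alpha -> 1 < cf_state alpha (S n).
Proof.
  intros Ha. simpl. pose proof (irrational_not_floor _ (cf_state_irrational alpha n Ha)) as H.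
  pose proof (floorR_bounds (cf_state alpha n)).
  rewrite <- Rinv_1 at 1. apply Rinv_lt_contravar; lra.
Qed.

Lemma cf_digit_pos alpha n : irrational alpha -> (1 <= cf_digit alpha (S n))%Z.
Proof.
  intros Ha. pose proof (cf_state_gt_1 alpha n Ha) as H.
  pose proof (floorR_bounds (cf_state alpha (S n))) as Hf. unfold cf_digit.
  assert (H1 : 1 < IZR (floorR (cf_state alpha (S n)) + 1)) by (rewrite plus_IZR; lra).
  apply lt_IZR in H1. lia.
Qed.

Lemma cf_digit_nat_pos alpha n : irrational alpha -> (1 <= Z.to_nat (cf_digit alpha (S n)))%nat.
Proof. intros Ha. pose proof (cf_digit_pos alpha n Ha). lia. Qed.

Lemma aR_ge_1 alpha n : irrational alpha -> (1 <= n)%nat -> 1 <= aR alpha n.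
Proof.
  intros Ha Hn. destruct n as [|n]; [lia|]. apply IZR_le. now apply cf_digit_pos.
Qed.

Lemma cf_state_digit alpha n : aR alpha n <= cf_state alpha n < aR alpha n + 1.
Proof. apply floorR_bounds. Qed.

Lemma INR_cf_digit alpha n : irrational alpha -> (1 <= n)%nat ->
  INR (Z.to_nat (cf_digit alpha n)) = aR alpha n.
Proof.
  intros Ha Hn. destruct n as [|n]; [lia|].
  pose proof (cf_digit_pos alpha n Ha). unfold aR. rewrite INR_IZR_INZ. f_equal. lia.
Qed.

Lemma q_pair_S alpha k :
  q_pair alpha (S k)
  = (snd (q_pair alpha k),
     (Z.to_nat (cf_digit alpha (S k)) * snd (q_pair alpha k) + fst (q_pair alpha k))%nat).
Proof. simpl. destruct (q_pair alpha k); reflexivity. Qed.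

Lemma fst_q_pair alpha k : fst (q_pair alpha (S k)) = qden alpha k.
Proof. rewrite q_pair_S. reflexivity. Qed.

Lemma qden_SS alpha k :
  qden alpha (S (S k))
  = (Z.to_nat (cf_digit alpha (S (S k))) * qden alpha (S k) + qden alpha k)%nat.
Proof. unfold qden at 1. rewrite q_pair_S, fst_q_pair. reflexivity. Qed.

Lemma qden_le_S alpha k : irrational alpha -> (qden alpha k <= qden alpha (S k))%nat.
Proof.
  intros Ha. pose proof (cf_digit_nat_pos alpha k Ha).
  unfold qden. rewrite q_pair_S; simpl snd.
  generalize dependent (Z.to_nat (cf_digit alpha (S k))). intros; nia.
Qed.

Lemma qden_pos alpha k : irrational alpha -> (1 <= qden alpha k)%nat.
Proof.
  intros Ha. induction k as [|k IH]; [unfold qden; simpl; lia|].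
  pose proof (qden_le_S alpha k Ha). lia.
Qed.

Lemma qden_SS_ge alpha k : irrational alpha ->
  (qden alpha (S k) + qden alpha k <= qden alpha (S (S k)))%nat.
Proof.
  intros Ha. pose proof (cf_digit_nat_pos alpha (S k) Ha). rewrite qden_SS.
  generalize dependent (Z.to_nat (cf_digit alpha (S (S k)))). intros; nia.
Qed.

Lemma qden_double alpha k : irrational alpha -> (2 * qden alpha k <= qden alpha (S (S k)))%nat.
Proof.
  intros Ha. pose proof (qden_SS_ge alpha k Ha). pose proof (qden_le_S alpha k Ha). lia.
Qed.

Lemma qden_ge alpha k : irrational alpha -> (k <= qden alpha k)%nat.
Proof.
  intros Ha.
  assert (H : forall k, (k <= qden alpha k /\ S k <= qden alpha (S k))%nat).
  { intros m. induction m as [|k' [IH1 IH2]].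
    - split; [lia|]. exact (qden_pos alpha 1 Ha).
    - split; [easy|]. pose proof (qden_SS_ge alpha k' Ha).
      pose proof (qden_pos alpha k' Ha). lia. }
  apply (H k).
Qed.

Lemma qden_coprime alpha k : Nat.gcd (qden alpha k) (qden alpha (S k)) = 1%nat.
Proof.
  assert (H : forall k, Nat.gcd (fst (q_pair alpha k)) (snd (q_pair alpha k)) = 1%nat).
  { clear k. intros k. induction k as [|k IH]; [reflexivity|].
    rewrite q_pair_S; simpl fst; simpl snd.
    rewrite Nat.add_comm, Nat.gcd_add_mult_diag_r, Nat.gcd_comm. exact IH. }
  specialize (H (S k)). rewrite fst_q_pair in H. exact H.
Qed.

(** Numerators (p_(k-1), p_k) of the convergents, in Z because [alpha] may be negative. *)
Fixpoint p_pair (alpha : R) (k : nat) : Z * Z :=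
  match k with
  | O => (1%Z, cf_digit alpha 0)
  | S j => let (pm, pj) := p_pair alpha j in (pj, (cf_digit alpha (S j) * pj + pm)%Z)
  end.

Lemma p_pair_S alpha k :
  p_pair alpha (S k)
  = (snd (p_pair alpha k), (cf_digit alpha (S k) * snd (p_pair alpha k) + fst (p_pair alpha k))%Z).
Proof. simpl. destruct (p_pair alpha k); reflexivity. Qed.

Lemma convergent_det alpha k : irrational alpha ->
  IZR (snd (p_pair alpha k)) * INR (fst (q_pair alpha k))
  - IZR (fst (p_pair alpha k)) * INR (snd (q_pair alpha k)) = - (-1) ^ k.
Proof.
  intros Ha. induction k as [|k IH]; [simpl; ring|].
  rewrite p_pair_S, q_pair_S; simpl fst; simpl snd.
  rewrite plus_INR, mult_INR, plus_IZR, mult_IZR, INR_cf_digit by (easy || lia).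
  unfold aR. simpl pow. lra.
Qed.

Lemma convergent_state alpha k : irrational alpha ->
  alpha * (cf_state alpha (S k) * INR (snd (q_pair alpha k)) + INR (fst (q_pair alpha k)))
  = cf_state alpha (S k) * IZR (snd (p_pair alpha k)) + IZR (fst (p_pair alpha k)).
Proof.
  intros Ha.
  assert (Hst : forall n, cf_state alpha (S n) * (cf_state alpha n - aR alpha n) = 1).
  { intros n. pose proof (irrational_not_floor _ (cf_state_irrational alpha n Ha)).
    simpl. unfold aR, cf_digit. field. lra. }
  induction k as [|k IH].
  - specialize (Hst 0%nat). simpl fst; simpl snd. simpl (INR 1). simpl (INR 0).
    change (cf_state alpha 0) with alpha in Hst. unfold aR in Hst. lra.
  - rewrite p_pair_S, q_pair_S; simpl fst; simpl snd.
    rewrite plus_INR, mult_INR, plus_IZR, mult_IZR, INR_cf_digit by (easy || lia).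
    specialize (Hst (S k)). fold (aR alpha (S k)).
    set (s1 := cf_state alpha (S k)) in *. set (s2 := cf_state alpha (S (S k))) in *.
    set (a := aR alpha (S k)) in *.
    set (q1 := INR (snd (q_pair alpha k))) in *. set (q0 := INR (fst (q_pair alpha k))) in *.
    set (p1 := IZR (snd (p_pair alpha k))) in *. set (p0 := IZR (fst (p_pair alpha k))) in *.
    assert (Hs : s2 * s1 = 1 + s2 * a) by lra.
    transitivity (s2 * (alpha * (s1 * q1 + q0)) + alpha * q1 * (1 + s2 * a - s2 * s1)); [ring|].
    rewrite IH, Hs.
    transitivity (p1 * (s2 * s1) + s2 * p0); [ring|]. rewrite Hs. ring.
Qed.

(** The distance of q_(k+1) alpha from the nearest integer in closed form. The index starts at q_1:
    for q_0 = 1 the corresponding expression may exceed 1/2. *)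
Definition theta (alpha : R) (k : nat) : R :=
  / (cf_state alpha (S (S k)) * INR (qden alpha (S k)) + INR (qden alpha k)).

Lemma theta_bounds alpha k : irrational alpha -> 0 < theta alpha k < 1 / 2.
Proof.
  intros Ha. unfold theta. pose proof (cf_state_gt_1 alpha (S k) Ha).
  pose proof (le_INR _ _ (qden_pos alpha k Ha)) as H1.
  pose proof (le_INR _ _ (qden_pos alpha (S k) Ha)) as H2. simpl (INR 1) in *.
  split; [apply Rinv_0_lt_compat; nra|].
  replace (1 / 2) with (/ 2) by field. apply Rinv_lt_contravar; nra.
Qed.

Lemma qden_mul_alpha alpha k : irrational alpha ->
  INR (qden alpha (S k)) * alpha
  = IZR (snd (p_pair alpha (S k))) + (-1) ^ (S k) * theta alpha k.
Proof.
  intros Ha. pose proof (convergent_det alpha (S k) Ha) as Hd.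
  pose proof (convergent_state alpha (S k) Ha) as Hs.
  rewrite fst_q_pair in *. fold (qden alpha (S k)) in *.
  pose proof (theta_bounds alpha k Ha) as Ht. unfold theta in *.
  set (s := cf_state alpha (S (S k))) in *. set (q := INR (qden alpha (S k))) in *.
  set (q' := INR (qden alpha k)) in *.
  assert (Hne : s * q + q' <> 0).
  { intros H0. rewrite H0, Rinv_0 in Ht. lra. }
  apply (Rmult_eq_reg_r (s * q + q')); [|easy].
  rewrite Rmult_plus_distr_r, (Rmult_assoc _ (/ _)), Rinv_l by easy.
  replace ((-1) ^ S k) with (- (IZR (snd (p_pair alpha (S k))) * q' - IZR (fst (p_pair alpha (S k))) * q))
    by lra.
  transitivity (q * (alpha * (s * q + q'))); [ring|]. rewrite Hs. ring.
Qed.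

Lemma pow_m1_cases k : (-1) ^ k = 1 \/ (-1) ^ k = -1.
Proof. induction k as [|k [IH|IH]]; simpl; rewrite ?IH; [left|right|left]; ring. Qed.

Lemma dist_int_near z e : Rabs e < 1 / 2 -> dist_int (IZR z + e) = Rabs e.
Proof.
  intros He. unfold dist_int. destruct (Rle_dec 0 e) as [H|H].
  - rewrite Rabs_pos_eq in * by easy. rewrite (floorR_unique _ z) by lra.
    rewrite Rmin_left; lra.
  - rewrite Rabs_left in * by lra. rewrite (floorR_unique _ (z - 1)) by (rewrite minus_IZR; lra).
    rewrite minus_IZR. rewrite Rmin_right; lra.
Qed.

Lemma dist_int_qden alpha k : irrational alpha ->
  dist_int (INR (qden alpha (S k)) * alpha) = theta alpha k.
Proof.
  intros Ha. pose proof (theta_bounds alpha k Ha) as Ht. rewrite qden_mul_alpha by easy.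
  assert (He : Rabs ((-1) ^ S k * theta alpha k) = theta alpha k).
  { rewrite Rabs_mult, (Rabs_pos_eq (theta alpha k)) by lra.
    destruct (pow_m1_cases (S k)) as [-> | ->]; rewrite ?Rabs_Ropp, ?Rabs_R1;
      [|change (-1) with (- (1)); rewrite Rabs_Ropp, Rabs_R1]; ring. }
  rewrite dist_int_near; rewrite He; lra.
Qed.

Lemma Rabs_sin_shift z t : Rabs (sin (t + IZR z * PI)) = Rabs (sin t).
Proof.
  rewrite sin_plus. rewrite (sin_eq_0_1 (IZR z * PI)) by (now exists z).
  rewrite Rmult_0_r, Rplus_0_r, Rabs_mult.
  assert (Hc : Rabs (cos (IZR z * PI)) = 1).
  { pose proof (sin2_cos2 (IZR z * PI)) as H.
    rewrite (sin_eq_0_1 (IZR z * PI)) in H by (now exists z).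
    rewrite <- Rabs_R1. apply Rsqr_eq_abs_0. unfold Rsqr in *. lra. }
  rewrite Hc. ring.
Qed.

Lemma pprod_fold f n a : fold_right Rmult 1 (map f (seq a n)) = pprod (fun i => f (a + i)%nat) n.
Proof.
  revert a. induction n as [|n IH]; intros a; [easy|].
  rewrite pprod_S_l. simpl. rewrite IH, Nat.add_0_r. f_equal.
  apply pprod_ext. intros; f_equal; lia.
Qed.

Lemma pprod_reindex (f : nat -> R) (g : nat -> nat) n :
  (forall i, (i < n)%nat -> (g i < n)%nat) ->
  (forall i j, (i < n)%nat -> (j < n)%nat -> g i = g j -> i = j) ->
  pprod (fun i => f (g i)) n = pprod f n.
Proof.
  intros Hg Hinj.
  assert (HP : Permutation (map g (seq 0 n)) (seq 0 n)).
  { apply NoDup_Permutation_bis.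
    - apply NoDup_map_NoDup_ForallPairs; [|apply seq_NoDup].
      intros i j Hi Hj. apply in_seq in Hi, Hj. apply Hinj; lia.
    - now rewrite length_map.
    - intros i Hi. apply in_map_iff in Hi. destruct Hi as (j & <- & Hj).
      apply in_seq in Hj. apply in_seq. specialize (Hg j). lia. }
  assert (HF : forall l l', Permutation l l' -> fold_right Rmult 1 l = fold_right Rmult 1 l').
  { intros l l' H. induction H; simpl; try congruence. ring. }
  pose proof (HF _ _ (Permutation_map f HP)) as H.
  rewrite map_map in H.
  rewrite (pprod_fold (fun i => f (g i)) n 0), (pprod_fold f n 0) in H. exact H.
Qed.

(** * Reindexing and linearization *)

(** Coprimality keeps the remainder of j q' away from 0, the one value at which the reflection
    fails. *)
Lemma frac_mul_sym q' q j : Nat.gcd q' q = 1%nat -> (0 < j < q)%nat ->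
  frac_mul q' q (q - j) = 1 - frac_mul q' q j.
Proof.
  intros Hg Hj. unfold frac_mul.
  pose proof (Nat.div_mod (j * q') q ltac:(lia)) as D.
  pose proof (Nat.mod_upper_bound (j * q') q ltac:(lia)) as B.
  set (f := (j * q' / q)%nat) in *. set (r := ((j * q') mod q)%nat) in *.
  assert (Hr : r <> 0%nat).
  { intros H0. assert (Hd : Nat.divide q j).
    { apply Nat.gauss with q'; [|now rewrite Nat.gcd_comm]. exists f. lia. }
    apply Nat.divide_pos_le in Hd; lia. }
  assert (Hfq : (f < q')%nat) by nia.
  assert (He : (((q - j) * q') mod q = q - r)%nat).
  { assert (Hm : exists m, q' = (f + 1 + m)%nat) by (exists (q' - f - 1)%nat; lia).
    destruct Hm as [m Hm].
    symmetry. apply Nat.mod_unique with m; [lia|].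
    rewrite Nat.mul_sub_distr_r, D, Hm, !Nat.mul_add_distr_l. lia. }
  rewrite He, minus_INR by lia. pose proof (lt_0_INR q ltac:(lia)). field. lra.
Qed.

Lemma sudler_pprod alpha x N :
  sudler alpha x N = pprod (fun n => Rabs (2 * sin (PI * (INR (S n) * alpha + x)))) N.
Proof. induction N as [|N IH]; simpl; [|rewrite IH]; easy. Qed.

(* The substitution n = q - (j q' mod q), i.e. (-1)^k n p = j mod q. *)
Lemma sudler_reindex alpha k x : irrational alpha ->
  let q := qden alpha (S k) in let q' := qden alpha k in
  sudler alpha ((-1) ^ (S k) * x / INR q) q
  = pprod (fun j => Rabs (2 * sin (PI * (INR j + x
               + INR q * theta alpha k * (1 - frac_mul q' q j)) / INR q))) q.
Proof.
  intros Ha q q'. rewrite sudler_pprod.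
  pose proof (qden_pos alpha (S k) Ha) as Hq. fold q in Hq.
  pose proof (qden_coprime alpha k) as Hg. fold q q' in Hg.
  assert (Hq0 : 0 < INR q) by (apply lt_0_INR; lia).
  (* Factor number i of the product belongs to n = i + 1, hence the extra - 1. *)
  rewrite <- (pprod_reindex _ (fun j => (q - 1 - (j * q') mod q)%nat)).
  - apply pprod_ext. intros j Hj.
    pose proof (Nat.mod_upper_bound (j * q') q ltac:(lia)) as B.
    pose proof (frac_mul_floor q' q j Hq) as Hf.
    assert (Hn : INR (S (q - 1 - (j * q') mod q)) = INR q * (1 - frac_mul q' q j)).
    { unfold frac_mul. replace (S (q - 1 - (j * q') mod q)) with (q - (j * q') mod q)%nat by lia.
      rewrite minus_INR by lia. field. lra. }
    rewrite Hn.
    pose proof (qden_mul_alpha alpha k Ha) as Hqa. fold q in Hqa.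
    pose proof (convergent_det alpha (S k) Ha) as Hd. rewrite fst_q_pair in Hd.
    fold (qden alpha (S k)) in Hd. fold q q' in Hd.
    set (p := snd (p_pair alpha (S k))) in *. set (p' := fst (p_pair alpha (S k))) in *.
    set (sg := (-1) ^ S k) in *. set (th := theta alpha k) in *.
    set (F := (j * q' / q)%nat) in *.
    set (z := ((1 + Z.of_nat F) * p - Z.of_nat j * p')%Z).
    (* n p = q ((1 + F) p) - j q' p, and q' p = q p' - sg *)
    assert (Harg : PI * (INR q * (1 - frac_mul q' q j) * alpha + sg * x / INR q)
       = sg * (PI * (INR j + x + INR q * th * (1 - frac_mul q' q j)) / INR q) + IZR z * PI).
    { unfold z. rewrite minus_IZR, !mult_IZR, plus_IZR, <- !INR_IZR_INZ.
      replace (INR q * (1 - frac_mul q' q j) * alpha)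
        with ((1 - frac_mul q' q j) * (INR q * alpha)) by ring.
      rewrite Hqa.
      replace ((1 - frac_mul q' q j) * (IZR p + sg * th))
        with (IZR p + INR F * IZR p - INR j * (IZR p * INR q') / INR q + sg * th * (1 - frac_mul q' q j))
        by (rewrite Hf; field; lra).
      replace (IZR p * INR q') with (IZR p' * INR q - sg) by lra.
      field. lra. }
    rewrite Harg, !Rabs_mult, Rabs_sin_shift. f_equal.
    unfold sg. destruct (pow_m1_cases (S k)) as [-> | ->].
    + now rewrite Rmult_1_l.
    + match goal with |- context [sin (-1 * ?t)] => replace (-1 * t) with (- t) by ring end.
      now rewrite sin_neg, Rabs_Ropp.
  - intros i Hi. lia.
  - intros i j Hi Hj Hij.
    pose proof (Nat.mod_upper_bound (i * q') q ltac:(lia)) as B1.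
    pose proof (Nat.mod_upper_bound (j * q') q ltac:(lia)) as B2.
    assert (Hm : ((i * q') mod q = (j * q') mod q)%nat) by lia.
    pose proof (Nat.div_mod (i * q') q ltac:(lia)) as D1.
    pose proof (Nat.div_mod (j * q') q ltac:(lia)) as D2.
    assert (Hcase : forall a b, (a <= b)%nat -> (b < q)%nat ->
        ((a * q') mod q = (b * q') mod q)%nat -> a = b).
    { intros a b Hab Hb He.
      pose proof (Nat.div_mod (a * q') q ltac:(lia)) as E1.
      pose proof (Nat.div_mod (b * q') q ltac:(lia)) as E2.
      destruct (Nat.eq_dec a b) as [|Hne]; [easy|exfalso].
      assert (Hdv : Nat.divide q (b - a)).
      { apply Nat.gauss with q'; [|now rewrite Nat.gcd_comm].
        exists (b * q' / q - a * q' / q)%nat.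
        rewrite Nat.mul_sub_distr_r, Nat.mul_sub_distr_l. nia. }
      apply Nat.divide_pos_le in Hdv; lia. }
    destruct (Nat.le_ge_cases i j); [|symmetry]; apply Hcase; easy.
Qed.

(** Mean value theorem for ln sin. The bound on [e] leaves a third of the distance to q, so the
    intermediate point stays d / 3 away from the zeros, and 48 = 3 * 16. *)
Lemma ln_sin_ratio_approx q y e d :
  0 < d -> d <= y <= q - d -> 0 <= e -> e <= 2 / 3 * (q - y) ->
  Rabs (ln (sin (PI * (y + e) / q) / sin (PI * y / q)) - e * ctn q y) <= 48 * e ^ 2 / d ^ 2.
Proof.
  intros Hd Hy He He2. assert (Hq : 0 < q) by lra.
  rewrite ln_div by (apply sin_arg_pos; lra).
  destruct (MVT_gen (fun t => ln (sin (PI * t / q))) y (y + e) (ctn q)) as (c & Hc & Hm).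
  - intros t Ht. rewrite Rmin_left, Rmax_right in Ht by lra.
    pose proof (sin_arg_pos q t ltac:(lra)) as Hs. unfold ctn.
    auto_derive; [easy|]. unfold Rdiv. ring.
  - intros t Ht. rewrite Rmin_left, Rmax_right in Ht by lra.
    pose proof (sin_arg_pos q t ltac:(lra)) as Hs.
    apply continuity_pt_filterlim, (ex_derive_continuous (fun t => ln (sin (PI * t / q)))).
    auto_derive. easy.
  - rewrite Rmin_left, Rmax_right in Hc by lra. rewrite Hm.
    replace (ctn q c * (y + e - y) - e * ctn q y) with (e * (ctn q c - ctn q y)) by ring.
    rewrite Rabs_mult, (Rabs_pos_eq e) by easy.
    pose proof (ctn_lipschitz q c y (d / 3) d ltac:(lra) Hd ltac:(lra) Hy) as Hl.
    assert (Hcy : Rabs (y - c) <= e) by (apply Rabs_le_between; lra).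
    assert (Hi : 0 < / d ^ 2) by (apply Rinv_0_lt_compat; nra).
    apply Rle_trans with (e * (48 * e * / d ^ 2)).
    + apply Rmult_le_compat_l; [easy|]. eapply Rle_trans; [exact Hl|].
      replace (16 * Rabs (y - c) / (d / 3 * d)) with (48 * Rabs (y - c) * / d ^ 2) by (field; lra).
      apply Rmult_le_compat_r; lra.
    + right. field. lra.
Qed.

(** Pairs each index with its mirror image around a middle block; it serves to combine j with q -
    j. *)
Lemma psum_fold f n m :
  psum f (n + m + n)
  = psum (fun i => f i + f (n + m + n - 1 - i)%nat) n + psum (fun i => f (n + i)%nat) m.
Proof.
  rewrite psum_plus, !psum_app.
  rewrite <- (psum_rev (fun i => f (n + m + i)%nat)).
  rewrite (psum_ext (fun i => f (n + m + (n - 1 - i))%nat) (fun i => f (n + m + n - 1 - i)%nat)).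
  - ring.
  - intros i Hi. f_equal. lia.
Qed.

Lemma psum_inv_sq_shift_le s n : 0 < s <= 2 -> psum (fun i => / (INR i + s) ^ 2) n <= 9 / s ^ 2.
Proof.
  intros Hs. assert (Hi : 0 < / s ^ 2) by (apply Rinv_0_lt_compat; nra).
  assert (H8 : 2 <= 8 * / s ^ 2).
  { apply Rmult_le_reg_r with (s ^ 2); [nra|]. rewrite Rmult_assoc, Rinv_l by nra. nra. }
  destruct n as [|n]; [simpl psum; lra|].
  rewrite psum_S_l. simpl (INR 0). rewrite Rplus_0_l.
  assert (psum (fun i => / (INR (S i) + s) ^ 2) n <= 2); [|lra].
  eapply Rle_trans; [|apply (psum_inv_sq_le n)]. apply psum_le. intros j _.
  pose proof (lt_0_INR (S j) ltac:(lia)).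
  apply Rinv_le_contravar; [nra|]. apply pow_incr. lra.
Qed.

(** The derivative of [log_ratio] in C at C = 0. The index i + 2 runs over 2, ..., q - 2, that is,
    over all residues except 0, 1, -1. *)
Definition first_order (q' q : nat) (x : R) : R :=
  psum (fun i => (1 - frac_mul q' q (i + 2)) * ctn (INR q) (INR (i + 2) + x)) (q - 3).

Definition log_ratio (q' q : nat) (C x : R) : R :=
  psum (fun i => ln (sin (PI * (INR (i + 2) + x + C * (1 - frac_mul q' q (i + 2))) / INR q)
                     / sin (PI * (INR (i + 2) + x) / INR q))) (q - 3).

(** The quadratic errors are summable because the distance to the nearest zero grows linearly from 2
    - |x| at both ends of the range; 864 = 48 * 2 * 9. *)
Lemma log_ratio_approx (q' q : nat) (C x : R) :
  (4 <= q)%nat -> 0 <= C -> Rabs x < 2 ->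
  (forall j, (2 <= j <= q - 2)%nat ->
     C * (1 - frac_mul q' q j) <= 2 / 3 * (INR q - (INR j + x))) ->
  Rabs (log_ratio q' q C x - C * first_order q' q x) <= 864 * C ^ 2 / (2 - Rabs x) ^ 2.
Proof.
  intros Hq HC Hx Hcond.
  assert (Hs0 : 0 < 2 - Rabs x) by lra. pose proof (Rabs_pos x) as Hx0.
  assert (Hs : 0 < / (2 - Rabs x) ^ 2) by (apply Rinv_0_lt_compat; nra).
  unfold log_ratio, first_order. rewrite <- psum_scal, <- psum_minus.
  pose (g := fun i => / (INR i + (2 - Rabs x)) ^ 2).
  assert (Hg0 : forall i, 0 < g i).
  { intros i. unfold g. pose proof (pos_INR i). apply Rinv_0_lt_compat. nra. }
  apply Rle_trans with (psum (fun i => 48 * C ^ 2 * (g i + g (q - 3 - 1 - i)%nat)) (q - 3)).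
  - apply psum_abs_le. intros i Hi.
    pose proof (frac_mul_bounds q' q (i + 2) ltac:(lia)) as Hf.
    set (f := frac_mul q' q (i + 2)) in *.
    specialize (Hcond (i + 2)%nat ltac:(lia)). fold f in Hcond.
    pose proof (Rabs_between x) as Hx1.
    assert (He2 : (C * (1 - f)) ^ 2 <= C ^ 2).
    { apply pow_incr. split; [apply Rmult_le_pos; lra|].
      rewrite <- (Rmult_1_r C) at 2. apply Rmult_le_compat_l; lra. }
    (* For k up to both i and q - 4 - i, k + 2 - |x| bounds the distance of j + x from 0 and from q.
       The smaller of the two indices is then used, and its [g] is dominated by the sum over
       both. *)
    assert (Hmain : forall k, (k <= i)%nat -> (k <= q - 4 - i)%nat ->
      Rabs (ln (sin (PI * (INR (i + 2) + x + C * (1 - f)) / INR q)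
                     / sin (PI * (INR (i + 2) + x) / INR q))
            - C * ((1 - f) * ctn (INR q) (INR (i + 2) + x))) <= 48 * C ^ 2 * g k).
    { intros k Hk1 Hk2. rewrite <- Rmult_assoc.
      apply le_INR in Hk1. pose proof (pos_INR k) as Hk0.
      assert (Hqi : INR k + INR i + 4 <= INR q).
      { replace 4 with (INR 4) by (simpl; ring). rewrite <- !plus_INR. apply le_INR. lia. }
      pose proof (ln_sin_ratio_approx (INR q) (INR (i + 2) + x) (C * (1 - f)) (INR k + (2 - Rabs x))) as H.
      rewrite plus_INR in *. simpl (INR 2) in *.
      eapply Rle_trans; [apply H; try lra|].
      - apply Rmult_le_pos; lra.
      - unfold g, Rdiv. apply Rmult_le_compat_r; [left; apply Rinv_0_lt_compat; nra|]. lra. }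
    pose proof (Hg0 i) as G1. pose proof (Hg0 (q - 3 - 1 - i)%nat) as G2.
    assert (HC2 : 0 <= C ^ 2) by nra.
    destruct (Nat.le_ge_cases i (q - 4 - i)).
    + eapply Rle_trans; [apply (Hmain i); lia|]. nra.
    + eapply Rle_trans; [apply (Hmain (q - 3 - 1 - i)%nat); lia|]. nra.
  - rewrite psum_scal, psum_plus, (psum_rev g).
    pose proof (psum_inv_sq_shift_le (2 - Rabs x) (q - 3) ltac:(lra)) as Hb. fold g in Hb.
    assert (HC2 : 0 <= C ^ 2) by nra.
    unfold Rdiv in *. nra.
Qed.

(** * The cotangent sum at finite level *)

(** The poles at 0 cancel: t - sin t <= t^3 / 6 against sin t >= t / 6 gives (t^3 / 6) (2t) / (t^4 /
    36) = 12. *)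
Lemma inv_sin_sq_sub_bound t : 0 < t <= 3 * PI / 4 -> 0 <= / sin t ^ 2 - / t ^ 2 <= 12.
Proof.
  intros Ht. pose proof PI_lt_16_5 as Hp. pose proof PI_RGT_0 as Hp0.
  assert (Hs : t / 6 <= sin t).
  { eapply Rle_trans; [|apply sin_ge_min; lra].
    unfold Rmin. destruct Rle_dec; lra. }
  assert (Hst : sin t <= t) by (apply sin_le_self; lra).
  assert (Hs3 : t - sin t <= t ^ 3 / 6).
  { pose proof (pre_sin_bound t 0 ltac:(lra) ltac:(lra)) as [Hl _].
    unfold sin_approx, sin_term in Hl; simpl in Hl. simpl. lra. }
  set (s := sin t) in *.
  assert (Hs0 : 0 < s) by lra.
  assert (Ht2 : 0 < t ^ 2) by (apply pow_lt; lra).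
  assert (Hs2 : 0 < s ^ 2) by (apply pow_lt; lra).
  replace (/ s ^ 2 - / t ^ 2) with ((t - s) * (t + s) / (s ^ 2 * t ^ 2)) by (field; lra).
  split.
  - apply Rdiv_le_0_compat; [|now apply Rmult_lt_0_compat]. apply Rmult_le_pos; lra.
  - apply Rmult_le_reg_r with (s ^ 2 * t ^ 2); [now apply Rmult_lt_0_compat|].
    replace ((t - s) * (t + s) / (s ^ 2 * t ^ 2) * (s ^ 2 * t ^ 2)) with ((t - s) * (t + s))
      by (field; lra).
    apply Rle_trans with (t ^ 3 / 6 * (2 * t)).
    + apply Rmult_le_compat; lra.
    + replace (t ^ 3 / 6 * (2 * t)) with (12 * ((t / 6) ^ 2 * t ^ 2)) by field.
      apply Rmult_le_compat_l; [lra|]. apply Rmult_le_compat_r; [lra|].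
      apply pow_incr. lra.
Qed.

(** [inv_sin_sq_sub_bound] bounds the derivative; 132 = 11 * 12 with PI^2 <= 11. The range 3/4 q
    accommodates j + x for j <= q / 2, |x| < 2 and q >= 8. *)
Lemma ctn_sub_inv_lipschitz q y z : 0 < q -> 0 < y <= 3 / 4 * q -> 0 < z <= 3 / 4 * q ->
  Rabs ((ctn q y - / y) - (ctn q z - / z)) <= 132 * Rabs (y - z) / q ^ 2.
Proof.
  intros Hq Hy Hz. pose proof PI_lt_16_5 as Hp. pose proof PI_RGT_0 as Hp0.
  destruct (MVT_gen (fun t => ctn q t - / t) z y
     (fun t => (PI / q) ^ 2 * (/ (PI * t / q) ^ 2 - / sin (PI * t / q) ^ 2))) as (c & Hc & Hm).
  - intros t Ht. assert (Ht0 : 0 < t < q) by (revert Ht; unfold Rmin, Rmax; destruct (Rle_dec z y); lra).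
    pose proof (sin_arg_pos q t Ht0) as Hs. unfold ctn. auto_derive; [split; lra|].
    change (PI * t * / q) with (PI * t / q).
    pose proof (sin2_cos2 (PI * t / q)) as Hsc. unfold Rsqr in Hsc.
    set (S := sin (PI * t / q)) in *. set (Co := cos (PI * t / q)) in *.
    transitivity (/ t ^ 2 - (PI / q) ^ 2 * (S * S + Co * Co) / S ^ 2); [field; lra|].
    rewrite Hsc. field. lra.
  - intros t Ht. assert (Ht0 : 0 < t < q) by (revert Ht; unfold Rmin, Rmax; destruct (Rle_dec z y); lra).
    pose proof (sin_arg_pos q t Ht0) as Hs.
    apply continuity_pt_filterlim, (ex_derive_continuous (fun t => ctn q t - / t)).
    unfold ctn. auto_derive. change (PI * t * / q) with (PI * t / q). split; lra.
  - rewrite Hm, Rabs_mult.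
    assert (Hc0 : 0 < c <= 3 / 4 * q) by (revert Hc; unfold Rmin, Rmax; destruct (Rle_dec z y); lra).
    assert (Ht : 0 < PI * c / q <= 3 * PI / 4).
    { split; [apply Rdiv_lt_0_compat; nra|].
      apply Rmult_le_reg_r with q; [easy|]. replace (PI * c / q * q) with (PI * c) by (field; lra). nra. }
    pose proof (inv_sin_sq_sub_bound _ Ht) as Hb.
    rewrite Rabs_mult, (Rabs_pos_eq ((PI / q) ^ 2)) by apply pow2_ge_0.
    assert (Hpq : (PI / q) ^ 2 * Rabs (/ (PI * c / q) ^ 2 - / sin (PI * c / q) ^ 2) <= 132 / q ^ 2).
    { replace (132 / q ^ 2) with (11 / q ^ 2 * 12) by (field; lra).
      apply Rmult_le_compat; [apply pow2_ge_0|apply Rabs_pos| |apply Rabs_le_between; lra].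
      replace ((PI / q) ^ 2) with (PI ^ 2 * / q ^ 2) by (field; lra).
      apply Rmult_le_compat_r; [left; apply Rinv_0_lt_compat; nra|]. nra. }
    replace (132 * Rabs (y - z) / q ^ 2) with (132 / q ^ 2 * Rabs (y - z)) by (field; lra).
    apply Rmult_le_compat_r; [apply Rabs_pos|easy].
Qed.

Lemma ctn_opp q y : 0 < q -> ctn q (q - y) = - ctn q y.
Proof.
  intros Hq. unfold ctn. replace (PI * (q - y) / q) with (PI - PI * y / q) by (field; lra).
  rewrite sin_PI_x. replace (cos (PI - PI * y / q)) with (- cos (PI * y / q)).
  - unfold Rdiv. ring.
  - rewrite cos_minus, cos_PI, sin_PI. ring.
Qed.

Lemma ctn_half q : 0 < q -> ctn q (q / 2) = 0.
Proof.
  intros Hq. unfold ctn. replace (PI * (q / 2) / q) with (PI / 2) by (field; lra).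
  rewrite cos_PI2. unfold Rdiv. ring.
Qed.

(** This is t cot t at t = PI j / q, the factor by which [ctn] differs from 1 / j. It tends to 1 for
    fixed j and decreases to 0 at q / 2, as summation by parts requires. *)
Definition cot_weight (q : nat) (j : nat) : R := INR j * ctn (INR q) (INR j).

Lemma harm_le n : (1 <= n)%nat -> harm n <= 1 + ln (INR n).
Proof.
  induction n as [|n IH]; [lia|]. intros _. rewrite harm_S.
  destruct n as [|n].
  - unfold harm; simpl. rewrite ln_1. lra.
  - specialize (IH ltac:(lia)). rewrite (S_INR (S n)).
    pose proof (lt_0_INR (S n) ltac:(lia)).
    pose proof (ln_add_bounds (INR (S n)) 1 ltac:(lra) ltac:(lra)) as Hb.
    unfold Rdiv in Hb. lra.
Qed.

(** Up to index A the sum is harm A / A, which produces the logarithm; beyond it the terms telescope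
    to at most 1 / A. *)
Lemma psum_min_inv_le A n : (1 <= A)%nat ->
  psum (fun i => Rmin (1 / INR A) (1 / INR (S i)) * / INR (S i)) n
  <= (2 + ln (INR A)) / INR A.
Proof.
  intros HA. assert (HA0 : 1 <= INR A) by (apply (le_INR 1); lia).
  set (f := fun i => Rmin (1 / INR A) (1 / INR (S i)) * / INR (S i)).
  assert (Hf : forall i, 0 < / INR (S i)) by (intros; apply Rinv_0_lt_compat, lt_0_INR; lia).
  assert (HiA : 0 < / INR A) by (apply Rinv_0_lt_compat; lra).
  assert (H1 : forall n, (n <= A)%nat -> psum f n <= (1 + ln (INR A)) / INR A).
  { intros m Hm. apply Rle_trans with (psum f A).
    - replace (psum f A) with (psum f (m + (A - m))) by (f_equal; lia). rewrite psum_app.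
      pose proof (psum_nonneg (fun i => f (m + i)%nat) (A - m)) as Hp.
      assert (0 <= psum (fun i => f (m + i)%nat) (A - m)); [|lra].
      apply Hp. intros i _. unfold f. apply Rmult_le_pos; [|left; apply Hf].
      apply Rmin_glb; apply Rdiv_le_0_compat; try lra. apply lt_0_INR; lia.
    - apply Rle_trans with (psum (fun i => / INR A * / INR (S i)) A).
      + apply psum_le. intros i _. unfold f. apply Rmult_le_compat_r; [left; apply Hf|].
        unfold Rdiv at 1. rewrite Rmult_1_l. apply Rmin_l.
      + rewrite psum_scal. fold (harm A). pose proof (harm_le A HA).
        unfold Rdiv. rewrite Rmult_comm. apply Rmult_le_compat_r; lra. }
  destruct (Nat.le_ge_cases n A) as [Hn|Hn].
  - specialize (H1 n Hn). unfold Rdiv in *. lra.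
  - replace (psum f n) with (psum f (A + (n - A))) by (f_equal; lia). rewrite psum_app.
    specialize (H1 A ltac:(lia)).
    assert (H2 : psum (fun i => f (A + i)%nat) (n - A) <= 1 / INR A); [|unfold Rdiv in *; lra].
    pose (v := fun i => - / INR (A + i)).
    assert (Ht : psum (fun i => v (S i) - v i) (n - A) <= / INR A).
    { rewrite psum_telescope. unfold v. rewrite Nat.add_0_r.
      assert (0 < / INR (A + (n - A))) by (apply Rinv_0_lt_compat, lt_0_INR; lia). lra. }
    unfold Rdiv. rewrite Rmult_1_l. eapply Rle_trans; [|exact Ht].
    apply psum_le. intros i _. unfold f, v.
    replace (A + S i)%nat with (S (A + i)) by lia. rewrite S_INR.
    pose proof (le_INR A (A + i) ltac:(lia)). set (y := INR (A + i)) in *.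
    replace (- / (y + 1) - - / y) with (/ y * / (y + 1)) by (field; lra).
    apply Rmult_le_compat_r; [left; apply Rinv_0_lt_compat; lra|].
    eapply Rle_trans; [apply Rmin_r|]. unfold Rdiv. rewrite Rmult_1_l.
    apply Rinv_le_contravar; lra.
Qed.

Lemma frac_mul_le q' q A j : (0 < q)%nat -> (1 <= A)%nat -> (A * q' <= q)%nat ->
  frac_mul q' q j <= INR j / INR A.
Proof.
  intros Hq HA Hle. rewrite frac_mul_floor by easy.
  pose proof (pos_INR (j * q' / q)). pose proof (pos_INR j).
  assert (HA0 : 1 <= INR A) by (apply (le_INR 1); lia).
  assert (Hq0 : 0 < INR q) by (apply lt_0_INR; lia).
  apply le_INR in Hle. rewrite mult_INR in Hle.
  assert (INR q' / INR q <= / INR A).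
  { apply Rmult_le_reg_r with (INR q * INR A); [nra|].
    replace (INR q' / INR q * (INR q * INR A)) with (INR A * INR q') by (field; lra).
    replace (/ INR A * (INR q * INR A)) with (INR q) by (field; lra). easy. }
  apply Rle_trans with (INR j * (INR q' / INR q)); [lra|]. unfold Rdiv at 2.
  apply Rmult_le_compat_l; easy.
Qed.

(** As {j beta} <= min (1, j / A), the sum reduces to [psum_min_inv_le]; only the term i = 0 needs
    the factor 1 / s. *)
Lemma frac_weighted_sum_le q' q A s n :
  (0 < q)%nat -> (1 <= A)%nat -> (A * q' <= q)%nat -> 0 < s <= 2 ->
  psum (fun i => frac_mul q' q (i + 2) * / (INR (i + 2) * (INR i + s))) n
  <= 16 * (1 + ln (INR A)) / (s * INR A).
Proof.
  intros Hq HA Hle Hs. assert (HA0 : 1 <= INR A) by (apply (le_INR 1); lia).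
  assert (HiA : 0 < / INR A) by (apply Rinv_0_lt_compat; lra).
  assert (His : / 2 <= / s) by (apply Rinv_le_contravar; lra).
  assert (Hln : 0 <= ln (INR A)) by (rewrite <- ln_1; apply ln_le; lra).
  replace (16 * (1 + ln (INR A)) / (s * INR A)) with (16 * (1 + ln (INR A)) * / s * / INR A)
    by (field; lra).
  assert (Hfin : / s * / INR A + 3 * ((2 + ln (INR A)) / INR A)
     <= 16 * (1 + ln (INR A)) * / s * / INR A).
  { unfold Rdiv. rewrite <- Rmult_assoc, <- Rmult_plus_distr_r. apply Rmult_le_compat_r; [lra|].
    set (L := ln (INR A)) in *. set (u := / s) in *. assert (0 <= L * (u - / 2)) by (apply Rmult_le_pos; lra). lra. }
  destruct n as [|n].
  { simpl psum. apply Rmult_le_pos; [|lra]. apply Rmult_le_pos; lra. }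
  eapply Rle_trans; [|exact Hfin]. rewrite psum_S_l. apply Rplus_le_compat.
  - pose proof (frac_mul_le q' q A (0 + 2) Hq HA Hle) as Hf. simpl (0 + 2)%nat in *.
    simpl (INR 2) in *. simpl (INR 0). rewrite Rplus_0_l.
    apply Rle_trans with (2 / INR A * / (2 * s)).
    + apply Rmult_le_compat_r; [|exact Hf]. left; apply Rinv_0_lt_compat; lra.
    + right. field. lra.
  - eapply Rle_trans; [|apply Rmult_le_compat_l; [lra|apply (psum_min_inv_le A n HA)]].
    rewrite <- psum_scal. apply psum_le. intros i _.
    pose proof (frac_mul_le q' q A (S i + 2) Hq HA Hle) as Hf1.
    pose proof (frac_mul_bounds q' q (S i + 2) Hq) as Hf2.
    assert (Hi : 1 <= INR (S i)) by (apply (le_INR 1); lia).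
    rewrite plus_INR in *. simpl (INR 2) in *. set (y := INR (S i)) in *.
    set (f := frac_mul q' q (S i + 2)) in *.
    assert (Hm : f * / (y + (1 + 1)) <= Rmin (1 / INR A) (1 / y)).
    { apply Rmin_glb.
      - apply Rle_trans with ((y + (1 + 1)) / INR A * / (y + (1 + 1))).
        + apply Rmult_le_compat_r; [left; apply Rinv_0_lt_compat; lra|easy].
        + right. field. lra.
      - unfold Rdiv. apply Rmult_le_compat; try lra.
        + left; apply Rinv_0_lt_compat; lra.
        + apply Rinv_le_contravar; lra. }
    rewrite Rinv_mult, <- Rmult_assoc.
    apply Rle_trans with (Rmin (1 / INR A) (1 / y) * / y).
    + apply Rmult_le_compat; [|left; apply Rinv_0_lt_compat; lra|exact Hm|apply Rinv_le_contravar; lra].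
      apply Rmult_le_pos; [lra|left; apply Rinv_0_lt_compat; lra].
    + assert (0 <= Rmin (1 / INR A) (1 / y) * / y); [|lra].
      apply Rmult_le_pos; [|left; apply Rinv_0_lt_compat; lra].
      apply Rmin_glb; apply Rdiv_le_0_compat; lra.
Qed.

(** t cot t is at least cos t because sin t <= t, and at most 1 because sin t - t cos t increases
    from 0. The 6 comes from cos t >= 1 - t^2 / 2 and PI^2 <= 12. *)
Lemma cot_weight_near_1 q j : (0 < q)%nat -> (1 <= j)%nat -> (2 * j <= q)%nat ->
  1 - 6 * INR j ^ 2 / INR q ^ 2 <= cot_weight q j <= 1.
Proof.
  intros Hq Hj Hjq. unfold cot_weight, ctn. pose proof PI_lt_16_5 as Hp. pose proof PI_RGT_0 as Hp0.
  assert (Hj1 : 1 <= INR j) by (apply (le_INR 1); lia).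
  assert (Hq0 : 0 < INR q) by (apply lt_0_INR; lia).
  apply le_INR in Hjq. rewrite mult_INR in Hjq. simpl (INR 2) in Hjq.
  set (t := PI * INR j / INR q).
  assert (Ht : 0 < t <= PI / 2).
  { unfold t. split; [apply Rdiv_lt_0_compat; nra|].
    apply Rmult_le_reg_r with (INR q); [easy|]. field_simplify; nra. }
  replace (INR j * (PI / INR q * (cos t / sin t))) with (t * (cos t / sin t))
    by (unfold t, Rdiv; ring).
  assert (Hs : 0 < sin t) by (apply sin_gt_0; lra).
  assert (Hst : sin t <= t) by (apply sin_le_self; lra).
  assert (Hc0 : 0 <= cos t) by (apply cos_ge_0; lra).
  split.
  - apply Rle_trans with (cos t).
    + pose proof (pre_cos_bound t 0 ltac:(lra) ltac:(lra)) as [Hl _].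
      unfold cos_approx, cos_term in Hl; simpl in Hl.
      assert (Ht2 : t * t <= 12 * (INR j ^ 2 / INR q ^ 2)).
      { unfold t. replace (PI * INR j / INR q * (PI * INR j / INR q))
          with ((PI * PI) * (INR j ^ 2 / INR q ^ 2)) by (field; lra).
        apply Rmult_le_compat_r; [apply Rdiv_le_0_compat; nra|nra]. }
      unfold Rdiv in *. lra.
    + apply Rmult_le_reg_r with (sin t); [easy|].
      replace (t * (cos t / sin t) * sin t) with (cos t * t) by (field; lra).
      now apply Rmult_le_compat_l.
  - cut (0 <= sin t - t * cos t).
    { intros H. apply Rmult_le_reg_r with (sin t); [easy|].
      replace (t * (cos t / sin t) * sin t) with (t * cos t) by (field; lra). lra. }
    apply (nonneg_of_derive (fun t => sin t - t * cos t) (fun t => t * sin t)); [lra| | |].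
    + rewrite sin_0, cos_0. lra.
    + intros x _. auto_derive; [easy|ring].
    + intros x Hx. apply Rmult_le_pos; [lra|]. apply sin_ge_0; lra.
Qed.

Lemma cot_weight_decr q j : (1 <= j)%nat -> (2 * S j <= q)%nat ->
  cot_weight q (S j) <= cot_weight q j.
Proof.
  intros Hj Hjq. unfold cot_weight. pose proof PI_RGT_0 as Hp0.
  assert (Hj1 : 1 <= INR j) by (apply (le_INR 1); lia).
  apply le_INR in Hjq. rewrite mult_INR in Hjq. simpl (INR 2) in Hjq. rewrite S_INR in *.
  set (Q := INR q) in *. set (y := INR j) in *.
  cut (0 <= y * ctn Q y - (y + 1) * ctn Q (y + 1)); [lra|].
  (* Used at u = 1; the derivative of - t cot t has the sign of t - sin t cos t. *)
  apply (nonneg_of_derive (fun u => y * ctn Q y - (y + u) * ctn Q (y + u))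
    (fun u => PI / Q * ((PI * (y + u) / Q - sin (PI * (y + u) / Q) * cos (PI * (y + u) / Q))
         / sin (PI * (y + u) / Q) ^ 2))); [lra| | |].
  - rewrite Rplus_0_r. lra.
  - intros u Hu. pose proof (sin_arg_pos Q (y + u) ltac:(lra)) as Hs. unfold ctn.
    auto_derive; [change (PI * (y + u) * / Q) with (PI * (y + u) / Q); lra|].
    change (PI * (y + u) * / Q) with (PI * (y + u) / Q).
    pose proof (sin2_cos2 (PI * (y + u) / Q)) as Hsc. unfold Rsqr in Hsc.
    set (S := sin (PI * (y + u) / Q)) in *. set (Co := cos (PI * (y + u) / Q)) in *.
    transitivity (PI / Q * ((PI * (y + u) / Q) * (S * S + Co * Co) - S * Co) / S ^ 2);
      [field; lra|]. rewrite Hsc. field. lra.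
  - intros u Hu. pose proof (sin_arg_pos Q (y + u) ltac:(lra)) as Hs.
    assert (Ht : 0 <= PI * (y + u) / Q) by (apply Rdiv_le_0_compat; nra).
    pose proof (sin_le_self _ Ht). pose proof (COS_bound (PI * (y + u) / Q)).
    apply Rmult_le_pos; [apply Rdiv_le_0_compat; lra|].
    apply Rdiv_le_0_compat; [nra|apply pow_lt; lra].
Qed.

Lemma cot_weight_nonneg q j : (1 <= j)%nat -> (2 * j <= q)%nat -> 0 <= cot_weight q j.
Proof.
  intros Hj Hjq. unfold cot_weight, ctn. pose proof PI_RGT_0 as Hp0.
  assert (Hj1 : 1 <= INR j) by (apply (le_INR 1); lia).
  apply le_INR in Hjq. rewrite mult_INR in Hjq. simpl (INR 2) in Hjq.
  apply Rmult_le_pos; [lra|]. apply Rmult_le_pos; [apply Rdiv_le_0_compat; lra|].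
  apply Rdiv_le_0_compat; [|apply sin_arg_pos; lra].
  apply cos_ge_0.
  - assert (0 <= PI * INR j / INR q) by (apply Rdiv_le_0_compat; nra). lra.
  - apply Rmult_le_reg_r with (INR q); [lra|]. field_simplify; nra.
Qed.

(** Pairing j with q - j isolates the sawtooth weights at x = 0, a difference of reciprocals
    carrying x, and a remainder weighted by {j beta}. The last is small because {j beta} <= j / A
    for the small j that matter; this is the origin of the error (1 + ln A) / A. *)
Lemma first_order_approx q' q A x :
  (0 < q')%nat -> Nat.gcd q' q = 1%nat -> (1 <= A)%nat -> (A * q' <= q)%nat -> (8 <= q)%nat ->
  Rabs x < 2 ->
  let h := ((q - 1) / 2)%nat in
  Rabs (first_order q' q x
        - (psum (fun i => / (INR (i + 2) + x)) (h - 1) - harm h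
           + psum (fun i => saw q' q (S i) * cot_weight q (S i)) h))
  <= 1040 * (1 + ln (INR A)) / ((2 - Rabs x) * INR A) + 600 / INR q.
Proof.
  intros Hq' Hg HA HAq Hq Hx h.
  pose proof (Nat.div_mod (q - 1) 2 ltac:(lia)) as D. fold h in D.
  pose proof (Nat.mod_upper_bound (q - 1) 2 ltac:(lia)) as B.
  set (m := ((q - 1) mod 2)%nat) in *.
  assert (Hq8 : 8 <= INR q) by (replace 8 with (INR 8) by (simpl; ring); apply le_INR; lia).
  pose proof (Rabs_pos x) as Hx0.
  pose proof (Rabs_between x) as Hx1.
  set (s := 2 - Rabs x). assert (Hs : 0 < s <= 2) by (unfold s; lra).
  set (Q := INR q) in *.
  assert (HA0 : 1 <= INR A) by (apply (le_INR 1); lia).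
  assert (Hln : 0 <= ln (INR A)) by (rewrite <- ln_1; apply ln_le; lra).
  assert (HiQ : 0 < / Q) by (apply Rinv_0_lt_compat; lra).
  assert (Hh1 : (1 <= h)%nat) by lia.
  unfold first_order. fold Q.
  replace (q - 3)%nat with ((h - 1) + m + (h - 1))%nat at 1 by lia.
  rewrite psum_fold.
  (* The central index j = q / 2, present only for even q. [ctn] vanishes at q / 2, so the shift by
     x costs O(1 / q). *)
  set (mid := psum _ m).
  assert (Hmid : Rabs mid <= 256 / Q).
  { assert (Hm : m = 0%nat \/ m = 1%nat) by lia. unfold mid. destruct Hm as [-> | Hm].
    - simpl. rewrite Rabs_R0. apply Rdiv_le_0_compat; lra.
    - rewrite Hm. simpl psum. rewrite Rplus_0_l.
      assert (Hj : INR (h - 1 + 0 + 2) = Q / 2).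
      { assert (HQ : Q = INR (2 * (h - 1 + 0 + 2))) by (unfold Q; f_equal; lia).
        rewrite HQ, mult_INR. simpl (INR 2). field. }
      rewrite Hj.
      pose proof (frac_mul_bounds q' q (h - 1 + 0 + 2) ltac:(lia)) as Hf.
      set (f := frac_mul q' q (h - 1 + 0 + 2)) in *.
      pose proof (ctn_lipschitz Q (Q / 2 + x) (Q / 2) (Q / 4) (Q / 2)
        ltac:(lra) ltac:(lra) ltac:(lra) ltac:(lra)) as Hl.
      rewrite ctn_half, Rminus_0_r in Hl by lra.
      rewrite Rabs_mult, (Rabs_pos_eq (1 - f)) by lra.
      apply Rle_trans with (1 * (16 * Rabs (Q / 2 - (Q / 2 + x)) / (Q / 4 * (Q / 2)))).
      + apply Rmult_le_compat; try lra. apply Rabs_pos.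
      + replace (Q / 2 - (Q / 2 + x)) with (- x) by ring. rewrite Rabs_Ropp.
        replace (1 * (16 * Rabs x / (Q / 4 * (Q / 2)))) with ((128 * Rabs x / Q) * / Q) by (field; lra).
        unfold Rdiv at 2. apply Rmult_le_compat_r; [lra|].
        apply Rmult_le_reg_r with Q; [lra|]. replace (128 * Rabs x / Q * Q) with (128 * Rabs x) by (field; lra). nra. }
  assert (Hharm : harm h = 1 + psum (fun i => / INR (i + 2)) (h - 1)).
  { unfold harm. replace h with (S (h - 1)) at 1 by lia. rewrite psum_S_l. simpl (INR 1).
    rewrite Rinv_1. f_equal. apply psum_ext. intros i _. do 2 f_equal. lia. }
  assert (HZ : psum (fun i => saw q' q (S i) * cot_weight q (S i)) h
    = (1 - 2 * frac_mul q' q 1) * cot_weight q 1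
      + psum (fun i => (1 - 2 * frac_mul q' q (i + 2)) * ctn Q (INR (i + 2))) (h - 1)).
  { replace h with (S (h - 1)) at 1 by lia. rewrite psum_S_l. f_equal.
    - unfold saw. simpl (INR 1). field.
    - apply psum_ext. intros i _. replace (S (S i)) with (i + 2)%nat by lia.
      unfold saw, cot_weight. fold Q. pose proof (lt_0_INR (i + 2) ltac:(lia)). field. lra. }
  (* [first_order] starts at j = 2, while [harm h] and the sawtooth sum start at 1; their terms j =
     1 cancel up to this error. *)
  assert (H1 : Rabs ((1 - 2 * frac_mul q' q 1) * cot_weight q 1 - 1) <= 2 / INR A + 6 / Q).
  { pose proof (cot_weight_near_1 q 1 ltac:(lia) ltac:(lia) ltac:(lia)) as Hw. fold Q in Hw.
    pose proof (cot_weight_nonneg q 1 ltac:(lia) ltac:(lia)) as Hw0.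
    pose proof (frac_mul_le q' q A 1 ltac:(lia) HA HAq) as Hf1.
    pose proof (frac_mul_bounds q' q 1 ltac:(lia)) as Hf2. simpl (INR 1) in *.
    set (f := frac_mul q' q 1) in *. set (w := cot_weight q 1) in *.
    assert (Hqq : 6 * 1 ^ 2 / Q ^ 2 <= 6 / Q).
    { unfold Rdiv. replace (6 * 1 ^ 2) with 6 by ring. apply Rmult_le_compat_l; [lra|].
      apply Rinv_le_contravar; nra. }
    apply Rabs_le_between. unfold Rdiv in *. nra. }
  (* With f = {j beta} and c = [ctn], the pair contributes (1 - f) c(j + x) - f c(j - x), which
     equals (c(j + x) - c(j)) + (1 - 2f) c(j) - f (c(j + x) + c(j - x) - 2 c(j)). [A1] is the error
     of replacing c(y) by 1 / y in the first difference, [B1] sums the bracket with weight f. *)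
  set (A1 := psum (fun i => (ctn Q (INR (i + 2) + x) - ctn Q (INR (i + 2)))
                             - (/ (INR (i + 2) + x) - / INR (i + 2))) (h - 1)).
  set (B1 := psum (fun i => frac_mul q' q (i + 2)
     * (ctn Q (INR (i + 2) + x) + ctn Q (INR (i + 2) - x) - 2 * ctn Q (INR (i + 2)))) (h - 1)).
  assert (Hdec : psum (fun i =>
      (1 - frac_mul q' q (i + 2)) * ctn Q (INR (i + 2) + x)
      + (1 - frac_mul q' q (h - 1 + m + (h - 1) - 1 - i + 2))
        * ctn Q (INR (h - 1 + m + (h - 1) - 1 - i + 2) + x)) (h - 1)
    = A1 + psum (fun i => / (INR (i + 2) + x)) (h - 1) - psum (fun i => / INR (i + 2)) (h - 1) - B1
      + psum (fun i => (1 - 2 * frac_mul q' q (i + 2)) * ctn Q (INR (i + 2))) (h - 1)).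
  { unfold A1, B1. rewrite (psum_minus (fun i => ctn Q (INR (i + 2) + x) - ctn Q (INR (i + 2)))).
    rewrite (psum_minus (fun i => / (INR (i + 2) + x))).
    match goal with |- _ = ?a - (?b - ?c) + ?b - ?c - ?d + ?e =>
      replace (a - (b - c) + b - c - d + e) with (a - d + e) by ring end.
    rewrite <- psum_minus, <- psum_plus. apply psum_ext. intros i Hi.
    replace (h - 1 + m + (h - 1) - 1 - i + 2)%nat with (q - (i + 2))%nat by lia.
    rewrite frac_mul_sym by (easy || lia). rewrite minus_INR by lia. fold Q.
    replace (Q - INR (i + 2) + x) with (Q - (INR (i + 2) - x)) by ring.
    rewrite ctn_opp by lra. ring. }
  rewrite Hdec.
  assert (Hi2 : forall i, (i < h - 1)%nat -> 2 * INR (i + 2) <= Q /\ INR (i + 2) = INR i + 2).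
  { intros i Hi. split.
    - replace 2 with (INR 2) by (simpl; ring). rewrite <- mult_INR. apply le_INR. lia.
    - rewrite plus_INR. simpl (INR 2). ring. }
  assert (HA1 : Rabs A1 <= 264 / Q).
  { apply Rle_trans with (psum (fun _ => 264 / Q ^ 2) (h - 1)).
    - unfold A1. apply psum_abs_le. intros i Hi. destruct (Hi2 i Hi) as [Hi3 Hi4].
      rewrite Hi4 in *. pose proof (pos_INR i).
      pose proof (ctn_sub_inv_lipschitz Q (INR i + 2 + x) (INR i + 2)
         ltac:(lra) ltac:(lra) ltac:(lra)) as Hl.
      replace (ctn Q (INR i + 2 + x) - ctn Q (INR i + 2) - (/ (INR i + 2 + x) - / (INR i + 2)))
        with ((ctn Q (INR i + 2 + x) - / (INR i + 2 + x)) - (ctn Q (INR i + 2) - / (INR i + 2))) by ring.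
      eapply Rle_trans; [exact Hl|]. replace (INR i + 2 + x - (INR i + 2)) with x by ring.
      unfold Rdiv. apply Rmult_le_compat_r; [left; apply Rinv_0_lt_compat; nra|lra].
    - rewrite psum_const.
      assert (Hh : INR (h - 1) <= Q) by (apply le_INR; lia).
      replace (264 / Q) with (Q * (264 / Q ^ 2)) by (field; lra).
      apply Rmult_le_compat_r; [apply Rdiv_le_0_compat; nra|easy]. }
  assert (HB1 : Rabs B1 <= 1024 * (1 + ln (INR A)) / (s * INR A)).
  { apply Rle_trans with (psum (fun i => 64 * (frac_mul q' q (i + 2) * / (INR (i + 2) * (INR i + s)))) (h - 1)).
    - unfold B1. apply psum_abs_le. intros i Hi. destruct (Hi2 i Hi) as [Hi3 Hi4].
      pose proof (frac_mul_bounds q' q (i + 2) ltac:(lia)) as Hf.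
      rewrite Hi4 in *. pose proof (pos_INR i) as Hi0. set (y := INR i + 2) in *.
      rewrite Rabs_mult, (Rabs_pos_eq (frac_mul _ _ _)) by lra.
      rewrite <- Rmult_assoc, (Rmult_comm 64), Rmult_assoc. apply Rmult_le_compat_l; [lra|].
      assert (Hlip : forall u, Rabs u <= Rabs x ->
         Rabs (ctn Q (y + u) - ctn Q y) <= 32 * / (y * (INR i + s))).
      { intros u Hu. pose proof (Rabs_between u).
        pose proof (ctn_lipschitz Q (y + u) y (INR i + s) y ltac:(lra) ltac:(unfold y; lra)
          ltac:(unfold y, s in *; lra) ltac:(lra)) as Hl.
        eapply Rle_trans; [exact Hl|]. replace (y - (y + u)) with (- u) by ring. rewrite Rabs_Ropp.
        rewrite (Rmult_comm (INR i + s) y). unfold Rdiv. apply Rmult_le_compat_r; [|lra].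
        left. apply Rinv_0_lt_compat. apply Rmult_lt_0_compat; unfold y; lra. }
      pose proof (Hlip x ltac:(lra)) as L1. pose proof (Hlip (- x) ltac:(rewrite Rabs_Ropp; lra)) as L2.
      unfold Rminus at 2. apply Rabs_le_between in L1, L2. apply Rabs_le_between. lra.
    - rewrite psum_scal.
      pose proof (frac_weighted_sum_le q' q A s (h - 1) ltac:(lia) HA HAq Hs) as Hw.
      unfold Rdiv in *. lra. }
  rewrite Hharm, HZ.
  assert (HA2 : 2 / INR A <= 8 * (1 + ln (INR A)) / (s * INR A)).
  { replace (8 * (1 + ln (INR A)) / (s * INR A)) with (8 * (1 + ln (INR A)) * / s * / INR A) by (field; lra).
    unfold Rdiv. apply Rmult_le_compat_r; [left; apply Rinv_0_lt_compat; lra|].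
    assert (/ 2 <= / s) by (apply Rinv_le_contravar; lra). nra. }
  apply Rabs_le_between in Hmid, H1, HA1, HB1. apply Rabs_le_between.
  unfold Rdiv in *. lra.
Qed.

(** * Limits along the convergents *)

(** Partial sums are within [b] of [tau] always, and within the better [e] from J on. By
    monotonicity of w the poor bound is charged only w 0 - w J, which becomes negligible for the
    cotangent weights. *)
Lemma abel_bound (u w : nat -> R) (n J : nat) (tau e b : R) :
  (J <= n)%nat ->
  (forall i, (i < n)%nat -> w (S i) <= w i) -> 0 <= w n ->
  (forall i, (i <= n)%nat -> Rabs (psum u (S i) - tau) <= b) ->
  (forall i, (J <= i <= n)%nat -> Rabs (psum u (S i) - tau) <= e) ->
  Rabs (psum (fun i => u i * w i) (S n) - w O * tau) <= e * w J + b * (w O - w J).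
Proof.
  intros HJ Hdec Hn Hb He.
  assert (Heq : psum (fun i => u i * w i) (S n) - w O * tau
    = psum (fun i => (psum u (S i) - tau) * (w i - w (S i))) n + (psum u (S n) - tau) * w n).
  { change (psum (fun i => u i * w i) (S n)) with (psum (fun i => u i * w i) n + u n * w n).
    rewrite psum_abel.
    rewrite (psum_ext (fun i => (psum u (S i) - tau) * (w i - w (S i)))
      (fun i => psum u (S i) * (w i - w (S i)) + tau * (w (S i) - w i))) by (intros; ring).
    rewrite psum_plus, psum_scal, psum_telescope. rewrite (psum_S u n). ring. }
  rewrite Heq. replace n with (J + (n - J))%nat at 1 by lia. rewrite psum_app.
  assert (H1 : Rabs (psum (fun i => (psum u (S i) - tau) * (w i - w (S i))) J) <= b * (w O - w J)).
  { replace (w O - w J) with (psum (fun i => w i - w (S i)) J).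
    - rewrite <- psum_scal. apply psum_abs_le. intros i Hi.
      rewrite Rabs_mult, (Rabs_pos_eq (w i - w (S i))).
      + apply Rmult_le_compat_r; [|apply Hb; lia]. specialize (Hdec i ltac:(lia)). lra.
      + specialize (Hdec i ltac:(lia)). lra.
    - pose proof (psum_telescope (fun i => - w i) J) as Ht. cbv beta in Ht.
      erewrite psum_ext; [rewrite Ht; ring|intros; cbv beta; ring]. }
  assert (H2 : Rabs (psum (fun i => (psum u (S (J + i)) - tau) * (w (J + i)%nat - w (S (J + i)))) (n - J))
     <= e * (w J - w n)).
  { replace (w J - w n) with (psum (fun i => w (J + i)%nat - w (S (J + i))) (n - J)).
    - rewrite <- psum_scal. apply psum_abs_le. intros i Hi.
      rewrite Rabs_mult, (Rabs_pos_eq (w _ - w _)).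
      + apply Rmult_le_compat_r; [|apply He; lia]. specialize (Hdec (J + i)%nat ltac:(lia)). lra.
      + specialize (Hdec (J + i)%nat ltac:(lia)). lra.
    - pose proof (psum_telescope (fun i => - w (J + i)%nat) (n - J)) as Ht. cbv beta in Ht.
      replace (J + (n - J))%nat with n in Ht by lia. rewrite Nat.add_0_r in Ht.
      erewrite psum_ext; [rewrite Ht; ring|]. intros i _. cbv beta.
      replace (J + S i)%nat with (S (J + i)) by lia. ring. }
  assert (H3 : Rabs ((psum u (S n) - tau) * w n) <= e * w n).
  { rewrite Rabs_mult, (Rabs_pos_eq (w n)) by easy. apply Rmult_le_compat_r; [easy|].
    apply He. lia. }
  apply Rabs_le_between in H1, H2, H3. apply Rabs_le_between. lra.
Qed.

Lemma eventually_ge_of_lim (f : nat -> nat) (M : nat) :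
  is_lim_seq (fun m => INR (f m)) p_infty -> eventually (fun m => (M <= f m)%nat).
Proof.
  intros Hf. apply is_lim_seq_spec in Hf. destruct (Hf (INR M)) as [N HN].
  exists N. intros m Hm. specialize (HN m Hm). apply INR_lt in HN. lia.
Qed.

Lemma ratio_step_bounds a y z : 1 <= a -> 0 < y -> 0 <= z <= y ->
  0 < y / (a * y + z) <= / a /\ ln a <= - ln (y / (a * y + z)) <= ln a + / a.
Proof.
  intros Ha Hy Hz. assert (Hd : 0 < a * y + z) by nra.
  assert (Hinv : y / (a * y + z) = / (a + z / y)) by (field; lra).
  assert (Hzy : 0 <= z / y <= 1).
  { split; [apply Rdiv_le_0_compat|apply -> Rdiv_le_1]; lra. }
  rewrite Hinv, ln_Rinv, Ropp_involutive by lra.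
  split; [split; [apply Rinv_0_lt_compat|apply Rinv_le_contravar]; lra|].
  pose proof (ln_add_bounds a (z / y) ltac:(lra) ltac:(lra)) as Hb.
  split; [apply ln_le; lra|].
  assert (z / y / a <= 1 / a); [|unfold Rdiv in *; lra].
  apply Rmult_le_compat_r; [left; apply Rinv_0_lt_compat|]; lra.
Qed.

(** Long truncations obey reciprocity with error 70 beta + beta rho + 10 / floor (N beta), where
    beta <= 1 / A and the last term is made at most eps / 2. Short ones are only bounded, but all
    weights up to a fixed index tend to 1, so [abel_bound] makes them harmless. *)
Lemma weighted_saw_limit (q q' q'' : nat -> nat) (A : nat) (rho : R) :
  (1 <= A)%nat ->
  (forall m, 0 < q' m)%nat -> (forall m, Nat.gcd (q' m) (q m) = 1%nat) ->
  (forall m, q m = A * q' m + q'' m)%nat -> (forall m, q'' m <= q' m)%nat ->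
  is_lim_seq (fun m => INR (q m)) p_infty ->
  eventually (fun m => forall M, (M < q' m)%nat -> Rabs (sawsum (q'' m) (q' m) M) <= rho) ->
  forall eps, 0 < eps ->
  eventually (fun m =>
    Rabs (psum (fun i => saw (q' m) (q m) (S i) * cot_weight (q m) (S i)) ((q m - 1) / 2)
          - saw_main (INR (q' m) / INR (q m))) <= (70 + rho) / INR A + eps).
Proof.
  intros HA Hq' Hg Hq Hq'' Hlim Hrho eps Heps.
  assert (HA0 : 1 <= INR A) by (apply (le_INR 1); lia).
  (* J is so large that floor (N beta) >= 20 / eps for N >= J *)
  destruct (nfloor_ex (20 / eps)) as [J0 HJ0]; [left; apply Rdiv_lt_0_compat; lra|].
  set (M0 := S J0). assert (HM0 : 20 / eps < INR M0) by (unfold M0; rewrite S_INR; lra).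
  set (J := ((A + 1) * M0)%nat).
  assert (HlnA : 0 <= ln (INR A)) by (rewrite <- ln_1; apply ln_le; lra).
  (* Bounds the deviation of [sawsum] from [saw_main] at every truncation, the short ones
     included. *)
  set (b := ln (INR A) + 1 + saw_const + Rabs rho
            + (ln (INR A) + 1 + Rabs euler_gamma + Rabs (ln (2 * PI)))).
  assert (Hb0 : 0 <= b).
  { unfold b, saw_const. pose proof (Rabs_pos rho). pose proof (Rabs_pos euler_gamma).
    pose proof (Rabs_pos (ln (2 * PI))).
    lra. }
  (* The weights up to index J + 1 differ from 1 by at most 6 (J + 1)^2 / q^2; for q beyond this
     size, b times twice that is at most eps / 2. *)
  destruct (nfloor_ex (24 * b * (INR J + 1) ^ 2 / eps)) as [L HL].
  { apply Rdiv_le_0_compat; [|easy]. apply Rmult_le_pos; [lra|apply pow2_ge_0]. }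
  pose proof (eventually_ge_of_lim q (2 * J + 10 + S L) Hlim) as Hbig.
  generalize (filter_and _ _ Hrho Hbig). apply filter_imp. clear Hrho Hbig.
  intros m [Hr Hm].
  specialize (Hq' m). specialize (Hg m). specialize (Hq m). specialize (Hq'' m).
  set (Q := q m) in *. set (Q' := q' m) in *. set (Q'' := q'' m) in *.
  set (h := ((Q - 1) / 2)%nat).
  pose proof (Nat.div_mod (Q - 1) 2 ltac:(lia)) as D. fold h in D.
  pose proof (Nat.mod_upper_bound (Q - 1) 2 ltac:(lia)) as B.
  assert (HQ' : (Q' <= Q)%nat) by nia.
  assert (HQA : (Q <= (A + 1) * Q')%nat) by nia.
  assert (Hq0 : 0 < INR Q) by (apply lt_0_INR; lia).
  assert (Hq'0 : 0 < INR Q') by (apply lt_0_INR; lia).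
  set (bt := INR Q' / INR Q) in *.
  destruct (ratio_step_bounds (INR A) (INR Q') (INR Q'') HA0 Hq'0) as [HbtA HlnB].
  { split; [apply pos_INR|now apply le_INR]. }
  rewrite <- mult_INR, <- plus_INR, <- Hq in HbtA, HlnB. fold bt in HbtA, HlnB.
  assert (HiA : 0 < / INR A <= 1) by now apply Rinv_unit.
  assert (Hrho0 : 0 <= rho) by (eapply Rle_trans; [apply Rabs_pos|apply (Hr O); lia]).
  assert (Hmain : forall N, (J <= N < Q)%nat ->
     Rabs (sawsum Q' Q N - saw_main bt) <= (70 + rho) / INR A + eps / 2).
  { intros N HN.
    assert (HMN : (M0 <= N * Q' / Q)%nat).
    { apply Nat.div_le_lower_bound; [lia|]. unfold J in HN. nia. }
    pose proof (sawsum_reciprocity Q' Q A Q'' N ltac:(lia) Hg Hq ltac:(lia) ltac:(unfold M0 in HMN; lia)) as Hs.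
    assert (HM' : (N * Q' / Q < Q')%nat) by (apply Nat.Div0.div_lt_upper_bound; nia).
    specialize (Hr _ HM'). fold bt in Hs.
    set (s := sawsum Q'' Q' (N * Q' / Q)) in *.
    apply le_INR in HMN. set (M := INR (N * Q' / Q)) in *.
    assert (HM20 : 10 / M <= eps / 2).
    { assert (HMp : 0 < M) by (pose proof (Rdiv_lt_0_compat 20 eps); lra).
      apply Rmult_le_reg_r with M; [easy|].
      replace (10 / M * M) with 10 by (field; lra).
      apply Rmult_le_reg_r with (2 / eps); [apply Rdiv_lt_0_compat; lra|].
      replace (eps / 2 * M * (2 / eps)) with M by (field; lra).
      replace (10 * (2 / eps)) with (20 / eps) by (field; lra). lra. }
    assert (Hbs : Rabs (bt * s) <= / INR A * rho).
    { rewrite Rabs_mult, (Rabs_pos_eq bt) by lra. apply Rmult_le_compat; try lra. apply Rabs_pos. }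
    apply Rabs_le_between in Hs, Hbs. apply Rabs_le_between. unfold Rdiv in *. lra. }
  assert (Hall : forall N, (N < Q)%nat -> Rabs (sawsum Q' Q N - saw_main bt) <= b).
  { intros N HN.
    pose proof (sawsum_bound_step Q' Q A Q'' rho N ltac:(lia) Hg Hq Hr HN) as Hs. fold bt in Hs.
    assert (Hbr : bt * rho <= rho) by nra.
    unfold b, saw_main. rewrite (Rabs_pos_eq rho) by easy.
    pose proof (Rabs_between euler_gamma).
    pose proof (Rabs_between (ln (2 * PI))).
    apply Rabs_le_between in Hs. apply Rabs_le_between. lra. }
  pose proof (abel_bound (fun i => saw Q' Q (S i)) (fun i => cot_weight Q (S i)) (h - 1) J
    (saw_main bt) ((70 + rho) / INR A + eps / 2) b ltac:(lia)) as HAb.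
  replace (S (h - 1)) with h in HAb by lia.
  assert (HQL : 24 * b * (INR J + 1) ^ 2 / eps <= INR Q).
  { apply Rle_trans with (INR (S L)); [rewrite S_INR; lra|]. apply le_INR. lia. }
  assert (HQ2 : INR Q <= INR Q ^ 2).
  { assert (1 <= INR Q) by (apply (le_INR 1); lia). nra. }
  assert (Hsmall : b * (12 * (INR J + 1) ^ 2 / INR Q ^ 2) <= eps / 2).
  { apply Rmult_le_reg_r with (INR Q ^ 2 * (2 / eps)).
    - apply Rmult_lt_0_compat; [nra|]. apply Rdiv_lt_0_compat; lra.
    - replace (b * (12 * (INR J + 1) ^ 2 / INR Q ^ 2) * (INR Q ^ 2 * (2 / eps)))
        with (24 * b * (INR J + 1) ^ 2 / eps) by (field; lra).
      replace (eps / 2 * (INR Q ^ 2 * (2 / eps))) with (INR Q ^ 2) by (field; lra). lra. }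
  assert (HJ1 : cot_weight Q 1 <= 1 /\ 1 - 6 * (INR J + 1) ^ 2 / INR Q ^ 2 <= cot_weight Q (S J)).
  { split.
    - apply cot_weight_near_1; lia.
    - pose proof (cot_weight_near_1 Q (S J) ltac:(lia) ltac:(lia) ltac:(lia)) as Hc.
      rewrite S_INR in Hc. lra. }
  pose proof (cot_weight_near_1 Q 1 ltac:(lia) ltac:(lia) ltac:(lia)) as Hc1.
  pose proof (cot_weight_nonneg Q 1 ltac:(lia) ltac:(lia)) as Hc0.
  simpl (INR 1) in Hc1.
  assert (Hwd : forall i, (i < h - 1)%nat -> cot_weight Q (S (S i)) <= cot_weight Q (S i)).
  { intros i Hi. apply cot_weight_decr; lia. }
  specialize (HAb Hwd ltac:(apply cot_weight_nonneg; lia)).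
  assert (HAb1 : forall i, (i <= h - 1)%nat ->
     Rabs (psum (fun i => saw Q' Q (S i)) (S i) - saw_main bt) <= b).
  { intros i Hi. apply (Hall (S i)). lia. }
  assert (HAb2 : forall i, (J <= i <= h - 1)%nat ->
     Rabs (psum (fun i => saw Q' Q (S i)) (S i) - saw_main bt) <= (70 + rho) / INR A + eps / 2).
  { intros i Hi. apply (Hmain (S i)). lia. }
  specialize (HAb HAb1 HAb2).
  pose proof (Hall O ltac:(lia)) as Ht. unfold sawsum in Ht; simpl psum in Ht.
  rewrite Rminus_0_l, Rabs_Ropp in Ht.
  pose proof (cot_weight_near_1 Q (S J) ltac:(lia) ltac:(lia) ltac:(lia)) as [_ HwJ].
  pose proof (cot_weight_nonneg Q (S J) ltac:(lia) ltac:(lia)) as HwJ0.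
  set (Z := psum (fun i => saw Q' Q (S i) * cot_weight Q (S i)) h) in *.
  set (w1 := cot_weight Q 1) in *. set (wJ := cot_weight Q (S J)) in *.
  set (tau := saw_main bt) in *. set (e0 := (70 + rho) / INR A) in *.
  set (g := (INR J + 1) ^ 2 / INR Q ^ 2).
  assert (Hg1 : / INR Q ^ 2 <= g).
  { unfold g, Rdiv. rewrite <- (Rmult_1_l (/ INR Q ^ 2)) at 1.
    apply Rmult_le_compat_r; [left; apply Rinv_0_lt_compat; nra|].
    pose proof (pos_INR J). nra. }
  replace (12 * (INR J + 1) ^ 2 / INR Q ^ 2) with (12 * g) in Hsmall by (unfold g; field; lra).
  replace (6 * (INR J + 1) ^ 2 / INR Q ^ 2) with (6 * g) in HJ1 by (unfold g; field; lra).
  replace (6 * 1 ^ 2 / INR Q ^ 2) with (6 * / INR Q ^ 2) in Hc1 by (field; lra).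
  assert (Hwt : Rabs ((w1 - 1) * tau) <= b * (6 * g)).
  { rewrite Rabs_mult, Rmult_comm. apply Rmult_le_compat; try apply Rabs_pos; [easy|].
    apply Rabs_le_between. lra. }
  assert (He0 : 0 <= e0 + eps / 2).
  { eapply Rle_trans; [apply Rabs_pos|apply (HAb2 (h - 1)%nat); lia]. }
  assert (HeJ : (e0 + eps / 2) * wJ <= e0 + eps / 2).
  { rewrite <- (Rmult_1_r (e0 + eps / 2)) at 2. apply Rmult_le_compat_l; easy. }
  assert (HbJ : b * (w1 - wJ) <= b * (6 * g)).
  { apply Rmult_le_compat_l; [easy|]. lra. }
  replace (Z - tau) with ((Z - w1 * tau) + (w1 - 1) * tau) by ring.
  apply Rabs_le_between in HAb, Hwt. apply Rabs_le_between. lra.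
Qed.

(** The digamma limit at 2 + x compared with [harm_asymp]: both logarithms agree in the limit, and
    the Euler constant left over cancels the one in [saw_main]. *)
Lemma harm_shift_limit x : -2 < x < 2 -> forall eps, 0 < eps ->
  eventually (fun n => Rabs (psum (fun i => / (INR (i + 2) + x)) n - harm (S n)
                             + digamma (2 + x) + euler_gamma) <= eps).
Proof.
  intros Hx eps Heps.
  pose proof (digamma_lim (2 + x) ltac:(lra)) as Hd.
  apply is_lim_seq_spec in Hd. assert (He2 : 0 < eps / 2) by lra.
  specialize (Hd (mkposreal _ He2)). simpl in Hd.
  destruct (nfloor_ex (46 / eps)) as [L HL]; [left; apply Rdiv_lt_0_compat; lra|].
  assert (Hbig : eventually (fun n => (L + 2 <= n)%nat)) by (exists (L + 2)%nat; auto).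
  generalize (filter_and _ _ Hd Hbig). apply filter_imp. clear Hd Hbig.
  intros n [Hd Hn].
  rewrite (psum_ext (fun i => / (INR (i + 2) + x)) (fun j => / (2 + x + INR j))).
  2:{ intros i _. rewrite plus_INR. simpl (INR 2). f_equal. ring. }
  pose proof (harm_asymp (S n) ltac:(lia)) as Hh.
  assert (HnR : INR L + 2 <= INR n) by (apply le_INR in Hn; rewrite plus_INR in Hn; simpl (INR 2) in Hn; lra).
  pose proof (pos_INR L) as HL0.
  pose proof (ln_add_quadratic (INR (S n)) (1 + x)) as Hl.
  rewrite S_INR in *. set (y := INR n + 1) in *.
  specialize (Hl ltac:(unfold y; lra) ltac:(unfold y; lra)).
  replace (y + (1 + x)) with (2 + x + INR n) in Hl by (unfold y; ring).
  assert (Hy : 46 / eps < y) by (unfold y; lra).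
  assert (Hiy : 0 < / y <= 1) by (apply Rinv_unit; unfold y; lra).
  assert (Hye : 23 * / y <= eps / 2).
  { apply Rmult_le_reg_r with (y * (2 / eps)).
    - apply Rmult_lt_0_compat; [unfold y; lra|apply Rdiv_lt_0_compat; lra].
    - replace (23 * / y * (y * (2 / eps))) with (46 / eps) by (field; split; [lra|unfold y; lra]).
      replace (eps / 2 * (y * (2 / eps))) with y by (field; lra). lra. }
  assert (Hy2 : / y ^ 2 <= / y).
  { apply Rinv_le_contravar; unfold y; nra. }
  assert (H1 : Rabs ((1 + x) / y) <= 3 * / y).
  { unfold Rdiv. rewrite Rabs_mult, (Rabs_pos_eq (/ y)) by lra.
    apply Rmult_le_compat_r; [lra|]. apply Rabs_le_between. lra. }
  assert (H2 : 2 * (1 + x) ^ 2 / y ^ 2 <= 18 * / y).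
  { pose proof (pow2_ge_0 (1 + x)).
    assert (0 <= (3 - (1 + x)) * (3 + (1 + x))) by (apply Rmult_le_pos; lra).
    assert (0 < / y ^ 2) by (apply Rinv_0_lt_compat, pow_lt; unfold y; lra).
    unfold Rdiv. apply Rmult_le_compat; lra. }
  replace (/ (2 * y)) with (/ 2 * / y) in Hh by (field; unfold y; lra).
  apply Rabs_def2 in Hd. apply Rabs_le_between in Hl, Hh, H1. apply Rabs_le_between. lra.
Qed.

(** Combines the finite-level formula with the two limits. Replacing - ln beta by ln A costs another
    1 / A, whence 71 instead of 70. *)
Lemma first_order_limit (q q' q'' : nat -> nat) (A : nat) (rho x : R) :
  (1 <= A)%nat ->
  (forall m, 0 < q' m)%nat -> (forall m, Nat.gcd (q' m) (q m) = 1%nat) ->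
  (forall m, q m = A * q' m + q'' m)%nat -> (forall m, q'' m <= q' m)%nat ->
  is_lim_seq (fun m => INR (q m)) p_infty ->
  eventually (fun m => forall M, (M < q' m)%nat -> Rabs (sawsum (q'' m) (q' m) M) <= rho) ->
  Rabs x < 2 ->
  forall eps, 0 < eps ->
  eventually (fun m =>
    Rabs (first_order (q' m) (q m) x - (ln (INR A / (2 * PI)) - digamma (2 + x)))
    <= (71 + rho) / INR A + 1040 * (1 + ln (INR A)) / ((2 - Rabs x) * INR A) + eps).
Proof.
  intros HA Hq' Hg Hq Hq'' Hlim Hrho Hx eps Heps.
  assert (HA0 : 1 <= INR A) by (apply (le_INR 1); lia).
  pose proof (weighted_saw_limit q q' q'' A rho HA Hq' Hg Hq Hq'' Hlim Hrho (eps / 4) ltac:(lra)) as HZ.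
  assert (Hx' : -2 < x < 2) by (apply Rabs_def2 in Hx; lra).
  destruct (harm_shift_limit x Hx' (eps / 4) ltac:(lra)) as [N1 HN1].
  destruct (nfloor_ex (1200 / eps)) as [L HL]; [left; apply Rdiv_lt_0_compat; lra|].
  pose proof (eventually_ge_of_lim q (2 * N1 + 10 + S L) Hlim) as Hbig.
  generalize (filter_and _ _ HZ Hbig). apply filter_imp. clear HZ Hbig.
  intros m [HZ Hm].
  specialize (Hq' m). specialize (Hg m). specialize (Hq m). specialize (Hq'' m).
  set (Q := q m) in *. set (Q' := q' m) in *. set (Q'' := q'' m) in *.
  pose proof (first_order_approx Q' Q A x Hq' Hg HA ltac:(lia) ltac:(lia) Hx) as Hf.
  cbv zeta in Hf. set (h := ((Q - 1) / 2)%nat) in *.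
  pose proof (Nat.div_mod (Q - 1) 2 ltac:(lia)) as D. fold h in D.
  pose proof (Nat.mod_upper_bound (Q - 1) 2 ltac:(lia)) as B.
  specialize (HN1 (h - 1)%nat ltac:(lia)). replace (S (h - 1)) with h in HN1 by lia.
  assert (HQ6 : 600 / INR Q <= eps / 2).
  { assert (HQL : 1200 / eps < INR Q).
    { apply Rlt_le_trans with (INR (S L)); [rewrite S_INR; lra|]. apply le_INR. lia. }
    assert (0 < INR Q) by (apply lt_0_INR; lia).
    apply Rmult_le_reg_r with (INR Q * (2 / eps)).
    - apply Rmult_lt_0_compat; [easy|apply Rdiv_lt_0_compat; lra].
    - replace (600 / INR Q * (INR Q * (2 / eps))) with (1200 / eps) by (field; lra).
      replace (eps / 2 * (INR Q * (2 / eps))) with (INR Q) by (field; lra). lra. }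
  assert (Hq0 : 0 < INR Q) by (apply lt_0_INR; lia).
  assert (Hq'0 : 0 < INR Q') by (apply lt_0_INR; lia).
  destruct (ratio_step_bounds (INR A) (INR Q') (INR Q'') HA0 Hq'0) as [_ Hbt].
  { split; [apply pos_INR|now apply le_INR]. }
  rewrite <- mult_INR, <- plus_INR, <- Hq in Hbt.
  pose proof PI_RGT_0. rewrite ln_div by lra.
  unfold saw_main in HZ.
  apply Rabs_le_between in HZ, Hf, HN1. apply Rabs_le_between. unfold Rdiv in *. lra.
Qed.

(** * Iterating reciprocity along the convergents *)

Definition saw_bound (alpha : R) (k : nat) (B : R) : Prop :=
  forall N, (N < qden alpha (S k))%nat ->
    Rabs (sawsum (qden alpha k) (qden alpha (S k)) N)
    <= ln (aR alpha (S k)) + 1 + saw_const + B.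

Lemma saw_const_pos : 0 < saw_const.
Proof.
  unfold saw_const. pose proof (Rabs_pos euler_gamma). pose proof (Rabs_pos (ln (2 * PI))). lra.
Qed.

Lemma q_ratio_bounds alpha k : irrational alpha ->
  0 < INR (qden alpha (S k)) / INR (qden alpha (S (S k))) <= / aR alpha (S (S k)) /\
  - ln (INR (qden alpha (S k)) / INR (qden alpha (S (S k)))) <= ln (aR alpha (S (S k))) + 1.
Proof.
  intros Ha. pose proof (le_INR _ _ (qden_pos alpha k Ha)) as H0.
  pose proof (le_INR _ _ (qden_pos alpha (S k) Ha)) as H1.
  pose proof (le_INR _ _ (qden_le_S alpha k Ha)) as H2. simpl (INR 1) in *.
  pose proof (aR_ge_1 alpha (S (S k)) Ha ltac:(lia)) as HA.
  rewrite qden_SS, plus_INR, mult_INR, INR_cf_digit by (easy || lia).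
  pose proof (ratio_step_bounds _ (INR (qden alpha (S k))) (INR (qden alpha k)) HA ltac:(lra) ltac:(lra)) as [Hb Hl].
  split; [exact Hb|].
  pose proof (Rinv_unit _ HA). lra.
Qed.

(** Only the excess [B] is recursive: the new logarithm ln a_(k+2) stays outside it, while the whole
    previous bound is multiplied by beta. *)
Lemma saw_bound_succ alpha k B : irrational alpha -> saw_bound alpha k B ->
  saw_bound alpha (S k)
    (INR (qden alpha (S k)) / INR (qden alpha (S (S k)))
      * (ln (aR alpha (S k)) + 1 + saw_const + B)).
Proof.
  intros Ha HB N HN.
  pose proof (qden_pos alpha (S k) Ha). pose proof (qden_le_S alpha (S k) Ha).
  pose proof (sawsum_bound_step (qden alpha (S k)) (qden alpha (S (S k)))
    (Z.to_nat (cf_digit alpha (S (S k)))) (qden alpha k) _ N ltac:(lia)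
    (qden_coprime alpha (S k)) (qden_SS alpha k) HB HN) as Hs.
  pose proof (q_ratio_bounds alpha k Ha). lra.
Qed.

Lemma saw_bound_exists alpha k : irrational alpha -> exists B, 0 <= B /\ saw_bound alpha k B.
Proof.
  intros Ha. pose proof saw_const_pos as HK.
  assert (Hln : forall n, 0 <= ln (aR alpha (S n))).
  { intros n. rewrite <- ln_1. apply ln_le; [lra|]. apply aR_ge_1; [easy|lia]. }
  induction k as [|k [B [HB0 HB]]].
  - exists (Rabs (ln (1 / INR (qden alpha 1)))). split; [apply Rabs_pos|]. intros N HN.
    pose proof (qden_pos alpha 1 Ha) as H1.
    (* As q_0 = 1, the level below consists of the empty sum alone, so the reciprocity step also
       starts the induction. *)
    assert (Hr0 : forall M, (M < 1)%nat -> Rabs (sawsum 0 1 M) <= 0).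
    { intros M HM. replace M with 0%nat by lia. unfold sawsum; simpl. rewrite Rabs_R0. lra. }
    pose proof (sawsum_bound_step 1 (qden alpha 1) (qden alpha 1) 0 0 N
      ltac:(lia) (qden_coprime alpha 0) ltac:(lia) Hr0 HN) as Hs.
    change (qden alpha 0) with 1%nat. specialize (Hln 0%nat).
    simpl (INR 1) in Hs. pose proof (Rle_abs (- ln (1 / INR (qden alpha 1)))) as Hl.
    rewrite Rabs_Ropp in Hl. lra.
  - eexists. split; [|exact (saw_bound_succ alpha k B Ha HB)].
    pose proof (q_ratio_bounds alpha k Ha). specialize (Hln k). apply Rmult_le_pos; lra.
Qed.

Lemma saw_bound_le alpha k B B' : B <= B' -> saw_bound alpha k B -> saw_bound alpha k B'.
Proof. intros Hle H N HN. specialize (H N HN). lra. Qed.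

(** The initial excess depends on alpha, so it must be forgotten: the recursion contracts it, and
    the bound beyond some k1 depends on T alone. *)
Lemma saw_bound_eventually alpha k0 T : irrational alpha -> 1 <= T ->
  (forall n, (k0 < n)%nat -> ln (aR alpha n) / aR alpha (n + 1) <= T) ->
  exists k1, forall k, (k1 <= k)%nat -> saw_bound alpha k (6 * (T + 1 + saw_const)).
Proof.
  intros Ha HT Hdig. pose proof saw_const_pos as HK.
  set (U := T + 1 + saw_const). assert (HU : 0 < U) by (unfold U; lra).
  set (bt := fun k => INR (qden alpha (S k)) / INR (qden alpha (S (S k)))).
  assert (Hbt : forall k, 0 < bt k <= 1).
  { intros k. pose proof (q_ratio_bounds alpha k Ha) as [Hb _].
    pose proof (aR_ge_1 alpha (S (S k)) Ha ltac:(lia)) as HA. unfold bt.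
    pose proof (Rinv_unit _ HA). lra. }
  assert (Hbt2 : forall k, bt (S k) * bt k <= 1 / 2).
  { intros k. unfold bt. pose proof (le_INR _ _ (qden_double alpha (S k) Ha)) as Hd.
    rewrite mult_INR in Hd. simpl (INR 2) in Hd.
    pose proof (lt_0_INR _ (qden_pos alpha (S k) Ha)).
    pose proof (lt_0_INR _ (qden_pos alpha (S (S k)) Ha)).
    pose proof (lt_0_INR _ (qden_pos alpha (S (S (S k))) Ha)).
    set (u := INR (qden alpha (S k))) in *. set (v := INR (qden alpha (S (S k)))) in *.
    set (w := INR (qden alpha (S (S (S k))))) in *.
    replace (v / w * (u / v)) with (u / w) by (field; lra).
    apply Rmult_le_reg_r with w; [easy|]. replace (u / w * w) with u by (field; lra). lra. }
  (* The inherited logarithm is absorbed by the digit hypothesis: beta ln a_(k+1) <= ln a_(k+1) /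
     a_(k+2) <= T. *)
  assert (Hstep : forall k B, (k0 <= k)%nat -> saw_bound alpha k B -> saw_bound alpha (S k) (U + bt k * B)).
  { intros k B Hk HB. eapply saw_bound_le; [|exact (saw_bound_succ alpha k B Ha HB)].
    fold (bt k). specialize (Hbt k).
    assert (Hl : bt k * ln (aR alpha (S k)) <= T).
    { specialize (Hdig (S k) ltac:(lia)). replace (S k + 1)%nat with (S (S k)) in Hdig by lia.
      pose proof (q_ratio_bounds alpha k Ha) as [Hb _]. fold (bt k) in Hb.
      assert (0 <= ln (aR alpha (S k))).
      { rewrite <- ln_1. apply ln_le; [lra|]. apply aR_ge_1; [easy|lia]. }
      eapply Rle_trans; [|exact Hdig]. unfold Rdiv. rewrite Rmult_comm.
      apply Rmult_le_compat_l; lra. }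
    unfold U. nra. }
  destruct (saw_bound_exists alpha k0 Ha) as [B0 [HB00 HB0]].
  (* Two steps send X to at most 2U + X / 2, whose fixed point is 4U; the initial excess decays
     geometrically. *)
  assert (Hind : forall i, saw_bound alpha (k0 + 2 * i) (4 * U + B0 * (1 / 2) ^ i)).
  { intros i. induction i as [|i IH].
    - rewrite Nat.mul_0_r, Nat.add_0_r. eapply saw_bound_le; [|exact HB0]. simpl. lra.
    - replace (k0 + 2 * S i)%nat with (S (S (k0 + 2 * i))) by lia.
      set (k := (k0 + 2 * i)%nat) in *.
      pose proof (Hstep (S k) _ ltac:(unfold k; lia) (Hstep k _ ltac:(unfold k; lia) IH)) as H2.
      eapply saw_bound_le; [|exact H2].
      set (X := 4 * U + B0 * (1 / 2) ^ i) in *.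
      assert (HX : 0 <= X).
      { unfold X. pose proof (pow_le (1 / 2) i ltac:(lra)). nra. }
      pose proof (Hbt k). pose proof (Hbt (S k)). specialize (Hbt2 k).
      assert (E1 : bt (S k) * U <= U) by nra.
      assert (E2 : bt (S k) * bt k * X <= 1 / 2 * X) by (apply Rmult_le_compat_r; lra).
      assert (E3 : U + bt (S k) * (U + bt k * X) = U + bt (S k) * U + bt (S k) * bt k * X) by ring.
      rewrite E3. simpl pow. unfold X in *. lra. }
  destruct (pow_lt_1_zero (1 / 2) ltac:(rewrite Rabs_pos_eq; lra) (U / (B0 + 1))
     ltac:(apply Rdiv_lt_0_compat; lra)) as [i0 Hi0].
  assert (Heven : forall i, (i0 <= i)%nat -> saw_bound alpha (k0 + 2 * i) (5 * U)).
  { intros i Hi. eapply saw_bound_le; [|apply Hind]. specialize (Hi0 i Hi).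
    rewrite Rabs_pos_eq in Hi0 by (apply pow_le; lra).
    assert (B0 * (1 / 2) ^ i <= U); [|lra].
    apply Rle_trans with ((B0 + 1) * (U / (B0 + 1))).
    - pose proof (pow_le (1 / 2) i ltac:(lra)). apply Rmult_le_compat; lra.
    - right. field. lra. }
  (* Even offsets reach 5U; an odd offset takes one more step, whence 6U. *)
  exists (k0 + 2 * i0 + 1)%nat. intros k Hk.
  pose proof (Nat.div_mod (k - k0) 2 ltac:(lia)) as D.
  pose proof (Nat.mod_upper_bound (k - k0) 2 ltac:(lia)) as Bm.
  set (i := ((k - k0) / 2)%nat) in *.
  destruct (Nat.eq_dec ((k - k0) mod 2) 0) as [E|E].
  - replace k with (k0 + 2 * i)%nat by lia. eapply saw_bound_le; [|apply Heven; lia]. lra.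
  - replace k with (S (k0 + 2 * i)) by lia.
    eapply saw_bound_le; [|apply Hstep; [lia|apply Heven; lia]].
    pose proof (Hbt (k0 + 2 * i)%nat). nra.
Qed.

(** * The prefactor *)

Definition bulk (q : nat) (x : R) : R :=
  pprod (fun i => Rabs (2 * sin (PI * (INR (i + 2) + x) / INR q))) (q - 3).

Lemma pprod_split_ends f q : (4 <= q)%nat ->
  pprod f q = f 0%nat * f 1%nat * f (q - 1)%nat * pprod (fun i => f (i + 2)%nat) (q - 3).
Proof.
  intros Hq. replace q with (2 + (q - 3) + 1)%nat at 1 by lia.
  rewrite pprod_app, pprod_app, pprod_1, pprod_2.
  replace (2 + (q - 3) + 0)%nat with (q - 1)%nat by lia.
  rewrite (pprod_ext (fun i => f (2 + i)%nat) (fun i => f (i + 2)%nat))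
    by (intros; f_equal; lia).
  ring.
Qed.

Lemma Rabs_sin_reflect q y : 0 < q ->
  Rabs (2 * sin (PI * (q - 1 + y) / q)) = Rabs (2 * sin (PI * (1 - y) / q)).
Proof.
  intros Hq. replace (PI * (q - 1 + y) / q) with (PI - PI * (1 - y) / q) by (field; lra).
  now rewrite sin_PI_x.
Qed.

(** {j beta} is 0, beta, 1 - beta at j = 0, 1, q - 1, which gives the three explicit sines. For the
    other j the condition on C keeps the shifted sine positive, so each absolute value is its value
    at C = 0 times the exponential of a logarithm. *)
Lemma sudler_factor (q' q : nat) (C x : R) :
  (4 <= q)%nat -> (0 < q' < q)%nat -> Nat.gcd q' q = 1%nat -> 0 <= C -> Rabs x < 2 ->
  (forall j, (2 <= j <= q - 2)%nat ->
     C * (1 - frac_mul q' q j) <= 2 / 3 * (INR q - (INR j + x))) ->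
  let D := C * (INR q' / INR q) in
  pprod (fun j => Rabs (2 * sin (PI * (INR j + x + C * (1 - frac_mul q' q j)) / INR q))) q
  = Rabs (2 * sin (PI * (x + C) / INR q)) * Rabs (2 * sin (PI * (1 + x + C - D) / INR q))
    * Rabs (2 * sin (PI * (1 - x - D) / INR q)) * bulk q x * exp (log_ratio q' q C x).
Proof.
  intros Hq Hq' Hg HC Hx Hcond D.
  assert (Hq0 : 0 < INR q) by (apply lt_0_INR; lia).
  rewrite pprod_split_ends by easy.
  assert (H0 : frac_mul q' q 0 = 0).
  { unfold frac_mul. rewrite Nat.mul_0_l, Nat.Div0.mod_0_l. simpl. field. lra. }
  assert (H1 : frac_mul q' q 1 = INR q' / INR q).
  { unfold frac_mul. rewrite Nat.mul_1_l, Nat.mod_small by lia. easy. }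
  rewrite frac_mul_sym by (easy || lia). rewrite H0, H1, minus_INR by lia.
  simpl (INR 0). simpl (INR 1).
  rewrite !Rmult_assoc. f_equal.
  { do 4 f_equal. ring. }
  f_equal.
  { do 4 f_equal. unfold D. ring. }
  f_equal.
  { replace (1 - x - D) with (1 - (x + D)) by ring.
    rewrite <- Rabs_sin_reflect by easy. do 4 f_equal. unfold D. ring. }
  unfold bulk, log_ratio. rewrite <- pprod_exp, <- pprod_mult.
  apply pprod_ext. intros i Hi.
  pose proof (frac_mul_bounds q' q (i + 2) ltac:(lia)) as Hf.
  specialize (Hcond (i + 2)%nat ltac:(lia)).
  assert (Hi2 : 2 <= INR (i + 2) <= INR q - 2).
  { rewrite plus_INR. simpl (INR 2). pose proof (pos_INR i). split; [lra|].
    assert (INR i + INR 4 <= INR q) by (rewrite <- plus_INR; apply le_INR; lia).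
    simpl (INR 4) in *. lra. }
  apply Rabs_def2 in Hx.
  set (f := frac_mul q' q (i + 2)) in *. set (y := INR (i + 2) + x) in *.
  assert (He : 0 <= C * (1 - f)) by (apply Rmult_le_pos; lra).
  pose proof (sin_arg_pos (INR q) y ltac:(unfold y; lra)) as S1.
  pose proof (sin_arg_pos (INR q) (y + C * (1 - f)) ltac:(unfold y in *; lra)) as S2.
  rewrite exp_ln by (now apply Rdiv_lt_0_compat).
  rewrite !Rabs_pos_eq by lra. field. lra.
Qed.

Lemma sin_scaled_limit (q : nat -> nat) (y : nat -> R) (l : R) :
  is_lim_seq (fun m => INR (q m)) p_infty -> is_lim_seq y l ->
  is_lim_seq (fun m => INR (q m) / (2 * PI) * Rabs (2 * sin (PI * y m / INR (q m)))) (Rabs l).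
Proof.
  intros Hq Hy. pose proof PI_RGT_0 as Hpi.
  assert (Hinv : is_lim_seq (fun m => / INR (q m)) 0) by (apply (is_lim_seq_inv _ p_infty Hq); easy).
  assert (Hsin : forall t, Rabs (sin t - t) <= t ^ 2).
  { assert (Hp : forall t, 0 <= t -> Rabs (sin t - t) <= t ^ 2).
    { intros t Ht. destruct (Rle_dec t 2) as [H1|H1].
      - pose proof (pre_sin_bound t 0 Ht ltac:(lra)) as [Hl _].
        unfold sin_approx, sin_term in Hl; simpl in Hl.
        pose proof (sin_le_self t Ht).
        assert (t * t * t <= t * t * 2) by (apply Rmult_le_compat_l; nra).
        apply Rabs_le_between. lra.
      - pose proof (SIN_bound t). pose proof (sin_le_self t Ht).
        apply Rabs_le_between. nra. }
    intros t. destruct (Rle_dec 0 t) as [Ht|Ht]; [auto|].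
    specialize (Hp (- t) ltac:(lra)). rewrite sin_neg in Hp.
    rewrite <- Rabs_Ropp. replace (- (sin t - t)) with (- sin t - - t) by ring.
    eapply Rle_trans; [exact Hp|]. right. ring. }
  assert (Hmain : is_lim_seq (fun m => INR (q m) / PI * sin (PI * y m / INR (q m)) - y m) 0).
  { apply is_lim_seq_abs_0.
    apply is_lim_seq_le_le_loc with (fun _ => 0) (fun m => PI * (y m * y m) * / INR (q m)).
    - destruct (eventually_ge_of_lim q 1 Hq) as [N HN]. exists N. intros m Hm.
      specialize (HN m Hm). assert (Hq0 : 0 < INR (q m)) by (apply lt_0_INR; lia).
      split; [apply Rabs_pos|].
      specialize (Hsin (PI * y m / INR (q m))).
      replace (INR (q m) / PI * sin (PI * y m / INR (q m)) - y m)
        with (INR (q m) / PI * (sin (PI * y m / INR (q m)) - PI * y m / INR (q m)))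
        by (field; lra).
      rewrite Rabs_mult, (Rabs_pos_eq (INR (q m) / PI)) by (left; now apply Rdiv_lt_0_compat).
      apply Rle_trans with (INR (q m) / PI * (PI * y m / INR (q m)) ^ 2).
      + apply Rmult_le_compat_l; [left; now apply Rdiv_lt_0_compat|easy].
      + right. field. lra.
    - apply is_lim_seq_const.
    - replace (Finite 0) with (Finite (PI * (l * l) * 0)) by (f_equal; ring).
      apply is_lim_seq_mult'; [|easy].
      apply is_lim_seq_mult'; [apply is_lim_seq_const|]. now apply is_lim_seq_mult'. }
  apply is_lim_seq_ext with
    (fun m => Rabs ((INR (q m) / PI * sin (PI * y m / INR (q m)) - y m) + y m)).
  - intros m. replace (_ - y m + y m) with (INR (q m) / PI * sin (PI * y m / INR (q m))) by ring.
    rewrite !Rabs_mult. rewrite (Rabs_pos_eq 2) by lra.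
    rewrite (Rabs_pos_eq (INR (q m) / PI)) by (apply Rdiv_le_0_compat; [apply pos_INR|lra]).
    field. lra.
  - apply (is_lim_seq_abs _ (Finite l)).
    replace (Finite l) with (Finite (0 + l)) by (f_equal; ring).
    now apply is_lim_seq_plus'.
Qed.

(* The continuous extension of |2 sin (pi x) / (x (x - 1) (x + 1))|. *)
Definition kappa (x : R) : R :=
  if Req_EM_T x 0 then 2 * PI
  else if Req_EM_T x 1 then PI
  else if Req_EM_T x (-1) then PI
  else Rabs (2 * sin (PI * x)) / (Rabs x * Rabs (1 + x) * Rabs (1 - x)).

Lemma bulk_generic q x : (4 <= q)%nat ->
  Rabs (2 * sin (PI * x)) = Rabs (2 * sin (PI * x / INR q))
     * Rabs (2 * sin (PI * (1 + x) / INR q)) * Rabs (2 * sin (PI * (1 - x) / INR q)) * bulk q x.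
Proof.
  intros Hq. assert (Hq0 : 0 < INR q) by (apply lt_0_INR; lia).
  rewrite <- (sin_prod_shift q x) by lia. rewrite pprod_split_ends by easy.
  rewrite (minus_INR q 1) by lia. simpl (INR 0). simpl (INR 1).
  rewrite <- (Rabs_sin_reflect (INR q) x) by easy. rewrite Rplus_0_l. reflexivity.
Qed.

Lemma bulk_0 q : (4 <= q)%nat ->
  INR q = Rabs (2 * sin (PI * 1 / INR q)) * Rabs (2 * sin (PI * 1 / INR q)) * bulk q 0.
Proof.
  intros Hq. assert (Hq0 : 0 < INR q) by (apply lt_0_INR; lia).
  rewrite <- (sin_prod q) at 1 by lia.
  replace (q - 1)%nat with (1 + (q - 3) + 1)%nat by lia.
  rewrite pprod_app, pprod_app, !pprod_1. unfold bulk.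
  replace (S (1 + (q - 3) + 0)) with (q - 1)%nat by lia.
  rewrite minus_INR by lia. simpl (INR 1).
  replace (INR q - 1) with (INR q - 1 + 0) by ring. rewrite Rabs_sin_reflect by easy.
  rewrite Rminus_0_r.
  rewrite (pprod_ext (fun i => Rabs (2 * sin (PI * INR (S (1 + i)) / INR q)))
     (fun i => Rabs (2 * sin (PI * (INR (i + 2) + 0) / INR q)))).
  - ring.
  - intros i _. rewrite Rplus_0_r. do 6 f_equal. lia.
Qed.

Lemma bulk_1 q : (4 <= q)%nat ->
  INR q = Rabs (2 * sin (PI * 1 / INR q)) * Rabs (2 * sin (PI * 2 / INR q)) * bulk q 1.
Proof.
  intros Hq. rewrite <- (sin_prod q) at 1 by lia.
  replace (q - 1)%nat with (2 + (q - 3))%nat by lia.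
  rewrite pprod_app, pprod_2. unfold bulk. simpl (INR 1). simpl (INR 2).
  replace (1 + 1) with 2 by ring. f_equal.
  apply pprod_ext. intros i _. do 5 f_equal.
  replace (S (2 + i)) with (i + 2 + 1)%nat by lia. rewrite (plus_INR (i + 2) 1). easy.
Qed.

Lemma bulk_m1 q : (4 <= q)%nat ->
  INR q = Rabs (2 * sin (PI * 1 / INR q)) * Rabs (2 * sin (PI * 2 / INR q)) * bulk q (-1).
Proof.
  intros Hq. assert (Hq0 : 0 < INR q) by (apply lt_0_INR; lia).
  rewrite <- (sin_prod q) at 1 by lia.
  replace (q - 1)%nat with ((q - 3) + 2)%nat by lia.
  rewrite pprod_app, pprod_2. unfold bulk.
  replace (S (q - 3 + 0)) with (q - 2)%nat by lia.
  replace (S (q - 3 + 1)) with (q - 1)%nat by lia.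
  rewrite !minus_INR by lia. simpl (INR 1). simpl (INR 2).
  replace (INR q - 1) with (INR q - 1 + 0) by ring.
  replace (INR q - (1 + 1)) with (INR q - 1 + (- 1)) by ring.
  rewrite !Rabs_sin_reflect by easy.
  rewrite Rminus_0_r. replace (1 - -1) with 2 by ring.
  rewrite (pprod_ext (fun i => Rabs (2 * sin (PI * INR (S i) / INR q)))
     (fun i => Rabs (2 * sin (PI * (INR (i + 2) + -1) / INR q)))).
  - ring.
  - intros i _. do 5 f_equal. rewrite plus_INR, S_INR. simpl (INR 2). ring.
Qed.

(** Generically [bulk] is the full sine product divided by the three outer factors, each of which is
    asymptotic to a multiple of 1 / q. *)
Lemma bulk_limit (q : nat -> nat) (x : R) :
  is_lim_seq (fun m => INR (q m)) p_infty -> Rabs x < 2 ->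
  is_lim_seq (fun m => (2 * PI / INR (q m)) ^ 3 * bulk (q m) x) (kappa x).
Proof.
  intros Hq Hx. pose proof PI_RGT_0 as Hpi.
  assert (Hev : eventually (fun m => (4 <= q m)%nat)) by (now apply eventually_ge_of_lim).
  assert (Hsin : forall y, is_lim_seq
     (fun m => INR (q m) / (2 * PI) * Rabs (2 * sin (PI * y / INR (q m)))) (Rabs y)).
  { intros y. apply (sin_scaled_limit q (fun _ => y)); [easy|apply is_lim_seq_const]. }
  assert (Hpos : forall m y, (4 <= q m)%nat -> 0 < y < 4 -> 0 < Rabs (2 * sin (PI * y / INR (q m)))).
  { intros m y Hm Hy. apply Rabs_pos_lt. apply le_INR in Hm. simpl (INR 4) in Hm.
    pose proof (sin_arg_pos (INR (q m)) y ltac:(lra)). lra. }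
  (* At x = 0, 1, -1 one outer factor vanishes and cannot be divided out; the product over nonzero
     residues, equal to q, is used instead. Here y is 1 for x = 0 and 2 for x = 1 or -1. *)
  assert (Hint : forall y l, 0 < y < 4 ->
     (forall m, (4 <= q m)%nat -> INR (q m) = Rabs (2 * sin (PI * 1 / INR (q m)))
         * Rabs (2 * sin (PI * y / INR (q m))) * bulk (q m) x) -> l = 2 * PI / y ->
     is_lim_seq (fun m => (2 * PI / INR (q m)) ^ 3 * bulk (q m) x) l).
  { intros y l Hy He Hl.
    apply is_lim_seq_ext_loc with (fun m => 2 * PI / ((INR (q m) / (2 * PI) * Rabs (2 * sin (PI * 1 / INR (q m))))
        * (INR (q m) / (2 * PI) * Rabs (2 * sin (PI * y / INR (q m)))))).
    - revert Hev. apply filter_imp. intros m Hm. specialize (He m Hm).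
      pose proof (Hpos m 1 Hm ltac:(lra)). pose proof (Hpos m y Hm Hy).
      assert (Hq0 : 0 < INR (q m)) by (apply lt_0_INR; lia).
      set (s1 := Rabs (2 * sin (PI * 1 / INR (q m)))) in *.
      set (s2 := Rabs (2 * sin (PI * y / INR (q m)))) in *.
      assert (Hb : bulk (q m) x = INR (q m) / (s1 * s2)).
      { apply Rmult_eq_reg_l with (s1 * s2); [|nra]. rewrite <- He. field. lra. }
      rewrite Hb. field. lra.
    - rewrite Hl. replace (2 * PI / y) with (2 * PI / (Rabs 1 * Rabs y))
        by (rewrite Rabs_R1, Rabs_pos_eq by lra; field; lra).
      apply is_lim_seq_div'; [apply is_lim_seq_const| |].
      + apply is_lim_seq_mult'; apply Hsin.
      + rewrite Rabs_R1, Rabs_pos_eq; lra. }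
  unfold kappa. apply Rabs_def2 in Hx.
  destruct (Req_EM_T x 0) as [E0|E0].
  { subst x. apply (Hint 1); [lra|intros; now apply bulk_0|field]. }
  destruct (Req_EM_T x 1) as [E1|E1].
  { subst x. apply (Hint 2); [lra|intros; now apply bulk_1|field]. }
  destruct (Req_EM_T x (-1)) as [E2|E2].
  { subst x. apply (Hint 2); [lra|intros; now apply bulk_m1|field]. }
  assert (Hne : forall m y, (4 <= q m)%nat -> y <> 0 -> -4 < y < 4 ->
     0 < Rabs (2 * sin (PI * y / INR (q m)))).
  { intros m y Hm Hy0 Hy. destruct (Rlt_dec 0 y); [apply Hpos; [easy|lra]|].
    replace (PI * y / INR (q m)) with (- (PI * - y / INR (q m)))
      by (field; apply not_0_INR; lia).
    rewrite sin_neg, Ropp_mult_distr_r_reverse, Rabs_Ropp. apply Hpos; [easy|lra]. }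
  apply is_lim_seq_ext_loc with (fun m => Rabs (2 * sin (PI * x)) /
      (INR (q m) / (2 * PI) * Rabs (2 * sin (PI * x / INR (q m)))
        * (INR (q m) / (2 * PI) * Rabs (2 * sin (PI * (1 + x) / INR (q m))))
        * (INR (q m) / (2 * PI) * Rabs (2 * sin (PI * (1 - x) / INR (q m)))))).
  - revert Hev. apply filter_imp. intros m Hm. rewrite (bulk_generic (q m) x Hm).
    pose proof (Hne m x Hm E0 ltac:(lra)).
    pose proof (Hne m (1 + x) Hm ltac:(lra) ltac:(lra)).
    pose proof (Hne m (1 - x) Hm ltac:(lra) ltac:(lra)).
    assert (Hq0 : 0 < INR (q m)) by (apply lt_0_INR; lia).
    field. lra.
  - apply is_lim_seq_div'; [apply is_lim_seq_const| |].
    + apply is_lim_seq_mult'; [apply is_lim_seq_mult'|]; apply Hsin.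
    + pose proof (Rabs_pos_lt x E0). pose proof (Rabs_pos_lt (1 + x) ltac:(lra)).
      pose proof (Rabs_pos_lt (1 - x) ltac:(lra)).
      apply Rgt_not_eq. repeat apply Rmult_lt_0_compat; easy.
Qed.

Lemma sin_difference_quotient_lim (n : R) :
  is_lim (fun y => Rabs (2 * sin (PI * (y - n)) / (y - n))) n (2 * PI).
Proof.
  pose proof PI_RGT_0 as Hpi.
  apply is_lim_ext_loc with (fun y => 2 * PI * Rabs (sin (PI * (y - n)) / (PI * (y - n)))).
  - exists (mkposreal 1 Rlt_0_1). intros y _ Hy.
    assert (Hy' : y - n <> 0) by lra.
    replace (2 * sin (PI * (y - n)) / (y - n)) with (2 * PI * (sin (PI * (y - n)) / (PI * (y - n))))
      by (field; lra).
    rewrite (Rabs_mult (2 * PI)), (Rabs_pos_eq (2 * PI)) by lra. reflexivity.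
  - replace (Finite (2 * PI)) with (Rbar_mult (2 * PI) (Rbar_abs 1))
      by (simpl; f_equal; rewrite Rabs_R1; ring).
    apply is_lim_scal_l, is_lim_Rabs.
    apply (is_lim_comp (fun t => sin t / t) (fun y => PI * (y - n)) n 1 0).
    + apply is_lim_sinc_0.
    + replace (Finite 0) with (Finite (PI * (n - n))) by (f_equal; ring).
      apply (is_lim_continuity (fun y => PI * (y - n)) n). apply derivable_continuous_pt, ex_derive_Reals_0.
      auto_derive. easy.
    + exists (mkposreal 1 Rlt_0_1). intros y _ Hy He. injection He as He.
      apply Rmult_integral in He. lra.
Qed.

Lemma Lim_sin_pole (f g : R -> R) (n : R) :
  continuity_pt g n ->
  (exists d : posreal, forall y, Rabs (y - n) < d -> y <> n ->
     f y = Rabs (2 * sin (PI * (y - n)) / (y - n)) * g y) ->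
  real (Lim f n) = 2 * PI * g n.
Proof.
  intros Hg [d Hd].
  assert (H : is_lim f n (2 * PI * g n)).
  { apply is_lim_ext_loc with (fun y => Rabs (2 * sin (PI * (y - n)) / (y - n)) * g y).
    - exists d. intros y Hy Hne. symmetry. now apply Hd.
    - apply (is_lim_mult _ _ _ (Finite (2 * PI)) (Finite (g n))); [|now apply is_lim_continuity|easy].
      apply sin_difference_quotient_lim. }
  apply is_lim_unique in H. now rewrite H.
Qed.

(** Moving the denominators x, x + 1, x - 1 into [kappa] leaves factors that are regular everywhere;
    this is the form in which the limit of the sines appears. *)
Lemma prefactor_eq C D x : Rabs x < 2 ->
  prefactor C D x = Rabs (x + C) * Rabs (1 + x + C - D) * Rabs (1 - x - D) * kappa x.
Proof.
  intros Hx. unfold prefactor, kappa. pose proof PI_RGT_0 as Hpi. apply Rabs_def2 in Hx.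
  assert (Hc : forall u v n, n + v <> 0 -> continuity_pt (fun y => Rabs (1 + u / (y + v))) n).
  { intros u v n Hn.
    apply (continuity_pt_comp (fun y => 1 + u / (y + v)) Rabs); [|apply Rcontinuity_abs].
    apply derivable_continuous_pt, ex_derive_Reals_0. auto_derive. easy. }
  assert (Hl : forall c n, continuity_pt (fun y => Rabs (y + c)) n).
  { intros c n. apply (continuity_pt_comp (fun y => y + c) Rabs); [|apply Rcontinuity_abs].
    apply derivable_continuous_pt, ex_derive_Reals_0. auto_derive. easy. }
  destruct (Req_EM_T x 0) as [E0|E0].
  { subst x.
    rewrite (Lim_sin_pole (prefactor_raw C D)
      (fun y => Rabs (1 + (C - D) / (y + 1)) * Rabs (y + C) * Rabs (1 + D / (y + - 1))) 0).
    - replace (1 + (C - D) / (0 + 1)) with (1 + 0 + C - D) by field.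
      replace (1 + D / (0 + -1)) with (1 - 0 - D) by field. ring.
    - repeat apply continuity_pt_mult; try apply Hc; try apply Hl; lra.
    - exists (mkposreal 1 Rlt_0_1). intros y Hy Hne. simpl in Hy. rewrite Rminus_0_r in *.
      unfold prefactor_raw. rewrite <- !Rabs_mult. f_equal. unfold Rminus. field.
      apply Rabs_def2 in Hy. repeat split; lra. }
  destruct (Req_EM_T x 1) as [E1|E1].
  { subst x.
    rewrite (Lim_sin_pole (prefactor_raw C D)
      (fun y => Rabs (1 + (C - D) / (y + 1)) * Rabs (1 + C / (y + 0)) * Rabs (y + (- 1 + D))) 1).
    - replace (1 + (C - D) / (1 + 1)) with ((1 + 1 + C - D) / 2) by field.
      replace (1 + C / (1 + 0)) with (1 + C) by field.
      replace (1 + (-1 + D)) with (- (1 - 1 - D)) by ring.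
      rewrite Rabs_Ropp. unfold Rdiv. rewrite (Rabs_mult _ (/ 2)), (Rabs_pos_eq (/ 2)) by lra. field.
    - repeat apply continuity_pt_mult; try apply Hc; try apply Hl; lra.
    - exists (mkposreal 1 Rlt_0_1). intros y Hy Hne. simpl in Hy.
      unfold prefactor_raw. apply Rabs_def2 in Hy.
      replace (PI * y) with (PI * (y - 1) + IZR 1 * PI) by ring.
      rewrite (Rabs_mult 2 (sin _)), Rabs_sin_shift.
      rewrite <- !Rabs_mult. f_equal. unfold Rminus. field. repeat split; lra. }
  destruct (Req_EM_T x (-1)) as [E2|E2].
  { subst x.
    rewrite (Lim_sin_pole (prefactor_raw C D)
      (fun y => Rabs (y + (1 + (C - D))) * Rabs (1 + C / (y + 0)) * Rabs (1 + D / (y + - 1))) (-1)).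
    - replace (-1 + (1 + (C - D))) with (1 + -1 + C - D) by ring.
      replace (1 + C / (-1 + 0)) with (- (-1 + C)) by field.
      replace (1 + D / (-1 + -1)) with ((1 - -1 - D) / 2) by field.
      rewrite Rabs_Ropp. unfold Rdiv. rewrite (Rabs_mult _ (/ 2)), (Rabs_pos_eq (/ 2)) by lra. field.
    - repeat apply continuity_pt_mult; try apply Hc; try apply Hl; lra.
    - exists (mkposreal 1 Rlt_0_1). intros y Hy Hne. simpl in Hy.
      unfold prefactor_raw. apply Rabs_def2 in Hy.
      replace (PI * y) with (PI * (y - -1) + IZR (-1) * PI) by ring.
      rewrite (Rabs_mult 2 (sin _)), Rabs_sin_shift.
      rewrite <- !Rabs_mult. f_equal. unfold Rminus. field. repeat split; lra. }
  unfold prefactor_raw.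
  replace (1 + (C - D) / (x + 1)) with ((1 + x + C - D) / (1 + x)) by (field; lra).
  replace (1 + C / x) with ((x + C) / x) by (field; lra).
  replace (1 + D / (x - 1)) with ((1 - x - D) / (1 - x)) by (field; lra).
  unfold Rdiv. rewrite !Rabs_mult, !Rabs_inv.
  pose proof (Rabs_pos_lt x E0). pose proof (Rabs_pos_lt (1 + x) ltac:(lra)).
  pose proof (Rabs_pos_lt (1 - x) ltac:(lra)). field. lra.
Qed.

(** The logarithms L need not be known to converge, only to be eventually close to C lam;
    convergence of P and S then determines E. *)
Lemma limit_exp_form (P S L C : nat -> R) (g s c lam err : R) :
  (forall m, P m = S m * exp (L m)) ->
  is_lim_seq P g -> is_lim_seq S s -> is_lim_seq C c -> 0 <= err -> 0 <= s ->
  (forall m, Rabs (C m) <= 1) ->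
  (forall eps, 0 < eps -> eventually (fun m => Rabs (L m - C m * lam) <= err + eps)) ->
  exists E, Rabs E <= err /\ g = s * exp (c * lam + E).
Proof.
  intros HP Hg Hs Hc Herr Hs0 HC HL.
  assert (Hbd : eventually (fun m => Rabs (L m) <= Rabs lam + err + 1)).
  { generalize (HL 1 Rlt_0_1). apply filter_imp. intros m Hm.
    specialize (HC m).
    assert (Rabs (C m * lam) <= Rabs lam).
    { rewrite Rabs_mult. rewrite <- (Rmult_1_l (Rabs lam)) at 2.
      apply Rmult_le_compat_r; [apply Rabs_pos|easy]. }
    replace (L m) with ((L m - C m * lam) + C m * lam) by ring.
    eapply Rle_trans; [apply Rabs_triang|]. lra. }
  set (B := Rabs lam + err + 1) in *.
  destruct (Req_dec s 0) as [E0|E0].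
  (* If S tends to 0 no logarithm can be taken, but then P tends to 0 as well because exp (L m)
     stays bounded, so any E serves. *)
  - exists 0. rewrite Rabs_R0. split; [easy|]. rewrite E0, Rmult_0_l.
    assert (HP0 : is_lim_seq P 0).
    { apply is_lim_seq_abs_0.
      apply is_lim_seq_le_le_loc with (fun _ => 0) (fun m => Rabs (S m) * exp B).
      - revert Hbd. apply filter_imp. intros m Hm. split; [apply Rabs_pos|].
        rewrite HP, Rabs_mult. apply Rmult_le_compat_l; [apply Rabs_pos|].
        rewrite Rabs_pos_eq by (left; apply exp_pos). apply exp_le_compat.
        apply Rabs_le_between in Hm. lra.
      - apply is_lim_seq_const.
      - replace (Finite 0) with (Finite (Rabs s * exp B)) by (f_equal; rewrite E0, Rabs_R0; ring).
        apply is_lim_seq_mult'; [|apply is_lim_seq_const]. now apply (is_lim_seq_abs _ (Finite s)). }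
    apply is_lim_seq_unique in HP0. apply is_lim_seq_unique in Hg.
    rewrite Hg in HP0. now injection HP0.
  - assert (Hsp : 0 < s) by lra.
    assert (Hev : eventually (fun m => 0 < S m)).
    { apply is_lim_seq_spec in Hs. destruct (Hs (mkposreal s Hsp)) as [N HN].
      exists N. intros m Hm. specialize (HN m Hm). simpl in HN. apply Rabs_def2 in HN. lra. }
    assert (Hexp : is_lim_seq (fun m => exp (L m)) (g / s)).
    { apply is_lim_seq_ext_loc with (fun m => P m / S m).
      - revert Hev. apply filter_imp. intros m Hm. rewrite HP. field. lra.
      - now apply is_lim_seq_div'. }
    assert (Hgs : exp (- B) <= g / s).
    { apply (is_lim_seq_le_loc (fun _ => exp (- B)) (fun m => exp (L m)) (exp (- B)) (g / s)).
      - revert Hbd. apply filter_imp. intros m Hm. apply exp_le_compat.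
        apply Rabs_le_between in Hm. lra.
      - apply is_lim_seq_const.
      - exact Hexp. }
    pose proof (exp_pos (- B)) as HBp.
    assert (HLl : is_lim_seq L (ln (g / s))).
    { apply is_lim_seq_ext with (fun m => ln (exp (L m))); [intros; apply ln_exp|].
      apply (is_lim_seq_continuous ln); [|exact Hexp].
      apply derivable_continuous_pt. exists (/ (g / s)). apply derivable_pt_lim_ln. lra. }
    exists (ln (g / s) - c * lam). split.
    + apply le_epsilon. intros eps Heps.
      assert (HD : is_lim_seq (fun m => Rabs (L m - C m * lam)) (Rabs (ln (g / s) - c * lam))).
      { apply (is_lim_seq_abs _ (Finite _)). apply is_lim_seq_minus'; [exact HLl|].
        apply (is_lim_seq_mult' C (fun _ => lam)); [exact Hc|apply is_lim_seq_const]. }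
      apply (is_lim_seq_le_loc _ (fun _ => err + eps) _ (err + eps) (HL eps Heps) HD).
      apply is_lim_seq_const.
    + replace (c * lam + (ln (g / s) - c * lam)) with (ln (g / s)) by ring.
      rewrite exp_ln by lra. field. lra.
Qed.

(** * Periodicity, bounds for C_k, and assembly *)

Lemma cf_digit_periodic alpha k0 p n m :
  (forall n, (k0 < n)%nat -> cf_digit alpha (n + p) = cf_digit alpha n) ->
  (k0 < n)%nat -> cf_digit alpha (n + m * p) = cf_digit alpha n.
Proof.
  intros Hper Hn. induction m as [|m IH]; [simpl; now rewrite Nat.add_0_r|].
  replace (n + S m * p)%nat with (n + m * p + p)%nat by lia. rewrite Hper by lia. exact IH.
Qed.

Lemma digit_growth_bound alpha k0 p T :
  (1 <= p)%nat ->
  (forall n, (k0 < n)%nat -> cf_digit alpha (n + p) = cf_digit alpha n) ->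
  (forall r, (1 <= r <= p)%nat -> ln (aR alpha (k0 + r)) / aR alpha (k0 + r + 1) <= T) ->
  forall n, (k0 < n)%nat -> ln (aR alpha n) / aR alpha (n + 1) <= T.
Proof.
  intros Hp Hper HT n Hn.
  pose proof (Nat.div_mod (n - k0 - 1) p ltac:(lia)) as D.
  pose proof (Nat.mod_upper_bound (n - k0 - 1) p ltac:(lia)) as B.
  set (m := ((n - k0 - 1) / p)%nat) in *. set (r := ((n - k0 - 1) mod p)%nat) in *.
  specialize (HT (S r) ltac:(lia)).
  replace n with (k0 + S r + m * p)%nat by lia.
  replace (k0 + S r + m * p + 1)%nat with (k0 + S r + 1 + m * p)%nat by lia.
  unfold aR in *. rewrite !(cf_digit_periodic alpha k0 p) by (easy || lia). exact HT.
Qed.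

Lemma qden_theta_eq alpha k : irrational alpha ->
  INR (qden alpha (S k)) * theta alpha k
  = / (cf_state alpha (S (S k)) + INR (qden alpha k) / INR (qden alpha (S k))).
Proof.
  intros Ha. unfold theta. pose proof (cf_state_gt_1 alpha (S k) Ha).
  pose proof (lt_0_INR _ (qden_pos alpha k Ha)). pose proof (lt_0_INR _ (qden_pos alpha (S k) Ha)).
  field. split; [lra|]. apply Rgt_not_eq. nra.
Qed.

(* For the index i = 2 and partial quotient 1 this is C {2 beta} <= min (1, 2 beta) / (1 + beta) <= 2/3. *)
Lemma shift_not_past_zero (q' q : nat) (C a x : R) :
  (0 < q' <= q)%nat -> Nat.gcd q' q = 1%nat -> 1 <= a ->
  0 <= C -> C <= / a -> C <= / (1 + INR q' / INR q) ->
  Rabs x <= Rmax 1 (2 - 2 / a) ->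
  forall j, (2 <= j <= q - 2)%nat ->
    C * (1 - frac_mul q' q j) <= 2 / 3 * (INR q - (INR j + x)).
Proof.
  intros Hq Hg Ha HC0 HCa HCb Hx j Hj.
  assert (Hq0 : 0 < INR q) by (apply lt_0_INR; lia).
  assert (Hq'0 : 0 < INR q') by (apply lt_0_INR; lia).
  rewrite <- frac_mul_sym by (easy || lia).
  pose proof (frac_mul_bounds q' q (q - j) ltac:(lia)) as Hf.
  pose proof (frac_mul_floor q' q (q - j) ltac:(lia)) as Hf2.
  pose proof (pos_INR ((q - j) * q' / q)) as Hfl.
  assert (Hi : INR (q - j) = INR q - INR j) by (apply minus_INR; lia).
  replace (INR q - (INR j + x)) with (INR (q - j) - x) by lra.
  assert (Hi2 : (q - j = 2 \/ 3 <= q - j)%nat) by lia.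
  pose proof (Rle_abs x) as Hxa.
  set (i := (q - j)%nat) in *. set (f := frac_mul q' q i) in *.
  set (b := INR q' / INR q) in *. assert (Hb0 : 0 < b) by (now apply Rdiv_lt_0_compat).
  assert (HCf : C * f <= C) by nra.
  pose proof (Rinv_unit a Ha) as Hia.
  destruct (Rle_dec 2 a) as [H2|H2].
  - assert (Hmax : Rabs x <= 2 - 2 / a).
    { rewrite Rmax_right in Hx; [easy|]. unfold Rdiv.
      assert (/ a <= / 2) by (apply Rinv_le_contravar; lra). lra. }
    assert (2 <= INR i) by (apply (le_INR 2); lia). unfold Rdiv in *. lra.
  - assert (Hmax : Rabs x <= 1).
    { rewrite Rmax_left in Hx; [easy|]. unfold Rdiv.
      assert (/ 2 < / a) by (apply Rinv_lt_contravar; lra). lra. }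
    destruct Hi2 as [Hi2|Hi2].
    + rewrite Hi2 in *. simpl (INR 2) in *.
      assert (Hcf : C * (1 + b) <= 1).
      { apply Rmult_le_reg_r with (/ (1 + b)); [apply Rinv_0_lt_compat; lra|].
        rewrite Rmult_assoc, Rinv_r, Rmult_1_r, Rmult_1_l by lra. exact HCb. }
      assert (C * f <= 2 / 3).
      { destruct (Rle_dec b (1 / 2)).
        - apply Rle_trans with (C * (2 * b)); [apply Rmult_le_compat_l; lra|]. nra.
        - nra. }
      lra.
    + apply le_INR in Hi2. simpl (INR 3) in Hi2. lra.
Qed.

Lemma qden_theta_bounds alpha k : irrational alpha ->
  let c := INR (qden alpha (S k)) * theta alpha k in
  0 <= c /\ c <= / aR alpha (S (S k)) /\
  c <= / (1 + INR (qden alpha k) / INR (qden alpha (S k))).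
Proof.
  intros Ha c. unfold c. rewrite qden_theta_eq by easy.
  pose proof (cf_state_gt_1 alpha (S k) Ha). pose proof (cf_state_digit alpha (S (S k))).
  pose proof (aR_ge_1 alpha (S (S k)) Ha ltac:(lia)).
  pose proof (lt_0_INR _ (qden_pos alpha k Ha)). pose proof (lt_0_INR _ (qden_pos alpha (S k) Ha)).
  assert (0 < INR (qden alpha k) / INR (qden alpha (S k))) by (now apply Rdiv_lt_0_compat).
  split; [left; apply Rinv_0_lt_compat; lra|].
  split; apply Rinv_le_contravar; lra.
Qed.

(* The error terms of [log_ratio_approx] and [first_order_limit], multiplied by C <= 1 / a'. *)
Lemma total_error_le (T lp la s a a' K : R) :
  1 <= T -> 0 <= lp -> 0 <= la -> 0 < s <= 2 -> 1 <= a -> 1 <= a' -> 0 <= K ->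
  864 * (/ a') ^ 2 / s ^ 2
  + / a' * ((71 + (lp + 1 + K + 6 * (T + 1 + K))) / a + 1040 * (1 + la) / (s * a))
  <= (1300 + 14 * K) * ((T + (lp + la)) / (s * a * a') + T / (s ^ 2 * a' ^ 2)).
Proof.
  intros HT Hlp Hla Hs Ha Ha' HK.
  set (u := / (s * a * a')). set (v := / (s ^ 2 * a' ^ 2)).
  assert (Hu : 0 < u) by (apply Rinv_0_lt_compat; repeat apply Rmult_lt_0_compat; lra).
  assert (Hv : 0 < v) by (apply Rinv_0_lt_compat; apply Rmult_lt_0_compat; apply pow_lt; lra).
  replace (864 * (/ a') ^ 2 / s ^ 2) with (864 * v) by (unfold v; field; lra).
  replace (/ a' * ((71 + (lp + 1 + K + 6 * (T + 1 + K))) / a + 1040 * (1 + la) / (s * a)))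
    with (((71 + (lp + 1 + K + 6 * (T + 1 + K))) * s + 1040 * (1 + la)) * u)
    by (unfold u; field; lra).
  replace ((T + (lp + la)) / (s * a * a')) with ((T + (lp + la)) * u) by (unfold u, Rdiv; ring).
  replace (T / (s ^ 2 * a' ^ 2)) with (T * v) by (unfold v, Rdiv; ring).
  rewrite (Rmult_plus_distr_l (1300 + 14 * K)), (Rplus_comm (864 * v)). apply Rplus_le_compat.
  - rewrite <- Rmult_assoc. apply Rmult_le_compat_r; [lra|].
    set (w := 71 + (lp + 1 + K + 6 * (T + 1 + K))).
    assert (Hw : w * s <= w * 2) by (apply Rmult_le_compat_l; unfold w; lra).
    assert (H1 : K * 1 <= K * T) by (apply Rmult_le_compat_l; lra).
    assert (H2 : 0 <= K * (lp + la)) by (apply Rmult_le_pos; lra).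
    unfold w in *. lra.
  - rewrite <- Rmult_assoc. apply Rmult_le_compat_r; [lra|].
    assert (H1 : 0 <= K * T) by (apply Rmult_le_pos; lra). lra.
Qed.

Theorem theorem4 :
  exists K : R, 0 < K /\
  forall (alpha : R) (k0 p : nat) (T : R) (G : nat -> R -> R) (C D : nat -> R),
    irrational alpha ->
    (1 <= p)%nat ->
    (* eventually periodic: a_{n+p} = a_n for all n >= k0+1 *)
    (forall n : nat, (k0 < n)%nat -> cf_digit alpha (n + p) = cf_digit alpha n) ->
    1 <= T ->
    (forall r : nat, (1 <= r <= p)%nat ->
       ln (aR alpha (k0 + r)) / aR alpha (k0 + r + 1) <= T) ->
    (* G_{alpha,r}(x) = lim_{m} P_{q_k}(alpha, (-1)^k x / q_k), k = k0 + r + m p *)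
    (forall (r : nat) (x : R), (1 <= r <= p)%nat ->
       is_lim_seq
         (fun m : nat =>
            sudler alpha
              ((-1) ^ (k0 + r + m * p) * x / INR (qden alpha (k0 + r + m * p)))
              (qden alpha (k0 + r + m * p)))
         (G r x)) ->
    (* C_r = lim q_{k0+r+mp} || q_{k0+r+mp} alpha || *)
    (forall r : nat, (1 <= r <= p)%nat ->
       is_lim_seq
         (fun m : nat =>
            INR (qden alpha (k0 + r + m * p))
            * dist_int (INR (qden alpha (k0 + r + m * p)) * alpha))
         (C r)) ->
    (* D_r = lim q_{k0+r-1+mp} || q_{k0+r+mp} alpha || *)
    (forall r : nat, (1 <= r <= p)%nat ->
       is_lim_seq
         (fun m : nat =>
            INR (qden alpha (k0 + r - 1 + m * p))
            * dist_int (INR (qden alpha (k0 + r + m * p)) * alpha))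
         (D r)) ->
    forall (r : nat) (x : R),
      (1 <= r <= p)%nat ->
      Rabs x <= Rmax 1 (2 - 2 / aR alpha (k0 + r + 1)) ->
      exists E : R,
        Rabs E <= K * ( (T + ln (aR alpha (k0 + r - 1 + p) * aR alpha (k0 + r)))
                          / ((2 - Rabs x) * aR alpha (k0 + r) * aR alpha (k0 + r + 1))
                        + T / ((2 - Rabs x) ^ 2 * aR alpha (k0 + r + 1) ^ 2) ) /\
        G r x = prefactor (C r) (D r) x
                * exp (C r * (ln (aR alpha (k0 + r) / (2 * PI)) - digamma (2 + x)) + E).
Proof.
  pose proof saw_const_pos as HK.
  (* 14 = 2 (1 + 6): [saw_const] enters [rho] once directly and six times through
     [saw_bound_eventually], and 2 - |x| is at most 2. The 1300 exceeds 2 (71 + 1 + 6) + 12 +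
     1040. *)
  exists (1300 + 14 * saw_const). split; [lra|].
  intros alpha k0 p T G C D Ha Hp Hper HT Hdig0 HG HC HD r x Hr Hx.
  pose proof (digit_growth_bound alpha k0 p T Hp Hper Hdig0) as Hdig.
  pose proof (aR_ge_1 alpha (k0 + r) Ha ltac:(lia)) as HA1.
  pose proof (aR_ge_1 alpha (k0 + r + 1) Ha ltac:(lia)) as HA2.
  pose proof (aR_ge_1 alpha (k0 + r - 1 + p) Ha ltac:(lia)) as HA0.
  set (a := aR alpha (k0 + r)) in *. set (a1 := aR alpha (k0 + r + 1)) in *.
  set (a0 := aR alpha (k0 + r - 1 + p)) in *.
  assert (Hx2 : Rabs x < 2).
  { eapply Rle_lt_trans; [exact Hx|]. apply Rmax_lub_lt; [lra|].
    assert (0 < 2 / a1) by (apply Rdiv_lt_0_compat; lra). lra. }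
  (* [J m] is the index of q_(k-2). Starting four periods late keeps the subtraction of 2 exact and
     guarantees q >= 4, without changing any limit. *)
  pose (J := fun m => (k0 + r + (m + 4) * p - 2)%nat).
  assert (HJ2 : forall m, S (S (J m)) = (k0 + r + (m + 4) * p)%nat) by (intros; unfold J; nia).
  assert (HJ1 : forall m, S (J m) = (k0 + r - 1 + (m + 4) * p)%nat) by (intros; unfold J; nia).
  set (A := Z.to_nat (cf_digit alpha (k0 + r))).
  assert (HAR : INR A = a) by (apply INR_cf_digit; [easy|lia]).
  assert (HA : (1 <= A)%nat) by (apply INR_le; rewrite HAR; exact HA1).
  pose (q := fun m => qden alpha (S (S (J m)))).
  pose (q' := fun m => qden alpha (S (J m))).
  pose (q'' := fun m => qden alpha (J m)).
  assert (Hdigit : forall m, cf_digit alpha (S (S (J m))) = cf_digit alpha (k0 + r)).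
  { intros m. rewrite HJ2. apply cf_digit_periodic with k0; [easy|lia]. }
  assert (Hdigit1 : forall m, aR alpha (S (S (S (J m)))) = a1).
  { intros m. rewrite HJ2. replace (S (k0 + r + (m + 4) * p)) with (k0 + r + 1 + (m + 4) * p)%nat by lia.
    unfold a0, a1, aR. f_equal. apply cf_digit_periodic with k0; [easy|lia]. }
  (* For r = 1 the index k0 + r - 1 lies before the period, so the digit is compared with the one a
     period later. *)
  assert (Hdigit0 : forall m, aR alpha (S (J m)) = a0).
  { intros m. rewrite HJ1. replace (k0 + r - 1 + (m + 4) * p)%nat with (k0 + r - 1 + p + (m + 3) * p)%nat by lia.
    unfold a0, a1, aR. f_equal. apply cf_digit_periodic with k0; [easy|lia]. }
  assert (Hqrec : forall m, (q m = A * q' m + q'' m)%nat).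
  { intros m. unfold q, q', q'', A. rewrite qden_SS, Hdigit. reflexivity. }
  assert (Hq''0 : forall m, (1 <= q'' m)%nat) by (intros; now apply qden_pos).
  assert (Hq'0 : forall m, (0 < q' m)%nat) by (intros m; pose proof (qden_pos alpha (S (J m)) Ha); unfold q'; lia).
  assert (Hq'' : forall m, (q'' m <= q' m)%nat) by (intros; now apply qden_le_S).
  assert (Hg : forall m, Nat.gcd (q' m) (q m) = 1%nat) by (intros; apply qden_coprime).
  assert (Hqm : forall m, (m + 4 <= q m)%nat).
  { intros m. unfold q. pose proof (qden_ge alpha (S (S (J m))) Ha) as H. rewrite HJ2 in *. nia. }
  assert (Hqlim : is_lim_seq (fun m => INR (q m)) p_infty).
  { apply is_lim_seq_le_p_loc with INR; [|apply is_lim_seq_INR].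
    exists 0%nat. intros m _. apply le_INR. specialize (Hqm m). lia. }
  destruct (saw_bound_eventually alpha k0 T Ha HT Hdig) as [k1 Hk1].
  set (rho := ln (a0) + 1 + saw_const + 6 * (T + 1 + saw_const)).
  assert (Hrho : eventually (fun m => forall M, (M < q' m)%nat ->
       Rabs (sawsum (q'' m) (q' m) M) <= rho)).
  { exists k1. intros m Hm M HM. specialize (Hk1 (J m) ltac:(unfold J; nia) M HM).
    rewrite Hdigit0 in Hk1. exact Hk1. }
  pose (bt := fun m => INR (q' m) / INR (q m)).
  pose (Cm := fun m => INR (q m) * theta alpha (S (J m))).
  assert (HCm : forall m, 0 <= Cm m /\ Cm m <= / a1 /\
                          Cm m <= / (1 + bt m)).
  { intros m. pose proof (qden_theta_bounds alpha (S (J m)) Ha) as H. cbv zeta in H.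
    rewrite Hdigit1 in H. exact H. }
  assert (HCl : is_lim_seq Cm (C r)).
  { specialize (HC r Hr). apply (is_lim_seq_incr_n _ 4) in HC.
    eapply is_lim_seq_ext; [|exact HC]. intros m. cbv beta. rewrite <- HJ2.
    rewrite dist_int_qden by easy. reflexivity. }
  assert (HDl : is_lim_seq (fun m => Cm m * bt m) (D r)).
  { specialize (HD r Hr). apply (is_lim_seq_incr_n _ 4) in HD.
    eapply is_lim_seq_ext; [|exact HD]. intros m. cbv beta. rewrite <- HJ2, <- HJ1.
    rewrite dist_int_qden by easy. unfold Cm, bt, q, q'.
    pose proof (lt_0_INR _ (qden_pos alpha (S (S (J m))) Ha)). field. lra. }
  pose (Pm := fun m => sudler alpha ((-1) ^ (S (S (J m))) * x / INR (q m)) (q m)).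
  assert (HPl : is_lim_seq Pm (G r x)).
  { specialize (HG r x Hr). apply (is_lim_seq_incr_n _ 4) in HG.
    eapply is_lim_seq_ext; [|exact HG]. intros m. cbv beta. rewrite <- HJ2. reflexivity. }
  pose (Sm := fun m => Rabs (2 * sin (PI * (x + Cm m) / INR (q m)))
     * Rabs (2 * sin (PI * (1 + x + Cm m - Cm m * bt m) / INR (q m)))
     * Rabs (2 * sin (PI * (1 - x - Cm m * bt m) / INR (q m))) * bulk (q m) x).
  pose (Lm := fun m => log_ratio (q' m) (q m) (Cm m) x).
  assert (Hcond : forall m j, (2 <= j <= q m - 2)%nat ->
     Cm m * (1 - frac_mul (q' m) (q m) j) <= 2 / 3 * (INR (q m) - (INR j + x))).
  { intros m. destruct (HCm m) as (H1 & H2 & H3).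
    specialize (Hq'0 m). specialize (Hqrec m).
    apply (shift_not_past_zero _ _ _ (a1)); try easy. split; [easy|nia]. }
  assert (HPS : forall m, Pm m = Sm m * exp (Lm m)).
  { intros m. unfold Pm, q. rewrite sudler_reindex by easy. fold (q m) (q' m) (Cm m).
    specialize (Hqm m). specialize (Hq'0 m). specialize (Hqrec m). specialize (Hq''0 m).
    pose proof (sudler_factor (q' m) (q m) (Cm m) x ltac:(lia) ltac:(nia) (Hg m)
      (proj1 (HCm m)) Hx2 (Hcond m)) as H. exact H. }
  assert (HSl : is_lim_seq Sm (prefactor (C r) (D r) x)).
  { rewrite prefactor_eq by easy. pose proof PI_RGT_0 as Hpi.
    apply is_lim_seq_ext with (fun m =>
       (INR (q m) / (2 * PI) * Rabs (2 * sin (PI * (x + Cm m) / INR (q m))))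
     * (INR (q m) / (2 * PI) * Rabs (2 * sin (PI * (1 + x + Cm m - Cm m * bt m) / INR (q m))))
     * (INR (q m) / (2 * PI) * Rabs (2 * sin (PI * (1 - x - Cm m * bt m) / INR (q m))))
     * ((2 * PI / INR (q m)) ^ 3 * bulk (q m) x)).
    - intros m. unfold Sm. assert (0 < INR (q m)) by (apply lt_0_INR; specialize (Hqm m); lia).
      field. lra.
    - repeat apply is_lim_seq_mult'.
      + apply (sin_scaled_limit q (fun m => x + Cm m)); [easy|].
        apply is_lim_seq_plus'; [apply is_lim_seq_const|easy].
      + apply (sin_scaled_limit q (fun m => 1 + x + Cm m - Cm m * bt m)); [easy|].
        apply is_lim_seq_minus'; [|easy].
        apply is_lim_seq_plus'; [apply is_lim_seq_const|easy].
      + apply (sin_scaled_limit q (fun m => 1 - x - Cm m * bt m)); [easy|].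
        apply is_lim_seq_minus'; [apply is_lim_seq_const|easy].
      + now apply bulk_limit. }
  pose proof (Rabs_pos x) as Hx0.
  assert (Hln0 : 0 <= ln (a0)) by (rewrite <- ln_1; apply ln_le; lra).
  assert (Hln1 : 0 <= ln (a)) by (rewrite <- ln_1; apply ln_le; lra).
  pose proof (total_error_le T _ _ (2 - Rabs x) (a) (a1) saw_const
     HT Hln0 Hln1 ltac:(lra) HA1 HA2 ltac:(lra)) as Herr.
  rewrite <- ln_mult in Herr by lra. fold rho in Herr.
  assert (Hi : 0 < / a1 <= 1) by now apply Rinv_unit.
  assert (Hs2 : 0 < / (2 - Rabs x) ^ 2) by (apply Rinv_0_lt_compat, pow_lt; lra).
  set (err := (71 + rho) / a
     + 1040 * (1 + ln (a)) / ((2 - Rabs x) * a)) in *.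
  assert (Herr0 : 0 <= err).
  { unfold err, rho. apply Rplus_le_le_0_compat; apply Rdiv_le_0_compat; try lra.
    apply Rmult_lt_0_compat; lra. }
  apply (limit_exp_form Pm Sm Lm Cm); try easy.
  - eapply Rle_trans; [|exact Herr]. apply Rplus_le_le_0_compat.
    + unfold Rdiv. apply Rmult_le_pos; [|lra]. pose proof (pow2_ge_0 (/ a1)). lra.
    + apply Rmult_le_pos; lra.
  - rewrite prefactor_eq by easy. pose proof PI_RGT_0.
    repeat apply Rmult_le_pos; try apply Rabs_pos. unfold kappa.
    destruct (Req_EM_T x 0); [lra|]. destruct (Req_EM_T x 1); [lra|].
    destruct (Req_EM_T x (-1)); [lra|].
    apply Rdiv_le_0_compat; [apply Rabs_pos|].
    repeat apply Rmult_lt_0_compat; apply Rabs_pos_lt; lra.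
  - intros m. destruct (HCm m) as (H1 & H2 & H3). rewrite Rabs_pos_eq; lra.
  - intros eps Heps.
    pose proof (first_order_limit q q' q'' A rho x HA Hq'0 Hg Hqrec Hq'' Hqlim Hrho Hx2 eps Heps) as HF.
    revert HF. apply filter_imp. intros m HF. rewrite HAR in HF. fold err in HF.
    destruct (HCm m) as (H1 & H2 & H3).
    pose proof (log_ratio_approx (q' m) (q m) (Cm m) x ltac:(specialize (Hqm m); lia) H1 Hx2 (Hcond m)) as HL.
    fold (Lm m) in HL. set (F := first_order (q' m) (q m) x) in *.
    set (lam := ln (a / (2 * PI)) - digamma (2 + x)) in *.
    assert (HCF : Rabs (Cm m * (F - lam)) <= / a1 * err + eps).
    { rewrite Rabs_mult, (Rabs_pos_eq (Cm m)) by easy.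
      apply Rle_trans with (/ a1 * (err + eps)).
      - apply Rmult_le_compat; try easy. apply Rabs_pos.
      - nra. }
    assert (HC2 : 864 * Cm m ^ 2 / (2 - Rabs x) ^ 2
      <= 864 * (/ a1) ^ 2 / (2 - Rabs x) ^ 2).
    { unfold Rdiv. apply Rmult_le_compat_r; [lra|]. apply Rmult_le_compat_l; [lra|].
      apply pow_incr. lra. }
    replace (Lm m - Cm m * lam) with ((Lm m - Cm m * F) + Cm m * (F - lam)) by ring.
    eapply Rle_trans; [apply Rabs_triang|]. lra.
Qed.
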